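(* Let $c_0,c_1,c_2,c_3,\gamma_0$ be positive constants with $c_0\le c_1$, and let $\phi$ be a sigmoid satisfying the Sigmoid Condition with constants $b_1,b_2,b_3>0$. Then there exists a constant $C>0$, depending only on $c_0,c_1,c_2,c_3,\gamma_0,b_1,b_2,b_3$, such that for all $T,d\ge 1$ and all deterministic data $\{y_t(1),y_t(0),x_t\}_{t=1}^T$ (with $x_t\in\mathbb R^d$) satisfying Assumptions 1, 2 and 3 with these constants, the Neyman regret under the Sigmoid-FTRL design run with sigmoid $\phi$ satisfies $$\mathcal R^{\mathrm{Neyman}}_T\le C\cdot T^{-1/2}R,\qquad R=\max_{t\in[T]}\|x_t\|.$$
   Context: **Setting.** Let $T,d\ge1$, $[T]=\{1,\dots,T\}$. The data are deterministic: covariates $x_t\in\mathbb R^d$ and potential outcomes $y_t(1),y_t(0)\in\mathbb R$ for $t\in[T]$. In round $t$ a random treatment $Z_t\in\{0,1\}$ is assigned and $Y_t=y_t(Z_t)$ is observed; treatment assignment is the only randomness. $\mathcal F_t=\sigma(Z_1,\dots,Z_t)$. An adaptive design specifies in round $t$, as functions of $Z_1,x_1,Y_1,\dots,Z_{t-1},x_{t-1},Y_{t-1},x_t$, the probability $p_t=\Pr(Z_t=1\mid\mathcal F_{t-1})$ and linear predictors $\beta_t(1),\beta_t(0)\in\mathbb R^d$. The adaptive AIPW estimator is $$\hat\tau=\frac1T\sum_{t=1}^T\Big\{\langle x_t,\beta_t(1)\rangle-\langle x_t,\beta_t(0)\rangle+\frac{\mathbf 1[Z_t=1]}{p_t}(Y_t-\langle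 x_t,\beta_t(1)\rangle)-\frac{\mathbf 1[Z_t=0]}{1-p_t}(Y_t-\langle x_t,\beta_t(0)\rangle)\Big\}.$$ **Neyman regret.** The oracle variance $V^*=\min_{p\in(0,1),\,\beta(1),\beta(0)\in\mathbb R^d}\mathrm{Var}(\hat\tau;p,\beta(1),\beta(0))$, where $\mathrm{Var}(\hat\tau;p,\beta(1),\beta(0))$ is the variance of $\hat\tau$ under the non-adaptive design $p_t=p$, $\beta_t(k)=\beta(k)$ for all $t$. The Neyman regret of a design is $\mathcal R^{\mathrm{Neyman}}_T=T\,\mathrm{Var}(\hat\tau)-T\,V^*$. **Assumption 1 (constants $0<c_0\le c_1$).** For both $k\in\{0,1\}$: $c_0\le\min_{\beta\in\mathbb R^d}\big(\frac1T\sum_{t=1}^T(y_t(k)-\langle x_t,\beta\rangle)^2\big)^{1/2}\le\big(\frac1T\sum_{t=1}^Ty_t(k)^4\big)^{1/4}\le c_1$. **Assumption 2 (constants $c_2,\gamma_0>0$).** For all $t\in[T]$ with $t\ge T^{1/2}\gamma_0$: $\sigma_{\min}\big(\frac1t\sum_{s\le t}x_sx_s^{\top}\big)\ge 1/c_2$. **Assumption 3 (constant $c_3>0$).** $R=\max_{t\in[T]}\|x_t\|\le c_3T^{1/4}$. **Sigmoid Condition (constants $b_1,b_2,b_3>0$).** $\phi:\mathbb R\to(0,1)$ satisfies: (1) $\phi$ is strictly increasing, $\phi(u)+\phi(-u)=1$, $\lim_{u\to+\infty}\phi(u)=1$; (2) $u\mapsto1/\phi(u)$ and $u\mapsto1/(1-\phi(u))$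 are convex; (3a) $-(1/\phi(u))'\le b_1$ for all $u\in\mathbb R$; (3b) $(1/\phi(u))''\le b_2(1+|u|)^{-3}$ for all $u\in\mathbb R$ except finitely many points; (3c) $(1/\phi(u))''\ge b_3(1+u)^{-3}$ for all $u\ge0$ except finitely many points. **Sigmoid-FTRL design.** Input: sigmoid $\phi$. Let $\psi(u)=\frac12u^2+|u|^3$ and $\Psi=\psi\circ\phi^{-1}:(0,1)\to[0,\infty)$; $R_0=1$. For $t=1,\dots,T$: observe $x_t$; set $R_t=\max(R_{t-1},\|x_t\|)$, $\eta_t=T^{-1/2}R_t^{-1}$; $\beta_t(1)=\arg\min_{\beta}\sum_{s<t}\big(Y_s\frac{\mathbf1[Z_s=1]}{p_s}-\langle x_s,\beta\rangle\big)^2+\eta_t^{-1}\|\beta\|^2$, $\ \beta_t(0)=\arg\min_{\beta}\sum_{s<t}\big(Y_s\frac{\mathbf1[Z_s=0]}{1-p_s}-\langle x_s,\beta\rangle\big)^2+\eta_t^{-1}\|\beta\|^2$; $\widehat A_{t-1}(1)=\sum_{s<t}\frac{\mathbf1[Z_s=1]}{p_s}(Y_s-\langle x_s,\beta_s(1)\rangle)^2$, $\ \widehat A_{t-1}(0)=\sum_{s<t}\frac{\mathbf1[Z_s=0]}{1-p_s}(Y_s-\langle x_s,\beta_s(0)\rangle)^2$; $p_t=\arg\min_{p\in(0,1)}\frac{\widehat A_{t-1}(1)}p+\frac{\widehat A_{t-1}(0)}{1-p}+\eta_t^{-1}\Psi(p)$; then draw $Z_t=1$ with (conditional) probability $p_t$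 and $Z_t=0$ otherwise, and observe $Y_t$.
   Formalization: The bound of Assumption 2 is also required at t = T; this is automatic when T ≥ γ0². For T < γ0² Assumption 2 is vacuous and the claim can fail: γ0 = 2, T = d = 1, x_1 = 0, y_1(1) = 1, y_1(0) = 2 gives regret 1 while R = 0. *)

(* Defs.v *)
From HB Require Import structures.
From mathcomp Require Export all_boot all_order all_algebra.
From mathcomp Require Export all_classical all_reals all_analysis.

Set Implicit Arguments.
Unset Strict Implicit.
Unset Printing Implicit Defensive.

Export Order.TTheory GRing.Theory Num.Theory.
Export numFieldNormedType.Exports.

Local Open Scope classical_set_scope.
Local Open Scope ring_scope.

(* The library's norm on matrices is the sup norm, hence the explicit
   Euclidean one. *)
Definition dotp (R : realType) (d : nat) (u v : 'cV[R]_d) : R :=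
  \sum_(i < d) u i 0 * v i 0.

Definition enorm (R : realType) (d : nat) (u : 'cV[R]_d) : R :=
  Num.sqrt (dotp u u).

Definition singular_value (R : realType) (d : nat) (A : 'M[R]_d) (s : R) :
  Prop := 0 <= s /\ eigenvalue (A^T *m A) (s ^+ 2).

Definition sigma_min (R : realType) (d : nat) (A : 'M[R]_d) : R :=
  inf [set s | singular_value A s].

(* A minimizer of f on D, chosen by classical choice; meaningful when one
   exists. *)
Definition argmin (R : realType) (A : pointedType) (D : set A) (f : A -> R) :
  A := get [set a | D a /\ forall b, D b -> f a <= f b].

(* Indexing: the rounds 1, ..., T of the experiment are the indices
   0, ..., T - 1 of the sequences x and y; values at indices >= T are never
   used.  Arms are booleans: y true t and y false t are the potential outcomes
   y_{t+1}(1) and y_{t+1}(0). *)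

Record decision (R : realType) (d : nat) := Decision {
  prob : R;
  predictor : bool -> 'cV[R]_d }.

Record round (R : realType) (d : nat) := Round {
  cov : 'cV[R]_d;
  treat : bool;
  resp : R;
  dec : decision R d }.

(* From the past rounds, oldest first, and the current covariate. Past
   decisions are functions of the past observations, so recording them gives a
   design no further information. *)
Definition design (R : realType) (d : nat) :=
  seq (round R d) -> 'cV[R]_d -> decision R d.

Definition arm_prob (R : realType) (p : R) (k : bool) : R :=
  if k then p else 1 - p.

(* The factor 1[Z = k] / Pr(Z = k) of a round. *)
Definition ipw (R : realType) (d : nat) (r : round R d) (k : bool) : R :=
  (treat r == k)%:R / arm_prob (prob (dec r)) k.

(* The rounds that occur when the treatments Z_1, Z_2, ... are those of z. *)
Definition rounds (R : realType) (d : nat) (D : design R d)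
    (x : nat -> 'cV[R]_d) (y : bool -> nat -> R) (z : seq bool) :
    seq (round R d) :=
  foldl (fun past k =>
    let t := size past in
    rcons past (Round (x t) k (y k t) (D past (x t)))) [::] z.

(* The law of (Z_1, ..., Z_T) under D: the product of the conditional
   probabilities of the successive assignments. *)
Definition path_prob (R : realType) (d : nat) (D : design R d)
    (x : nat -> 'cV[R]_d) (y : bool -> nat -> R) (z : seq bool) : R :=
  \prod_(r <- rounds D x y z) arm_prob (prob (dec r)) (treat r).

Definition aipw_term (R : realType) (d : nat) (r : round R d) : R :=
  let fit k := dotp (cov r) (predictor (dec r) k) in
  fit true - fit false
  + ipw r true * (resp r - fit true) - ipw r false * (resp r - fit false).

Definition aipw (R : realType) (d T : nat) (D : design R d)
    (x : nat -> 'cV[R]_d) (y : bool -> nat -> R) (z : T.-tuple bool) : R :=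
  T%:R^-1 * \sum_(r <- rounds D x y z) aipw_term r.

Definition expectation (R : realType) (d T : nat) (D : design R d)
    (x : nat -> 'cV[R]_d) (y : bool -> nat -> R)
    (X : T.-tuple bool -> R) : R :=
  \sum_(z : T.-tuple bool) path_prob D x y z * X z.

Definition aipw_variance (R : realType) (d T : nat) (D : design R d)
    (x : nat -> 'cV[R]_d) (y : bool -> nat -> R) : R :=
  let E := expectation (T := T) D x y in
  let tau := aipw (T := T) D x y in
  E (fun z => (tau z - E tau) ^+ 2).

Definition nonadaptive (R : realType) (d : nat) (p : R)
    (beta : bool -> 'cV[R]_d) : design R d :=
  fun _ _ => Decision p beta.

Definition oracle_variance (R : realType) (d T : nat)
    (x : nat -> 'cV[R]_d) (y : bool -> nat -> R) : R :=
  inf [set v | exists (p : R) (beta : bool -> 'cV[R]_d),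
         0 < p < 1 /\ v = aipw_variance T (nonadaptive p beta) x y].

Definition neyman_regret (R : realType) (d T : nat) (D : design R d)
    (x : nat -> 'cV[R]_d) (y : bool -> nat -> R) : R :=
  T%:R * aipw_variance T D x y - T%:R * oracle_variance T x y.

Definition max_enorm (R : realType) (d T : nat) (x : nat -> 'cV[R]_d) : R :=
  \big[Num.max/0]_(t < T) enorm (x t).

(* (1/t) (x_1 x_1^T + ... + x_t x_t^T) *)
Definition gram (R : realType) (d : nat) (x : nat -> 'cV[R]_d) (t : nat) :
    'M[R]_d :=
  t%:R^-1 *: \sum_(s < t) x s *m (x s)^T.

Definition outcome_assumption (R : realType) (d T : nat)
    (x : nat -> 'cV[R]_d) (y : bool -> nat -> R) (c0 c1 : R) : Prop :=
  forall k : bool,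
    let best_fit := inf (range (fun beta : 'cV[R]_d =>
      Num.sqrt (T%:R^-1 * \sum_(t < T) (y k t - dotp (x t) beta) ^+ 2))) in
    let fourth_moment :=
      (T%:R^-1 * \sum_(t < T) y k t ^+ 4) `^ (4%:R^-1) in
    [/\ c0 <= best_fit, best_fit <= fourth_moment & fourth_moment <= c1].

Definition gram_assumption (R : realType) (d T : nat)
    (x : nat -> 'cV[R]_d) (c2 gamma0 : R) : Prop :=
  forall t : nat, (1 <= t <= T)%N -> Num.sqrt T%:R * gamma0 <= t%:R ->
    c2^-1 <= sigma_min (gram x t).

Definition radius_assumption (R : realType) (d T : nat)
    (x : nat -> 'cV[R]_d) (c3 : R) : Prop :=
  max_enorm T x <= c3 * T%:R `^ (4%:R^-1).

(* The bounds on derivatives include the existence of these derivatives. *)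
Record sigmoid_condition (R : realType) (phi : R -> R) (b1 b2 b3 : R) : Prop :=
  SigmoidCondition {
  sigmoid_range : forall u, 0 < phi u < 1;
  sigmoid_increasing : {homo phi : u v / u < v};
  sigmoid_symmetric : forall u, phi u + phi (- u) = 1;
  sigmoid_limit : phi u @[u --> +oo] --> (1 : R);
  sigmoid_convex_inv :
    @convex_function R R^o setT (fun u => (phi u)^-1);
  sigmoid_convex_inv_compl :
    @convex_function R R^o setT (fun u => (1 - phi u)^-1);
  sigmoid_derive_bound :
    let f := fun u => (phi u)^-1 in
    forall u : R, derivable f u 1 /\ - derive1 f u <= b1;
  sigmoid_derive2_upper :
    let f := fun u => (phi u)^-1 in
    exists2 S : set R, finite_set S &
      forall u : R, ~ S u ->
        derivable (derive1 f) u 1 /\ derive1 (derive1 f) u <= b2 * (1 + `|u|) ^- 3;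
  sigmoid_derive2_lower :
    let f := fun u => (phi u)^-1 in
    exists2 S : set R, finite_set S &
      forall u : R, 0 <= u -> ~ S u ->
        derivable (derive1 f) u 1 /\ b3 * (1 + u) ^- 3 <= derive1 (derive1 f) u }.

Definition psi (R : realType) (u : R) : R := 2%:R^-1 * u ^+ 2 + `|u| ^+ 3.

(* pinv setT phi is the inverse of phi on its range. *)
Definition Psi (R : realType) (phi : R -> R) (p : R) : R :=
  psi (pinv setT phi p).

(* R_t and eta_t, from the rounds before t and the covariate x_t. *)
Definition ftrl_radius (R : realType) (d : nat) (past : seq (round R d))
    (x : 'cV[R]_d) : R :=
  Num.max (\big[Num.max/1]_(r <- past) enorm (cov r)) (enorm x).

Definition ftrl_rate (R : realType) (d T : nat) (past : seq (round R d))
    (x : 'cV[R]_d) : R :=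
  (Num.sqrt T%:R)^-1 * (ftrl_radius past x)^-1.

Definition ftrl_pred (R : realType) (d T : nat) (past : seq (round R d))
    (x : 'cV[R]_d) (k : bool) : 'cV[R]_d :=
  argmin setT (fun beta : 'cV[R]_d =>
    \sum_(r <- past) (resp r * ipw r k - dotp (cov r) beta) ^+ 2
    + (ftrl_rate T past x)^-1 * enorm beta ^+ 2).

Definition ftrl_loss (R : realType) (d : nat) (past : seq (round R d))
    (k : bool) : R :=
  \sum_(r <- past)
    ipw r k * (resp r - dotp (cov r) (predictor (dec r) k)) ^+ 2.

Definition ftrl_prob (R : realType) (d T : nat) (phi : R -> R)
    (past : seq (round R d)) (x : 'cV[R]_d) : R :=
  argmin [set p : R | 0 < p < 1] (fun p =>
    ftrl_loss past true / p + ftrl_loss past false / (1 - p)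
    + (ftrl_rate T past x)^-1 * Psi phi p).

Definition sigmoid_ftrl (R : realType) (d T : nat) (phi : R -> R) :
    design R d :=
  fun past x => Decision (ftrl_prob T phi past x) (ftrl_pred T past x).

(* Main.v *)
Require Import Defs.
From mathcomp Require Import ring lra.

Set Implicit Arguments.
Unset Strict Implicit.
Unset Printing Implicit Defensive.

Local Open Scope classical_set_scope.
Local Open Scope ring_scope.

(** Write e_t(k) = y_t(k) - <x_t, beta_t(k)> for the prediction errors and
    X_t(k) for the inverse of the conditional probability of arm k in round t.
    The errors of the rounds of the estimator are martingale increments, so that
      T^2 Var = sum_t E [e_t(1)^2 X_t(1) + e_t(0)^2 X_t(0) - (e_t(1) - e_t(0))^2]
    (aipw_variance_mean).  For a constant probability p with odds ratio
    a^2 = (1 - p) / p the summand is (a e_t(1) + e_t(0) / a)^2; hence the oracle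
    fits both arms by least squares and chooses p proportional to the norm of
    the residuals of arm 1 (oracle_variance_ge).  The regret is then the sum of
    two regrets in expectation: that of the probabilities p_t, with the errors
    e_t held fixed, and that of the predictors for the single outcome
    a y_t(1) + y_t(0) / a.  Both follow from the usual telescoping for
    follow-the-regularized-leader (ftrl_regret), with penalties of order
    sqrt T R and with stability terms, which carry the difficulty.

    In the variable u, with p = phi u, the objective is convex.  The curvature
    1 + 6 |u| of psi compensates the growth of 1 / phi u, which is at most
    linear in |u|, so the stability of the probabilities costs
    sum_t eta_t E e_t^4 (ftrl_probability_regret).  The stability of the
    predictors costs sum_t h_t E [e_t^2 + y_t^2 X_t], where h_t is the leverage
    of x_t (ftrl_combined_prediction_regret).

    The X_t are not bounded.  However, first-order optimality balances the cubic
    part of psi with the decay of the derivative of 1 / phi, and gives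
      X_t^4 <= C (1 + eta_t * (estimated losses before t))
    on every path (inv_arm_prob_pow4).  The estimated losses have mean
    sum_(s < t) E e_s^2, and the ridge regret against 0 bounds these errors in
    terms of the X_s; since X <= s + X^4 / s^3 with s as large as needed, the two
    bounds close up.  They give sum_t E e_t^2 = O(T) (error_total_le) and
    E X_t^4 = O(sqrt T / R_t) (mean_inv_prob_pow4_le), which is enough for
    sum_t h_t E [y_t^2 X_t] because h_t is O(R_t^2 / t) from
    time gamma0 sqrt T on (leverage_variance_le).

    For the fourth moments of the errors, a prediction <x_t, beta_t(k)> is
    split into the ridge prediction from the true outcomes and a martingale
    with deterministic weights, as the Gram matrices do not depend on the
    treatments.  The martingale is small (mean_noise_pow4_le).  For the
    deterministic part, in the first rounds, up to a multiple of sqrt T, the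
    regularization suffices; later the squared norm of the predictor is at most
    a constant times the mean of the past y_s^2, and Hardy's inequality with
    a_s = y_s^2 bounds the sum over t by the fourth moment of the outcomes
    (baseline_pow4_sum_le). *)

(** * Derivatives and convexity *)

Lemma le_of_eq (R : realType) (a b : R) : a = b -> a <= b.
Proof. by move=> ->. Qed.

Lemma pow4D_le (R : realType) (a b : R) : (a + b) ^+ 4 <= 8 * (a ^+ 4 + b ^+ 4).
Proof.
rewrite -subr_ge0.
have -> : 8 * (a ^+ 4 + b ^+ 4) - (a + b) ^+ 4 = 4 * (a ^+ 2 - b ^+ 2) ^+ 2 +
    (a - b) ^+ 2 * (2 * (a ^+ 2 + b ^+ 2) + (a + b) ^+ 2) by ring.
apply: addr_ge0; apply: mulr_ge0; rewrite ?sqr_ge0//.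
by have := sqr_ge0 a; have := sqr_ge0 b; have := sqr_ge0 (a + b); lra.
Qed.

(** The form of differentiability used for one-sided arguments at a point. *)
Lemma derive_approx (R : realType) (f : R -> R) (x l e : R) :
  is_derive x 1 f l -> 0 < e ->
  exists2 d : R, 0 < d & forall h, `|h| < d -> `|f (x + h) - f x - l * h| <= e * `|h|.
Proof.
move=> [df dl] e0.
have := df; rewrite /derivable => /cvg_ex[l' cl].
have El : l' = l by rewrite -dl; apply/esym/cvg_lim.
move: cl; rewrite El => /cvgrPdist_le /(_ e e0) [d /= d0 H].
exists d => // h hd.
have [->|h0] := eqVneq h 0; first by rewrite addr0 subrr mulr0 subr0 normr0 mulr0.
have := H h; rewrite /ball /= sub0r normrN => /(_ hd h0).
rewrite /GRing.scale /= mulr1 => Hh.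
have -> : f (x + h) - f x - l * h = - (l - h^-1 * (f (h + x) - f x)) * h.
  by rewrite mulNr mulrBl mulrAC mulVf// mul1r opprB (addrC h).
by rewrite normrM normrN ler_wpM2r.
Qed.

(** If the graph were below the tangent by gap at y, convexity would put it below
    by t gap at x + t (y - x) for all small t > 0, whereas the distance to the
    tangent is o(t). *)
Lemma convex_above_tangent (R : realType) (f : R -> R) (x y l : R) :
  @convex_function R R^o setT f -> is_derive x 1 f l ->
  f x + l * (y - x) <= f y.
Proof.
move=> cf df; rewrite leNgt; apply/negP => lt.
have [yx|nyx] := eqVneq y x; first by move: lt; rewrite yx subrr mulr0 addr0 ltxx.
have d0 : 0 < `|y - x| by rewrite normr_gt0 subr_eq0.
set gap := f x + l * (y - x) - f y.
have gap0 : 0 < gap by rewrite subr_gt0.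
have [d dp H] := derive_approx df (divr_gt0 gap0 (mulr_gt0 (ltr0Sn R 1) d0)).
pose t := Num.min 1 (d / (2 * `|y - x|)).
have t0 : 0 < t by rewrite lt_min ltr01 divr_gt0// mulr_gt0.
have t1 : t <= 1 by rewrite ge_min lexx.
have td : `|t * (y - x)| < d.
  rewrite normrM gtr0_norm//.
  have : t <= d / (2 * `|y - x|) by rewrite ge_min lexx orbT.
  rewrite ler_pdivlMr ?mulr_gt0// => ?.
  rewrite -(@ltr_pM2l _ 2)//; apply: (@le_lt_trans _ _ d); first lra.
  lra.
have /ler_normlP[Hl _] := H _ td.
have ht : 0 <= t <= 1 by rewrite ltW.
have /= := cf (Itv01 (ltW t0) t1) y x (mem_set I) (mem_set I).
rewrite !convRE /= /conv /= /GRing.scale /= => Hc.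
have Ex : t * y + unstable.onem t * x = x + t * (y - x) by rewrite /unstable.onem; ring.
rewrite Ex in Hc; move: Hl.
rewrite normrM (gtr0_norm t0) /unstable.onem in Hc *.
have -> : gap / (2 * `|y - x|) * (t * `|y - x|) = t * gap / 2.
  by field; rewrite gt_eqF.
rewrite /gap in gap0 *.
move: Hc; set A := f _ => Hc Hl.
have : t * (f x + l * (y - x) - f y) > 0 by rewrite mulr_gt0.
nra.
Qed.

(** The function dg need not be continuous at an exceptional point, but it is a
    derivative: by the mean value theorem its value there is a limit of values at
    nearby points, so monotonicity passes through finitely many such points. *)
Lemma derive_nonincreasing_except (R : realType) (g dg : R -> R) (l : seq R)
    (a b : R) :
  a < b -> (forall x, a <= x <= b -> is_derive x 1 g (dg x)) ->
  (forall x, a < x < b -> x \notin l -> derivable dg x 1 /\ derive1 dg x <= 0) ->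
  dg b <= dg a.
Proof.
elim: l a b => [|s l IH] a b ab dgP ddgP; last first.
  case: (boolP (a < s < b)) => [/andP[as_ sb]|ns]; last first.
    apply: IH => // x xab xl; apply: ddgP => //.
    by rewrite in_cons negb_or xl andbT; apply: contraNneq ns => <-.
  apply: (@le_trans _ _ (dg s)).
    apply: IH => // x /andP[xs xb].
      by apply: dgP; rewrite xb andbT (le_trans (ltW as_)).
    move=> xl; apply: ddgP; first by rewrite xb andbT (lt_trans as_).
    by rewrite in_cons negb_or xl andbT gt_eqF.
  apply: IH => // x /andP[xs xb].
    by apply: dgP; rewrite xs (le_trans xb (ltW sb)).
  move=> xl; apply: ddgP; first by rewrite xs (lt_trans xb sb).
  by rewrite in_cons negb_or xl andbT lt_eqF.
have inner x y : a < x -> x < y -> y < b -> dg y <= dg x.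
  move=> ax xy yb.
  have itv z : x <= z <= y -> derivable dg z 1 /\ derive1 dg z <= 0.
    by move=> /andP[xz zy]; apply: ddgP => //; rewrite (lt_le_trans ax)//= (le_lt_trans zy).
  have [c /itvP cxy E] : exists2 c, c \in `]x, y[%R & dg y - dg x = derive1 dg c * (y - x).
    apply: MVT => // [z /itvP zxy|].
      by rewrite derive1E; apply/derivableP; apply: (itv _ _).1; rewrite !zxy.
    by apply: derivable_within_continuous => z /itvP zxy; apply: (itv _ _).1; rewrite !zxy.
  have cin : x <= c <= y by rewrite !cxy.
  by rewrite -subr_le0 E mulr_le0_ge0 ?(itv c cin).2// subr_ge0 ltW.
have mvt x y : a <= x -> x < y -> y <= b ->
    exists2 c, x < c < y & g y - g x = dg c * (y - x).
  move=> ax xy yb.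
  have itv z : x <= z <= y -> is_derive z 1 g (dg z).
    by move=> /andP[xz zy]; apply: dgP; rewrite (le_trans ax xz) (le_trans zy yb).
  have [c /itvP cxy E] : exists2 c, c \in `]x, y[%R & g y - g x = dg c * (y - x).
    apply: MVT => // [z /itvP zxy|]; first by apply: itv; rewrite !zxy.
    apply: derivable_within_continuous => z /itvP zxy.
    by have [] := itv z; rewrite ?zxy.
  by exists c => //; rewrite !cxy.
have left_end y : a < y -> y < b -> dg y <= dg a.
  move=> ay yb; rewrite leNgt; apply/negP => lt.
  have e0 : 0 < (dg y - dg a) / 2 by rewrite divr_gt0// subr_gt0.
  have [|d d0 H] := @derive_approx _ g a (dg a) _ _ e0.
    by apply: dgP; rewrite lexx ltW.
  pose h := Num.min (y - a) (d / 2).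
  have h0 : 0 < h by rewrite lt_min subr_gt0 ay divr_gt0.
  have hy : h <= y - a by rewrite ge_min lexx.
  have hd : h <= d / 2 by rewrite ge_min lexx orbT.
  have [c /andP[ac ch] E] := mvt a (a + h) (lexx _) ltac:(lra) ltac:(lra).
  have := H h; rewrite gtr0_norm// => /(_ ltac:(lra)); rewrite E => /ler_normlP[_].
  have : dg y <= dg c.
    have [->//|cy] := eqVneq c y; apply: inner => //.
    by rewrite lt_neqAle cy/=; lra.
  move: (dg y) (dg c) (dg a) lt => Y C A lt YC.
  have : 0 < (C - A - (Y - A) / 2) * h by apply: mulr_gt0 => //; lra.
  nra.
have right_end y : a < y -> y < b -> dg b <= dg y.
  move=> ay yb; rewrite leNgt; apply/negP => lt.
  have e0 : 0 < (dg b - dg y) / 2 by rewrite divr_gt0// subr_gt0.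
  have [|d d0 H] := @derive_approx _ g b (dg b) _ _ e0.
    by apply: dgP; rewrite lexx ltW.
  pose h := Num.min (b - y) (d / 2).
  have h0 : 0 < h by rewrite lt_min subr_gt0 yb divr_gt0.
  have hy : h <= b - y by rewrite ge_min lexx.
  have hd : h <= d / 2 by rewrite ge_min lexx orbT.
  have [c /andP[bc cb] E] := mvt (b - h) b ltac:(lra) ltac:(lra) (lexx _).
  have := H (- h); rewrite normrN gtr0_norm// => /(_ ltac:(lra)).
  have -> : g (b - h) - g b = - (dg c * (b - (b - h))) by rewrite -E opprB.
  move=> /ler_normlP[_].
  have : dg c <= dg y.
    have [->//|cy] := eqVneq c y; apply: inner => //.
    by rewrite lt_neqAle eq_sym cy/=; lra.
  move: (dg y) (dg c) (dg b) lt => Y C A lt YC.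
  have : 0 < (A - C - (A - Y) / 2) * h by apply: mulr_gt0 => //; lra.
  nra.
by apply: (le_trans (right_end ((a + b) / 2) _ _) (left_end _ _ _)); lra.
Qed.

(** * The potential *)

Section Potential.
Context (R : realType).

Definition dpsi (u : R) : R := u + 3 * u * `|u|.

Lemma psi_ge0 (u : R) : 0 <= psi u.
Proof. by rewrite /psi addr_ge0// ?exprn_ge0// mulr_ge0// sqr_ge0. Qed.

(** The curvature |u| that the cubic part adds pays for 1 / phi u, which grows
    linearly in |u|. *)
Lemma psi_bregman_ge (u v : R) :
  psi u + dpsi u * (v - u) + (2^-1 + `|u|) * (v - u) ^+ 2 <= psi v.
Proof.
suff cubic (a b : R) : 0 <= a ->
    `|a| ^+ 3 + 3 * a * `|a| * (b - a) + `|a| * (b - a) ^+ 2 <= `|b| ^+ 3.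
  have : `|u| ^+ 3 + 3 * u * `|u| * (v - u) + `|u| * (v - u) ^+ 2 <= `|v| ^+ 3.
    have [u0|/ltW u0] := leP 0 u; first exact: cubic.
    have := cubic (- u) (- v); rewrite !normrN oppr_ge0 => /(_ u0); lra.
  by rewrite /psi /dpsi; lra.
move=> a0; rewrite (ger0_norm a0).
have [b0|/ltW b0] := leP 0 b.
  rewrite (ger0_norm b0) -subr_ge0.
  have -> : b ^+ 3 - (a ^+ 3 + 3 * a * a * (b - a) + a * (b - a) ^+ 2) =
    (a + b) * (b - a) ^+ 2 by ring.
  by rewrite mulr_ge0 ?sqr_ge0 ?addr_ge0.
rewrite (ler0_norm b0) -subr_ge0.
have -> : (- b) ^+ 3 - (a ^+ 3 + 3 * a * a * (b - a) + a * (b - a) ^+ 2) =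
  (- b) * (a + b) ^+ 2 + a ^+ 3 + a * b ^+ 2 by ring.
have nb0 : 0 <= - b by rewrite oppr_ge0.
have h1 := mulr_ge0 nb0 (sqr_ge0 (a + b)); have h2 := exprn_ge0 3 a0.
by have h3 := mulr_ge0 a0 (sqr_ge0 b); lra.
Qed.

(** A quadratic majorant of psi near u, which makes it unnecessary to
    differentiate the absolute value. *)
Lemma psi_bregman_le (u v : R) : `|v - u| <= 1 ->
  psi v <= psi u + dpsi u * (v - u) + (3 * 2^-1 + 3 * `|u|) * (v - u) ^+ 2.
Proof.
move=> vu1.
suff cubic (a b : R) : 0 <= a -> `|b - a| <= 1 ->
    `|b| ^+ 3 <= `|a| ^+ 3 + 3 * a * `|a| * (b - a) + (1 + 3 * `|a|) * (b - a) ^+ 2.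
  have : `|v| ^+ 3 <=
      `|u| ^+ 3 + 3 * u * `|u| * (v - u) + (1 + 3 * `|u|) * (v - u) ^+ 2.
    have [u0|/ltW u0] := leP 0 u; first exact: cubic.
    have := cubic (- u) (- v); rewrite -opprD !normrN oppr_ge0 => /(_ u0 vu1); lra.
  by rewrite /psi /dpsi; lra.
move=> a0 /ler_normlP[ba ab]; rewrite (ger0_norm a0).
have [b0|/ltW b0] := leP 0 b.
  rewrite (ger0_norm b0) -subr_ge0.
  have -> : a ^+ 3 + 3 * a * a * (b - a) + (1 + 3 * a) * (b - a) ^+ 2 - b ^+ 3 =
    (1 + a - b) * (b - a) ^+ 2 by ring.
  by rewrite mulr_ge0 ?sqr_ge0//; lra.
rewrite (ler0_norm b0) -subr_ge0.
have nb0 : 0 <= - b by rewrite oppr_ge0.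
have -> : a ^+ 3 + 3 * a * a * (b - a) + (1 + 3 * a) * (b - a) ^+ 2 - (- b) ^+ 3 =
  a ^+ 3 + 3 * a ^+ 2 * (- b) + 3 * a * b ^+ 2 + a ^+ 2 + 2 * a * (- b) +
  b ^+ 2 * (1 + b) by ring.
have h1 := exprn_ge0 3 a0; have h2 := mulr_ge0 (sqr_ge0 a) nb0.
have h3 := mulr_ge0 a0 (sqr_ge0 b); have h4 := mulr_ge0 a0 nb0.
have b1_ge0 : 0 <= 1 + b by lra.
by have h5 := mulr_ge0 (sqr_ge0 b) b1_ge0; have h6 := sqr_ge0 a; lra.
Qed.

(** With psi replaced by its quadratic majorant at u, the objective is
    differentiable and u is still a local minimizer. *)
Lemma psi_minimizer_stationary (L : R -> R) (l lam u : R) : 0 <= lam ->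
  (forall v, derivable L v 1) -> is_derive u 1 L l ->
  (forall v, L u + lam * psi u <= L v + lam * psi v) ->
  l + lam * dpsi u = 0.
Proof.
move=> lam0 dL dLu umin.
pose Q (v : R) : R := L v + (lam * dpsi u * (v - u) +
  lam * (3 * 2^-1 + 3 * `|u|) * (v - u) ^+ 2).
have dQ0 : is_derive u 1 Q (l + lam * dpsi u).
  apply: is_derive_eq; rewrite /GRing.scale /= subrr; ring.
have dQ (v : R) : derivable Q v 1.
  have dLv : is_derive v 1 L (derive1 L v).
    by rewrite derive1E; exact: derivableP.
  exact: ex_derive.
have uin : u \in `](u - 1), (u + 1)[%R by rewrite in_itv/=; lra.
have Qmin v : v \in `](u - 1), (u + 1)[%R -> Q u <= Q v.
  rewrite in_itv/= => /andP[uv vu].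
  have /psi_bregman_le : `|v - u| <= 1 by rewrite ler_norml; lra.
  move=> /(ler_wpM2l lam0); have := umin v.
  rewrite /Q subrr; lra.
have uu : u - 1 <= u + 1 by lra.
have [_ <-] := derive1_at_min uu (fun v _ => dQ v) uin Qmin.
by rewrite derive_val.
Qed.
End Potential.

(** * Sigmoids and the minimizing probability *)

Section Sigmoid.
Context (R : realType) (phi : R -> R) (b1 b2 b3 : R).
Hypothesis sc : sigmoid_condition phi b1 b2 b3.
Hypothesis b2_gt0 : 0 < b2.

Let f (u : R) : R := (phi u)^-1.
Let df : R -> R := derive1 f.

Lemma sigmoid_inv_derive (u : R) : is_derive u 1 f (df u).
Proof.
have [dfu _] := sigmoid_derive_bound sc u.
by rewrite /df derive1E; exact: derivableP.
Qed.

Lemma sigmoid_inv_tangent (u v : R) : f u + df u * (v - u) <= f v.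
Proof.
exact: convex_above_tangent (sigmoid_convex_inv sc) (sigmoid_inv_derive u).
Qed.

Lemma sigmoid_inv_gt1 (u : R) : 1 < f u.
Proof. by have /andP[p0 p1] := sigmoid_range sc u; rewrite invf_gt1. Qed.

Lemma sigmoid_inv_decreasing (u v : R) : u < v -> f v < f u.
Proof.
move=> /(sigmoid_increasing sc) uv.
have /andP[p0 _] := sigmoid_range sc u.
have /andP[q0 _] := sigmoid_range sc v.
by rewrite ltf_pV2.
Qed.

Lemma sigmoid_inv_derive_lt0 (u : R) : df u < 0.
Proof.
have := sigmoid_inv_tangent u (u - 1).
have := @sigmoid_inv_decreasing u (u + 1) ltac:(lra).
have := sigmoid_inv_tangent u (u + 1); lra.
Qed.

Lemma sigmoid_inv_derive_ge (u : R) : - b1 <= df u.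
Proof. by have [_] := sigmoid_derive_bound sc u; rewrite -/f -/df; lra. Qed.

Lemma sigmoid_inv0 : f 0 = 2.
Proof.
have := sigmoid_symmetric sc 0; rewrite oppr0 => h.
have -> : 2 = (2^-1)^-1 :> R by rewrite invrK.
by rewrite /f; congr (_ ^-1); lra.
Qed.

Lemma sigmoid_inv_le_linear (u : R) : f u <= 2 + b1 * `|u|.
Proof.
have := sigmoid_inv_tangent u 0; rewrite sigmoid_inv0.
have := sigmoid_inv_derive_ge u; have := sigmoid_inv_derive_lt0 u.
move: (df u) (f u) => d F dlt0 db.
have : `|d * u| <= b1 * `|u| by rewrite normrM ler_wpM2r// ltr0_norm//; lra.
move=> /ler_normlP[]; lra.
Qed.

Lemma sigmoid_inv_cvg : f u @[u --> +oo] --> (1 : R).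
Proof.
rewrite -[X in _ --> X]invr1; apply: cvgV; first exact: oner_neq0.
exact: sigmoid_limit sc.
Qed.

(** The second derivative of (b2 / 2) / (1 + u) is b2 / (1 + u)^3, so subtracting
    this function from 1 / phi leaves a concave function q on [0, +oo).  As q is
    bounded below, it is nondecreasing, which is the first bound; as it tends to
    1, it is at most 1, which is the second. *)
Lemma sigmoid_inv_decay (u : R) : 0 <= u ->
  - (b2 / 2 * (1 + u) ^- 2) <= df u /\ f u <= 1 + b2 / 2 / (1 + u).
Proof.
move=> u0.
pose q (v : R) : R := f v - b2 / 2 * (1 + v)^-1.
pose dq (v : R) : R := df v + b2 / 2 * (1 + v)^-1 ^+ 2.
have qP (v : R) : 0 <= v -> is_derive v 1 q (dq v).
  move=> v0; have v1 : 1 + v != 0 by rewrite gt_eqF//; lra.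
  have dfv := sigmoid_inv_derive v.
  apply: is_derive_eq; rewrite /dq /GRing.scale /=; field.
  by rewrite v1.
have [S finS HS] := sigmoid_derive2_upper sc.
have dqP (v w : R) : 0 <= v -> v < w -> dq w <= dq v.
  move=> v0 vw; have [l lS] : exists l : seq R, forall z, S z -> z \in l.
    by have /finite_seqP[l ->] := finS; exists l.
  apply: (@derive_nonincreasing_except _ q dq l v w vw) => [z /andP[vz _]|].
    by apply: qP; lra.
  move=> z /andP[vz zw] zl; have z1 : 1 + z != 0 by rewrite gt_eqF//; lra.
  have [|] := HS z; first by move=> /lS; rewrite (negbTE zl).
  rewrite -/f -/df => ddf ddfle.
  have dfz : is_derive z 1 df (derive1 df z) by rewrite derive1E; exact: derivableP.
  have E : is_derive z 1 dq (derive1 df z - b2 * (1 + z) ^- 3).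
    apply: is_derive_eq; rewrite /GRing.scale /=; field.
    by rewrite z1.
  have [? ?] := E; split=> //; rewrite derive1E derive_val.
  have zE : `|z| = z by apply: ger0_norm; lra.
  by move: ddfle; rewrite zE; lra.
have q_mvt (v w : R) : 0 <= v -> v < w ->
    exists2 c, v < c < w & q w - q v = dq c * (w - v).
  move=> v0 vw.
  have [z /itvP zvw||c /itvP cvw ?] := @MVT _ q dq v w vw.
  - by apply: qP; rewrite (le_trans v0)// ltW// zvw.
  - apply: derivable_within_continuous => z /itvP zvw.
    by have [] : is_derive z 1 q (dq z) by apply: qP; rewrite (le_trans v0)// zvw.
  - by exists c => //; rewrite !cvw.
have q_ge (v : R) : 0 <= v -> 1 - b2 / 2 <= q v.
  move=> v0; have := sigmoid_inv_gt1 v.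
  have : (1 + v)^-1 <= 1 by rewrite invf_le1; lra.
  move=> z1; have : b2 / 2 * (1 + v)^-1 <= b2 / 2 by apply: ler_piMr z1; rewrite divr_ge0// ltW.
  rewrite /q; lra.
have dq_ge0 (v : R) : 0 <= v -> 0 <= dq v.
  move=> v0; rewrite leNgt; apply/negP => dv.
  have qv := q_ge v v0.
  (* Descending from v with slope at most dq v < 0 crosses the lower bound before w. *)
  pose w := v + (q v + b2 / 2 + 1) / - dq v.
  have vw : v < w by rewrite ltrDl divr_gt0; lra.
  have w0 : 0 <= w by lra.
  have [c /andP[vc cw] E] := q_mvt v w v0 vw.
  have := dqP v c v0 vc => cv.
  have := q_ge w w0.
  have : (dq v - dq c) * (w - v) >= 0 by rewrite mulr_ge0; lra.
  have : dq v * (w - v) = - (q v + b2 / 2 + 1).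
    by rewrite /w; field; rewrite lt_eqF.
  lra.
have q_nondec (v w : R) : 0 <= v -> v < w -> q v <= q w.
  move=> v0 vw; have [c /andP[vc cw] E] := q_mvt v w v0 vw.
  by rewrite -subr_ge0 E mulr_ge0 ?dq_ge0//; lra.
split; first by have := dq_ge0 u u0; rewrite /dq exprVn; lra.
suff : q u <= 1 by rewrite /q; lra.
rewrite -(cvg_lim _ sigmoid_inv_cvg)//; apply: limr_ge.
  by apply/cvg_ex; exists 1; exact: sigmoid_inv_cvg.
near=> w; apply: (@le_trans _ _ (q w)).
  by apply: q_nondec => //; near: w; exact: (nbhs_pinfty_gt (num_real _)).
have w0 : 0 <= w by apply: ltW; near: w; exact: (nbhs_pinfty_gt (num_real _)).
have b2h : 0 <= b2 / 2 by rewrite divr_ge0// ltW.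
by rewrite /q gerBl; apply: mulr_ge0 => //; rewrite invr_ge0; lra.
Unshelve. all: by end_near. Qed.

Lemma sigmoid_opp (u : R) : phi (- u) = 1 - phi u.
Proof. by have := sigmoid_symmetric sc u; lra. Qed.

Lemma sigmoid_surjective (p : R) : 0 < p < 1 -> exists u, phi u = p.
Proof.
move=> /andP[p0 p1].
have [M [M0 Mp Mq]] : exists M : R, [/\ 0 <= M, p <= phi M & 1 - p <= phi M].
  have /cvgrPdist_lt /(_ (Num.min p (1 - p))) := sigmoid_limit sc.
  rewrite lt_min p0 subr_gt0 p1 => /(_ isT) near_phi.
  near (@pinfty_nbhs R) => M; exists M.
  have : `|1 - phi M| < Num.min p (1 - p) by near: M.
  rewrite lt_min => /andP[/ltr_normlP[_ h1] /ltr_normlP[_ h2]].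
  split; [|lra|lra].
  by apply: ltW; near: M; exact: (nbhs_pinfty_gt (num_real _)).
have phi_cont : continuous phi.
  move=> u; have -> : phi = (fun v => (f v)^-1).
    by apply/funext => v; rewrite /f invrK.
  apply: continuousV; first by rewrite gt_eqF// (lt_trans ltr01)// sigmoid_inv_gt1.
  apply/differentiable_continuous/derivable1_diffP.
  by have [] := sigmoid_inv_derive u.
have [|||c _ <-] := @IVT _ phi (- M) M p.
- lra.
- exact: continuous_subspaceT.
- rewrite ge_min le_max sigmoid_opp; apply/andP; split; apply/orP; [left|right]; lra.
- by exists c.
Unshelve. all: by end_near. Qed.

(** The decay of 1 / phi - 1 limits how far u can go before phi u exceeds 1 - c,
    with a limit that depends on phi through b2 only. *)
Lemma sigmoid_preimage_bounded (c u : R) : 0 < c -> c <= phi u <= 1 - c ->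
  `|u| <= b2 / 2 / c.
Proof.
move=> c0 cu.
suff pos (v : R) : 0 <= v -> phi v <= 1 - c -> v <= b2 / 2 / c.
  have [u0|/ltW u0] := leP 0 u.
    by rewrite (ger0_norm u0); apply: (pos u u0); case/andP: cu.
  by rewrite (ler0_norm u0); apply: pos; [rewrite oppr_ge0|rewrite sigmoid_opp; lra].
move=> v0 vc; rewrite ler_pdivlMr//.
have [_] := sigmoid_inv_decay v0.
have /andP[p0 p1] := sigmoid_range sc v.
have : c <= f v - 1.
  have : 1 - phi v <= f v - 1 by rewrite /f -subr_ge0;
    have -> : (phi v)^-1 - 1 - (1 - phi v) = (1 - phi v) ^+ 2 / phi v
      by [field; rewrite gt_eqF|]; rewrite divr_ge0 ?sqr_ge0// ltW.
  lra.
move=> h1 h2; have : c <= b2 / 2 / (1 + v) by lra.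
rewrite ler_pdivlMr; last lra.
nra.
Qed.

(** The objective defining p_t, in the variable u with p = phi u, where it is
    convex; by symmetry 1 - phi u = phi (- u). *)
Definition ftrl_objective (A1 A0 lam u : R) : R :=
  A1 * f u + A0 * f (- u) + lam * psi u.

Lemma ftrl_objective_continuous (A1 A0 lam : R) :
  continuous (ftrl_objective A1 A0 lam).
Proof.
have fC : continuous f.
  move=> u; apply/differentiable_continuous/derivable1_diffP.
  by have [] := sigmoid_inv_derive u.
move=> u; apply: cvgD; first apply: cvgD.
- by apply: cvgM; [exact: cvg_cst|exact: fC].
- apply: cvgM; first exact: cvg_cst.
  by apply: (@cvg_comp _ _ _ -%R f); [apply: cvgN; exact: cvg_id|exact: fC].
- apply: cvgM; first exact: cvg_cst.
  apply: cvgD; first apply: cvgM; first exact: cvg_cst.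
    exact: exprn_continuous.
  apply: (@cvg_comp _ _ _ (fun x : R => `|x|) (fun x => x ^+ 3)).
    by apply: cvg_norm; exact: cvg_id.
  exact: exprn_continuous.
Qed.

Section Objective.
Variables (A1 A0 lam : R).
Hypotheses (A1_ge0 : 0 <= A1) (A0_ge0 : 0 <= A0) (lam_gt0 : 0 < lam).
Let F := ftrl_objective A1 A0 lam.

Lemma ftrl_objective_min : exists u, forall v, F u <= F v.
Proof.
have f_ge0 (v : R) : 0 <= f v by apply: ltW; apply: lt_trans (sigmoid_inv_gt1 v).
have F_ge (v : R) : lam * psi v <= F v.
  by rewrite /F /ftrl_objective lerDr addr_ge0// mulr_ge0.
have F0_ge0 : 0 <= F 0 by apply: le_trans (F_ge 0); rewrite mulr_ge0 ?psi_ge0// ltW.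
pose M := 1 + 2 * F 0 / lam.
have FM : 0 <= 2 * F 0 / lam by rewrite divr_ge0 ?mulr_ge0// ltW.
have MM : - M <= M by rewrite /M; lra.
have [u uM umin] := EVT_min MM (continuous_subspaceT (@ftrl_objective_continuous A1 A0 lam)).
exists u => v; case: (boolP (v \in `[(- M), M])) => [|vM]; first exact: umin.
apply: (@le_trans _ _ (F 0)); first by apply: umin; rewrite in_itv/=; lra.
apply: le_trans (F_ge v).
have {}vM : M < `|v|.
  by rewrite ltNge; apply: contra vM; rewrite in_itv/= ler_norml.
have psiv : `|v| / 2 <= psi v.
  rewrite /psi -real_normK ?num_real//.
  have n0 := exprn_ge0 3 (normr_ge0 v).
  have : 0 <= `|v| * (`|v| - 1) by rewrite mulr_ge0//; rewrite /M in vM; lra.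
  lra.
have : lam * (2 * F 0 / lam) = 2 * F 0 by field; rewrite gt_eqF.
have : lam * (2 * F 0 / lam) <= lam * (`|v| - 1).
  by apply: ler_wpM2l; [exact: ltW|rewrite /M in vM; lra].
have := ler_wpM2l (ltW lam_gt0) psiv.
have := lam_gt0; lra.
Qed.

Variable u : R.
Hypothesis umin : forall v, F u <= F v.

Lemma ftrl_objective_foc : A1 * df u - A0 * df (- u) + lam * dpsi u = 0.
Proof.
pose L (v : R) : R := A1 * f v + A0 * f (- v).
have dL (v : R) : is_derive v 1 L (A1 * df v - A0 * df (- v)).
  have h1 := sigmoid_inv_derive v; have h2 := sigmoid_inv_derive (- v).
  have h3 : is_derive v 1 (f \o -%R) (df (- v) * -1) by exact: is_derive1_comp.
  apply: (@is_derive_eq _ _ _ (fun w => A1 * f w + A0 * (f \o -%R) w)).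
  by rewrite /GRing.scale /=; ring.
apply: (@psi_minimizer_stationary _ L _ lam u (ltW lam_gt0) _ (dL u) umin).
by move=> v; have [] := dL v.
Qed.

(** First-order optimality at u cancels the linear terms of the tangent bounds, and
    the curvature of psi remains. *)
Lemma ftrl_objective_growth (v : R) : F u + lam * (2^-1 + `|u|) * (v - u) ^+ 2 <= F v.
Proof.
have t1 := ler_wpM2l A1_ge0 (sigmoid_inv_tangent u v).
have t2 := ler_wpM2l A0_ge0 (sigmoid_inv_tangent (- u) (- v)).
have t3 := ler_wpM2l (ltW lam_gt0) (psi_bregman_ge u v).
have foc := ftrl_objective_foc.
have : (A1 * df u - A0 * df (- u) + lam * dpsi u) * (v - u) = 0.
  by rewrite foc mul0r.
rewrite /F /ftrl_objective; lra.
Qed.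

(** For u >= 0, optimality bounds lam (u + 3 u^2) by the pull of the losses of
    arm 1, at most A1 (b2 / 2) / (1 + u)^2; symmetrically for u <= 0 with arm 0.
    The cubic part of psi is what makes |u|, and with it 1 / p, grow only like
    the fourth root of the losses. *)
Lemma ftrl_minimizer_pow4 : lam * `|u| ^+ 4 <= b2 / 2 * (A1 + A0).
Proof.
have core (x A : R) : 0 <= x -> 0 <= A ->
    lam * (x + 3 * x ^+ 2) <= A * - df x -> lam * x ^+ 4 <= b2 / 2 * A.
  move=> x0 Ap le_x.
  have [dfx _] := sigmoid_inv_decay x0.
  have x1 : 0 < (1 + x) ^+ 2 by rewrite exprn_gt0//; lra.
  have : lam * (x + 3 * x ^+ 2) <= A * (b2 / 2 / (1 + x) ^+ 2).
    by apply: (le_trans le_x); rewrite ler_wpM2l//; lra.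
  rewrite !mulrA ler_pdivlMr// => h.
  have : lam * x ^+ 4 <= lam * (x + 3 * x ^+ 2) * (1 + x) ^+ 2.
    rewrite -mulrA ler_wpM2l ?(ltW lam_gt0)// -subr_ge0.
    have -> : (x + 3 * x ^+ 2) * (1 + x) ^+ 2 - x ^+ 4 =
      x + 5 * x ^+ 2 + 7 * x ^+ 3 + 2 * x ^+ 4 by ring.
    by rewrite !addr_ge0// ?mulr_ge0// exprn_ge0.
  lra.
have foc := ftrl_objective_foc.
have mono (A B x : R) : 0 <= A -> 0 <= B ->
  lam * x ^+ 4 <= b2 / 2 * A -> lam * x ^+ 4 <= b2 / 2 * (A + B).
  move=> Ap Bp h; apply: (le_trans h); rewrite ler_wpM2l ?lerDl// divr_ge0// ltW//.
have [u0|/ltW u0] := leP 0 u.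
  rewrite (ger0_norm u0); apply: mono => //; apply: core => //.
  have := mulr_ge0_le0 A0_ge0 (ltW (sigmoid_inv_derive_lt0 (- u))).
  by move: foc; rewrite /dpsi (ger0_norm u0); lra.
rewrite (ler0_norm u0) addrC; apply: mono => //; apply: core; rewrite ?oppr_ge0//.
have := mulr_ge0_le0 A1_ge0 (ltW (sigmoid_inv_derive_lt0 u)).
by move: foc; rewrite /dpsi (ler0_norm u0); lra.
Qed.
End Objective.

Lemma Psi_sigmoid (u : R) : Psi phi (phi u) = psi u.
Proof.
rewrite /Psi pinvKV ?inE// => v w _ _ eq_phi; apply/eqP.
by case: (ltgtP v w) => // /(sigmoid_increasing sc); rewrite eq_phi ltxx.
Qed.

Lemma ftrl_prob_minimizer (d T : nat) (past : seq (round R d)) (x : 'cV[R]_d) :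
  (forall k, 0 <= ftrl_loss past k) -> 0 < (ftrl_rate T past x)^-1 ->
  exists u, phi u = ftrl_prob T phi past x /\
    forall v, ftrl_objective (ftrl_loss past true) (ftrl_loss past false)
                (ftrl_rate T past x)^-1 u <=
              ftrl_objective (ftrl_loss past true) (ftrl_loss past false)
                (ftrl_rate T past x)^-1 v.
Proof.
move=> loss_ge0 lam_gt0; rewrite /ftrl_prob /argmin.
set A1 := ftrl_loss past true; set A0 := ftrl_loss past false.
set lam := (ftrl_rate T past x)^-1.
set S := [set p | _].
have objE u : A1 / phi u + A0 / (1 - phi u) + lam * Psi phi (phi u) =
    ftrl_objective A1 A0 lam u.
  by rewrite Psi_sigmoid -sigmoid_opp.
have [|p01 pmin] := getPex (P := S).
  have [u umin] := ftrl_objective_min (loss_ge0 true) (loss_ge0 false) lam_gt0.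
  exists (phi u); split; first exact: sigmoid_range sc u.
  by move=> q /sigmoid_surjective[v <-]; rewrite !objE.
have [u pE] := sigmoid_surjective p01.
exists u; split=> // v.
by rewrite -!objE pE; apply: pmin; exact: sigmoid_range sc v.
Qed.

(** The cases v = u and v = - u are the two arms. *)
Lemma sigmoid_inv_pow4 (A1 A0 lam u v : R) :
  0 <= A1 -> 0 <= A0 -> 0 < lam ->
  (forall w, ftrl_objective A1 A0 lam u <= ftrl_objective A1 A0 lam w) ->
  `|v| = `|u| ->
  f v ^+ 4 <= (128 + 4 * b1 ^+ 4 * b2) * (1 + (A1 + A0) / lam).
Proof.
move=> A1p A0p lamp umin vu.
have f_ge0 : 0 <= f v by apply: ltW; apply: lt_trans (sigmoid_inv_gt1 v).
have f_le := sigmoid_inv_le_linear v.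
have u4 := ftrl_minimizer_pow4 A1p A0p lamp umin.
have {}u4 : `|u| ^+ 4 <= b2 / 2 * ((A1 + A0) / lam).
  by rewrite mulrA ler_pdivlMr// mulrC.
have f4 : f v ^+ 4 <= (2 + b1 * `|v|) ^+ 4 by rewrite lerXn2r// nnegrE; lra.
have b14 : 0 <= b1 ^+ 4 by rewrite -[4%N]/(2 * 2)%N exprM sqr_ge0.
have := pow4D_le 2 (b1 * `|v|); rewrite vu exprMn in f4 *.
have := ler_wpM2l b14 u4.
have h1 : 0 <= (A1 + A0) / lam by rewrite divr_ge0 ?addr_ge0// ltW.
have h2 : 0 <= b1 ^+ 4 * b2 by rewrite mulr_ge0// ltW.
move: f4; set Z := (A1 + A0) / lam in h1 *; lra.
Qed.
End Sigmoid.

(** * Euclidean geometry and the smallest singular value *)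

Section FiniteSums.
Context (R : realType).

Lemma sum_CauchySchwarz (I : finType) (a b : I -> R) :
  (\sum_i a i * b i) ^+ 2 <= (\sum_i a i ^+ 2) * (\sum_i b i ^+ 2).
Proof.
set A := \sum_i a i ^+ 2; set B := \sum_i a i * b i; set C := \sum_i b i ^+ 2.
have A0 : 0 <= A by apply: sumr_ge0 => i _; exact: sqr_ge0.
have : 0 <= \sum_i (A * b i - B * a i) ^+ 2.
  by apply: sumr_ge0 => i _; exact: sqr_ge0.
have -> : \sum_i (A * b i - B * a i) ^+ 2 = A * (A * C - B ^+ 2).
  suff E (p q : R) : \sum_i (p * b i - q * a i) ^+ 2 =
      p ^+ 2 * C - 2 * p * q * B + q ^+ 2 * A by rewrite E; ring.
  rewrite /A /B /C !mulr_sumr -sumrB -big_split/=.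
  by apply: eq_bigr => i _; ring.
have [A_gt0|] := ltP 0 A; first by rewrite pmulr_rge0// subr_ge0.
move=> A_le0 _; have A00 : A = 0 by apply/eqP; rewrite eq_le A_le0.
have /allP a0 : all (fun i => a i ^+ 2 == 0) (index_enum I).
  have /eqP := A00; rewrite /A psumr_eq0 => [|i _]; last exact: sqr_ge0.
  by apply: sub_all => i /=.
have -> : B = 0.
  apply: big1 => i _; have := a0 i (mem_index_enum i).
  by rewrite sqrf_eq0 => /eqP->; rewrite mul0r.
by rewrite A00 mul0r expr0n.
Qed.

End FiniteSums.

Section InnerProduct.
Context (R : realType) (d : nat).
Implicit Types (u v w : 'cV[R]_d) (c : R).

Lemma dotpC u v : dotp u v = dotp v u.
Proof. by apply: eq_bigr => i _; rewrite mulrC. Qed.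

Lemma dotpDr u v w : dotp u (v + w) = dotp u v + dotp u w.
Proof. by rewrite -big_split/=; apply: eq_bigr => i _; rewrite mxE mulrDr. Qed.

Lemma dotpZr c u v : dotp u (c *: v) = c * dotp u v.
Proof. by rewrite mulr_sumr; apply: eq_bigr => i _; rewrite mxE mulrCA. Qed.

Lemma dotpNr u v : dotp u (- v) = - dotp u v.
Proof. by rewrite -scaleN1r dotpZr mulN1r. Qed.

Lemma dotpBr u v w : dotp u (v - w) = dotp u v - dotp u w.
Proof. by rewrite dotpDr dotpNr. Qed.

Lemma dotpDl u v w : dotp (u + v) w = dotp u w + dotp v w.
Proof. by rewrite dotpC dotpDr !(dotpC w). Qed.

Lemma dotpZl c u v : dotp (c *: u) v = c * dotp u v.
Proof. by rewrite dotpC dotpZr dotpC. Qed.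

Lemma dotpNl u v : dotp (- u) v = - dotp u v.
Proof. by rewrite dotpC dotpNr dotpC. Qed.

Lemma dotpBl u v w : dotp (u - v) w = dotp u w - dotp v w.
Proof. by rewrite dotpDl dotpNl. Qed.

Lemma dotp0r u : dotp u 0 = 0.
Proof. by apply: big1 => i _; rewrite mxE mulr0. Qed.

Lemma dotp_suml n (F : nat -> 'cV[R]_d) v :
  dotp (\sum_(s < n) F s) v = \sum_(s < n) dotp (F s) v.
Proof.
elim/big_rec2: _ => [|i a b _ <-]; first by rewrite dotpC dotp0r.
by rewrite dotpDl.
Qed.

Lemma dotp_ge0 u : 0 <= dotp u u.
Proof. by apply: sumr_ge0 => i _; rewrite -expr2 sqr_ge0. Qed.

Lemma dotp_eq0 u : dotp u u = 0 -> u = 0.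
Proof.
move=> /eqP; rewrite psumr_eq0 => [/allP u0|i _]; last by rewrite -expr2 sqr_ge0.
apply/matrixP => i j; rewrite ord1 mxE; apply/eqP.
by have := u0 i (mem_index_enum i); rewrite /= -expr2 sqrf_eq0.
Qed.

Lemma dotp_CauchySchwarz u v : dotp u v ^+ 2 <= dotp u u * dotp v v.
Proof. exact: (sum_CauchySchwarz (fun i => u i 0) (fun i => v i 0)). Qed.

Lemma enorm_sqr u : enorm u ^+ 2 = dotp u u.
Proof. by rewrite sqr_sqrtr ?dotp_ge0. Qed.

Lemma enorm_ge0 u : 0 <= enorm u.
Proof. exact: sqrtr_ge0. Qed.

Lemma mulmx_outer u v : u *m u^T *m v = dotp u v *: u.
Proof.
rewrite -mulmxA; apply/matrixP => i j; rewrite !mxE big_ord1 (ord1 j) mulrC.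
by congr (_ * _); rewrite mxE; apply: eq_bigr => k _; rewrite mxE.
Qed.

End InnerProduct.

Lemma continuous_sum (R : realType) (T : topologicalType) (I : Type)
    (r : seq I) (F : I -> T -> R) :
  (forall i, continuous (F i)) -> continuous (fun x => \sum_(i <- r) F i x).
Proof.
move=> cF; elim: r => [|i r IH].
  rewrite (_ : (fun _ => _) = fun=> 0); first by move=> x; exact: cvg_cst.
  by apply/funext => x; rewrite big_nil.
rewrite (_ : (fun _ => _) = fun x => F i x + \sum_(j <- r) F j x).
  by move=> x; apply: cvgD; [exact: cF|exact: IH].
by apply/funext => x; rewrite big_cons.
Qed.

Lemma continuous_mul (R : realType) (T : topologicalType) (f g : T -> R) :
  continuous f -> continuous g -> continuous (fun x => f x * g x).
Proof. by move=> cf cg x; apply: cvgM; [exact: cf|exact: cg]. Qed.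

(** Near t = 0 the linear term would dominate. *)
Lemma quadratic_ge0_linear0 (R : realType) (a K : R) :
  (forall t, 0 <= 2 * t * a + t ^+ 2 * K) -> a = 0.
Proof.
move=> q0; apply/eqP; apply: contraT => a0.
(* For this t the quadratic is negative, whatever the sign of K. *)
pose t := - a / (1 + `|K|).
have K1 : 0 < 1 + `|K| by rewrite ltr_wpDr.
have := q0 t.
have -> : 2 * t * a + t ^+ 2 * K = t ^+ 2 * (K - 2 * (1 + `|K|)).
  by rewrite /t; field; rewrite gt_eqF.
have : 0 < t ^+ 2.
  rewrite lt_def sqr_ge0 andbT sqrf_eq0; apply: mulf_neq0.
    by rewrite oppr_eq0.
  by rewrite invr_eq0 gt_eqF.
by move=> t2; rewrite pmulr_rge0//; have := ler_norm K; lra.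
Qed.

Section SmallestSingularValue.
Context (R : realType) (d : nat).
Variable A : 'M[R]_d.
Hypothesis A_sym : A^T = A.
Hypothesis A_psd : forall v : 'cV[R]_d, 0 <= dotp v (A *m v).

Lemma dotp_mulmx (u v : 'cV[R]_d) : dotp u (A *m v) = dotp v (A *m u).
Proof.
have E (a b : 'cV[R]_d) : dotp a b = (a^T *m b) 0 0.
  by rewrite mxE; apply: eq_bigr => i _; rewrite mxE.
by rewrite !E -[u^T *m _]trmxK mxE !trmx_mul trmxK A_sym mulmxA.
Qed.

(** By compactness of the Euclidean unit sphere, a closed subset of the unit box. *)
Lemma rayleigh_min : forall v0 : 'cV[R]_d, v0 != 0 ->
  exists u : 'cV[R]_d, dotp u u = 1 /\
    forall v, dotp u (A *m u) * dotp v v <= dotp v (A *m v).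
Proof.
move=> v0 v0n0.
pose g (w : 'rV[R]_d) : R := dotp w^T (A *m w^T).
pose S := [set w : 'rV[R]_d | dotp w^T w^T = 1].
have normalize (v : 'cV[R]_d) : v != 0 ->
    dotp ((enorm v)^-1 *: v) ((enorm v)^-1 *: v) = 1.
  move=> vn0; rewrite dotpZl dotpZr -enorm_sqr.
  have en0 : enorm v != 0.
    apply: contra_neq vn0 => e0; apply: dotp_eq0.
    by rewrite -enorm_sqr e0 expr0n.
  by rewrite mulrA -expr2 exprVn mulVf// expf_neq0.
have coordC (i : 'I_d) : continuous (fun w : 'rV[R]_d => w 0 i).
  by move=> w; exact: coord_continuous.
have SC : continuous (fun w : 'rV[R]_d => dotp w^T w^T).
  apply: continuous_sum => i.
  rewrite (_ : (fun _ => _) = fun w : 'rV[R]_d => w 0 i * w 0 i).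
    exact: continuous_mul.
  by apply/funext => w; rewrite !mxE.
have gC : continuous g.
  apply: continuous_sum => i.
  rewrite (_ : (fun _ => _) =
      fun w : 'rV[R]_d => w 0 i * \sum_j A i j * w 0 j).
    apply: continuous_mul => //; apply: continuous_sum => j.
    by apply: continuous_mul => //; exact: cst_continuous.
  apply/funext => w; rewrite !mxE; congr (_ * _).
  by apply: eq_bigr => j _; rewrite mxE.
have Sclosed : closed S.
  rewrite /S.
  have -> : [set w : 'rV[R]_d | dotp w^T w^T = 1] =
            (fun w : 'rV[R]_d => dotp w^T w^T) @^-1` [set 1].
    by [].
  by apply: preimage_closed => //; exact: closed_eq.
have Scompact : compact S.
  have box : compact [set v : 'rV[R]_d | forall i, v ord0 i \in `[(-1 : R), 1]].
    by apply: (@rV_compact R _ (fun=> `[(-1 : R), 1]%classic)) => _; exact: segment_compact.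
  apply: subclosed_compact Sclosed box _ => w wS i.
  rewrite in_itv/= -ler_norml -(@expr_le1 _ 2)// real_normK ?num_real//.
  rewrite -[leRHS]wS /dotp (bigD1 i)//= !mxE -expr2 lerDl.
  by apply: sumr_ge0 => j _; rewrite -expr2 sqr_ge0.
have [|w /set_mem wS wmin] := EVT_min_rV _ Scompact (continuous_subspaceT gC).
  by exists ((enorm v0)^-1 *: v0)^T; rewrite /S/= trmxK normalize.
exists w^T; split=> // v.
have [->|vn0] := eqVneq v 0; first by rewrite mulmx0 !dotp0r mulr0.
have := wmin ((enorm v)^-1 *: v)^T; rewrite inE /S/= trmxK normalize// => /(_ erefl).
rewrite /g trmxK -scalemxAr dotpZl dotpZr mulrA -expr2 exprVn -enorm_sqr => h.
rewrite mulrC -ler_pdivlMl// exprn_gt0// lt_def enorm_ge0 andbT.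
by apply: contra_neq vn0 => e0; apply: dotp_eq0; rewrite -enorm_sqr e0 expr0n.
Qed.

(** A minimizer u of the Rayleigh quotient is stationary, hence an eigenvector of A
    with eigenvalue l = u^T A u; as l >= 0, it is a singular value of A. *)
Lemma sigma_min_le_form (v : 'cV[R]_d) :
  sigma_min A * dotp v v <= dotp v (A *m v).
Proof.
have [->|vn0] := eqVneq v 0; first by rewrite mulmx0 !dotp0r mulr0.
have [u [u1 umin]] := rayleigh_min vn0.
set l := dotp u (A *m u) in umin.
apply: le_trans (umin v); rewrite ler_wpM2r ?dotp_ge0//.
have eigen : A *m u = l *: u.
  have [w wE] : exists w, w = A *m u - l *: u by eexists.
  have q0 (t : R) : 0 <= 2 * t * dotp w w + t ^+ 2 * (dotp w (A *m w) - l * dotp w w).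
    have := umin (u + t *: w).
    rewrite !mulmxDr -!scalemxAr !dotpDl !dotpDr !dotpZl !dotpZr u1.
    rewrite (dotp_mulmx u w) -/l.
    have ww : dotp w w = dotp w (A *m u) - l * dotp w u.
      by rewrite {2}wE dotpBr dotpZr.
    by rewrite (dotpC u w) ww; lra.
  suff /dotp_eq0 w0 : dotp w w = 0 by apply/eqP; rewrite -subr_eq0 -wE w0.
  exact: quadratic_ge0_linear0 q0.
have l0 : 0 <= l by exact: A_psd.
apply: ge_inf; first by exists 0 => s [].
split=> //; apply/eigenvalueP; exists u^T.
  have Au : u^T *m A = l *: u^T.
    by rewrite -[A in LHS]A_sym -trmx_mul eigen linearZ.
  by rewrite A_sym mulmxA Au -scalemxAl Au scalerA -expr2.
apply/eqP => /(congr1 trmx); rewrite trmxK trmx0 => u0.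
by move: u1; rewrite u0 dotp0r => /esym/eqP; rewrite oner_eq0.
Qed.
End SmallestSingularValue.

(** * Ridge regression *)

Section Ridge.
Context (R : realType) (d : nat).
Variable x : nat -> 'cV[R]_d.

Definition ridge_form (t : nat) (lam : R) (w : 'cV[R]_d) : R :=
  \sum_(s < t) dotp (x s) w ^+ 2 + lam * dotp w w.

Definition ridge_loss (v : nat -> R) (t : nat) (lam : R) (b : 'cV[R]_d) : R :=
  \sum_(s < t) (v s - dotp (x s) b) ^+ 2 + lam * dotp b b.

(** Stationarity of the ridge loss at b.  It is linear in (v, b), so it is
    inherited by linear combinations of the two arms. *)
Definition normal_equation (v : nat -> R) (t : nat) (lam : R) (b : 'cV[R]_d) :=
  forall w, \sum_(s < t) (v s - dotp (x s) b) * dotp (x s) w = lam * dotp b w.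

(** The matrix of the form is invertible, because the coercive form vanishes at
    the vectors of its kernel. *)
Lemma ridge_form_represents (t : nat) (lam c : R) : 0 < c ->
  (forall w, c * dotp w w <= ridge_form t lam w) ->
  forall g, exists z, forall w,
    \sum_(s < t) dotp (x s) z * dotp (x s) w + lam * dotp z w = dotp g w.
Proof.
move=> c0 coercive g.
pose H : 'M[R]_d := \sum_(s < t) x s *m (x s)^T + lam%:M.
have HE z w : dotp (H *m z) w =
    \sum_(s < t) dotp (x s) z * dotp (x s) w + lam * dotp z w.
  rewrite mulmxDl dotpDl mulmx_suml mul_scalar_mx dotpZl; congr (_ + _).
  rewrite (dotp_suml t (fun s => x s *m (x s)^T *m z)); apply: eq_bigr => s _.
  by rewrite mulmx_outer dotpZl.
have Hunit : H \in unitmx.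
  rewrite -row_free_unit -kermx_eq0; apply/eqP/row_matrixP => i; rewrite row0.
  apply/eqP; apply: contraT => un0; set u := row i (kermx H) in un0.
  have uH : u *m H = 0 by apply/sub_kermxP; exact: row_sub.
  have : ridge_form t lam u^T = 0.
    rewrite /ridge_form -[RHS](_ : dotp (H *m u^T) u^T = 0).
      by rewrite HE; congr (_ + _); apply: eq_bigr => s _; rewrite expr2.
    rewrite dotpC /dotp; transitivity ((u *m H *m u^T) 0 0).
      by rewrite -mulmxA mxE; apply: eq_bigr => j _; rewrite mxE.
    by rewrite uH mul0mx mxE.
  move=> q0; have := coercive u^T; rewrite q0 pmulr_rle0// => uu.
  have /dotp_eq0 /(congr1 trmx) : dotp u^T u^T = 0.
    by apply/eqP; rewrite eq_le uu dotp_ge0.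
  by rewrite trmxK trmx0 => u0; rewrite u0 eqxx in un0.
by exists (invmx H *m g) => w; rewrite -HE mulmxA mulmxV// mul1mx.
Qed.

Lemma ridge_loss_eq (v : nat -> R) (t : nat) (lam : R) (b b' : 'cV[R]_d) :
  normal_equation v t lam b ->
  ridge_loss v t lam b' = ridge_loss v t lam b + ridge_form t lam (b' - b).
Proof.
move=> /(_ (b' - b)); rewrite /ridge_loss /ridge_form.
rewrite !dotpBr !dotpBl (dotpC b b').
have -> : \sum_(s < t) (v s - dotp (x s) b') ^+ 2 =
  \sum_(s < t) (v s - dotp (x s) b) ^+ 2
  - 2 * \sum_(s < t) (v s - dotp (x s) b) * dotp (x s) (b' - b)
  + \sum_(s < t) dotp (x s) (b' - b) ^+ 2.
  rewrite mulr_sumr -sumrB -big_split/=; apply: eq_bigr => s _.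
  by rewrite dotpBr; ring.
by move=> ->; ring.
Qed.

Lemma ridge_minimizer_exists (v : nat -> R) (t : nat) (lam c : R) : 0 < c ->
  (forall w, c * dotp w w <= ridge_form t lam w) ->
  exists b, normal_equation v t lam b.
Proof.
move=> c0 coercive.
have [b bE] := ridge_form_represents c0 coercive (\sum_(s < t) v s *: x s).
exists b => w; have := bE w; rewrite (dotp_suml t (fun s => v s *: x s)) => h.
under eq_bigr do rewrite mulrBl.
rewrite sumrB; apply/eqP; rewrite subr_eq addrC h; apply/eqP.
by apply: eq_bigr => s _; rewrite dotpZl.
Qed.

Lemma argmin_ridge_loss (v : nat -> R) (t : nat) (lam : R) : 0 < lam ->
  normal_equation v t lam (argmin setT (ridge_loss v t lam)).
Proof.
move=> lam0; set b := argmin _ _.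
have coercive w : lam * dotp w w <= ridge_form t lam w.
  by rewrite lerDr; apply: sumr_ge0 => s _; exact: sqr_ge0.
have [b0 b0N] := ridge_minimizer_exists v lam0 coercive.
have [|_ bmin] := getPex (P := [set a | setT a /\
    forall b, setT b -> ridge_loss v t lam a <= ridge_loss v t lam b]).
  exists b0; split=> // b' _; rewrite (ridge_loss_eq b' b0N) lerDl.
  by apply: le_trans (coercive _); rewrite mulr_ge0 ?dotp_ge0// ltW.
move=> w; apply/eqP; rewrite eq_sym -subr_eq0; apply/eqP.
apply: (@quadratic_ge0_linear0 _ _ (ridge_form t lam w)) => r.
have := bmin (b + r *: w) I; rewrite -/(argmin _ _) -/b -subr_ge0.
congr (0 <= _); rewrite /ridge_loss /ridge_form.
rewrite !dotpDl !dotpDr !dotpZl !dotpZr (dotpC w b).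
have -> : \sum_(s < t) (v s - dotp (x s) (b + r *: w)) ^+ 2 =
  \sum_(s < t) (v s - dotp (x s) b) ^+ 2
  - 2 * r * \sum_(s < t) (v s - dotp (x s) b) * dotp (x s) w
  + r ^+ 2 * \sum_(s < t) dotp (x s) w ^+ 2.
  rewrite !mulr_sumr -sumrB -big_split/=; apply: eq_bigr => s _.
  by rewrite dotpDr dotpZr; ring.
by ring.
Qed.

Lemma ridge_form_minimizer_le (v : nat -> R) (t : nat) (lam : R) (b : 'cV[R]_d) :
  0 <= lam -> normal_equation v t lam b ->
  ridge_form t lam b <= \sum_(s < t) v s ^+ 2.
Proof.
move=> lam0 /(_ b); rewrite /ridge_form.
have : 0 <= \sum_(s < t) (v s - dotp (x s) b) ^+ 2.
  by apply: sumr_ge0 => s _; exact: sqr_ge0.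
have -> : \sum_(s < t) (v s - dotp (x s) b) ^+ 2 =
  \sum_(s < t) v s ^+ 2 - 2 * \sum_(s < t) (v s - dotp (x s) b) * dotp (x s) b
  - \sum_(s < t) dotp (x s) b ^+ 2.
  rewrite mulr_sumr -!sumrB; apply: eq_bigr => s _; ring.
have := mulr_ge0 lam0 (dotp_ge0 b); lra.
Qed.

End Ridge.

Lemma gram_form_ge (R : realType) (d : nat) (x : nat -> 'cV[R]_d) (t : nat)
    (c : R) : (0 < t)%N -> c <= sigma_min (gram x t) ->
  forall v, c * t%:R * dotp v v <= \sum_(s < t) dotp (x s) v ^+ 2.
Proof.
move=> t0 ct.
have t0R : 0 < t%:R :> R by rewrite ltr0n.
have formE v : dotp v (gram x t *m v) = t%:R^-1 * \sum_(s < t) dotp (x s) v ^+ 2.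
  rewrite -scalemxAl dotpZr mulmx_suml; congr (_ * _).
  rewrite dotpC (dotp_suml t (fun s => x s *m (x s)^T *m v)).
  by apply: eq_bigr => s _; rewrite mulmx_outer dotpZl expr2.
have gram_sym : (gram x t)^T = gram x t.
  rewrite /gram linearZ/= linear_sum/=; congr (_ *: _); apply: eq_bigr => s _.
  by rewrite trmx_mul trmxK.
have gram_psd (w : 'cV[R]_d) : 0 <= dotp w (gram x t *m w).
  rewrite formE mulr_ge0 ?invr_ge0 ?ler0n//.
  by apply: sumr_ge0 => s _; exact: sqr_ge0.
move=> v; have := sigma_min_le_form gram_sym gram_psd v; rewrite formE => h.
rewrite mulrAC -ler_pdivlMr// [leRHS]mulrC; apply: le_trans h.
by rewrite ler_wpM2r ?dotp_ge0.
Qed.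

(** * Regret telescoping and Hardy's inequality *)

Section Regret.
Context (R : realType).

(** The hypothesis says that the loss of round s raises the regularized objective,
    minimal at b s, by at least c s.  With the next iterate as competitor this
    telescopes, because lam is nondecreasing and pot is nonnegative. *)
Lemma ftrl_regret (B : Type) (f : nat -> B -> R) (lam : nat -> R) (pot : B -> R)
    (b : nat -> B) (c : nat -> R) (n : nat) :
  (forall a, 0 <= pot a) -> 0 <= lam 0%N ->
  (forall s, (s < n)%N -> lam s <= lam s.+1) ->
  (forall s a, (s <= n)%N ->
     \sum_(i < s) f i (b s) + lam s * pot (b s) + c s <=
     \sum_(i < s) f i a + lam s * pot a + f s a) ->
  forall a, \sum_(s < n.+1) c s <= \sum_(s < n.+1) f s a + lam n * pot a.
Proof.
move=> pot0 lam0; elim: n => [|n IH] lam_mono step a.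
  have := step 0%N a (leqnn _); rewrite !big_ord0 !add0r !big_ord1 addrC => h.
  have := mulr_ge0 lam0 (pot0 (b 0%N)); lra.
rewrite big_ord_recr [in leRHS]big_ord_recr/=.
have {}IH := IH (fun s sn => lam_mono s (ltnW sn))
  (fun s a' sn => step s a' (leqW sn)) (b n.+1).
have := step n.+1 a (leqnn _).
have := ler_wpM2r (pot0 (b n.+1)) (lam_mono n (ltnSn n)).
lra.
Qed.

(** By ridge_loss_eq, a competitor whose prediction differs by w from that of b s
    has an excess past loss of at least w^2 / h s; the minimum of
    (e - w)^2 + w^2 / h over w is e^2 / (1 + h). *)
Lemma ridge_regret (d : nat) (x : nat -> 'cV[R]_d) (v lam h : nat -> R)
    (b : nat -> 'cV[R]_d) (n : nat) :
  (forall s, 0 <= lam s) -> (forall s, (s < n)%N -> lam s <= lam s.+1) ->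
  (forall s, (s <= n)%N -> normal_equation x v s (lam s) (b s)) ->
  (forall s, (s <= n)%N -> 0 < h s) ->
  (forall s w, (s <= n)%N -> dotp (x s) w ^+ 2 <= h s * ridge_form x s (lam s) w) ->
  forall a, \sum_(s < n.+1) (v s - dotp (x s) (b s)) ^+ 2 / (1 + h s) <=
            \sum_(s < n.+1) (v s - dotp (x s) a) ^+ 2 + lam n * dotp a a.
Proof.
move=> lam0 lam_mono normal h0 lev.
apply: (@ftrl_regret _ (fun s a => (v s - dotp (x s) a) ^+ 2) lam
  (fun a => dotp a a) b
  (fun s => (v s - dotp (x s) (b s)) ^+ 2 / (1 + h s))) => //.
- by move=> a; exact: dotp_ge0.
move=> s a sn; have := ridge_loss_eq a (normal s sn); rewrite /ridge_loss => ->.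
rewrite -[leRHS]addrA lerD2l.
have := lev s (a - b s) sn; have hs := h0 s sn.
set Q := ridge_form _ _ _ _.
have -> : v s - dotp (x s) a = (v s - dotp (x s) (b s)) - dotp (x s) (a - b s).
  by rewrite dotpBr; lra.
move: (v s - _) (dotp _ _) => e w wQ.
rewrite ler_pdivrMr ?addr_gt0//.
have h1 : 0 <= (h s * e - (1 + h s) * w) ^+ 2 := sqr_ge0 _.
rewrite -(ler_pM2l hs).
have := ler_wpM2l (ltW (addr_gt0 ltr01 hs)) wQ.
move: (h s) hs h1 => k k0; lra.
Qed.

(** If m and M are consecutive averages then a n = (n + 1) M - n m, and the right
    side gains n (M - m)^2 over the left side. *)
Lemma hardy_step (S : nat -> R) (a : nat -> R) (n : nat) :
  (forall t, S t.+1 = S t + a t) -> S 0%N = 0 ->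
  \sum_(t < n) (S t.+1 / t.+1%:R) ^+ 2 + n%:R * (S n / n%:R) ^+ 2 <=
  2 * \sum_(t < n) S t.+1 / t.+1%:R * a t.
Proof.
move=> SE S0; elim: n => [|n IH]; first by rewrite !big_ord0 mul0r addr0 mulr0.
rewrite !big_ord_recr/=.
set M := S n.+1 / n.+1%:R; set m := S n / n%:R in IH *.
have aE : a n = (n%:R + 1) * M - n%:R * m.
  rewrite /M /m; have -> : n.+1%:R = n%:R + 1 :> R by rewrite -natr1.
  have n1 : n%:R + 1 != 0 :> R by rewrite gt_eqF// ltr_wpDl.
  rewrite [X in _ = X - _]mulrC divfK// SE.
  case: (n) S0 => [->|k _]; first by rewrite mul0r; ring.
  by rewrite [X in _ = _ - X]mulrC divfK ?pnatr_eq0//; ring.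
have : 0 <= n%:R * (M - m) ^+ 2 by rewrite mulr_ge0 ?sqr_ge0 ?ler0n.
rewrite aE -(natr1 n); lra.
Qed.

(** Hardy's inequality for p = 2; the boundary term serves the summation by parts
    below. *)
Lemma hardy (a : nat -> R) (n : nat) : (forall t, 0 <= a t) ->
  \sum_(t < n) ((\sum_(s < t.+1) a s) / t.+1%:R) ^+ 2 +
    n%:R * ((\sum_(s < n) a s) / n%:R) ^+ 2 <= 4 * \sum_(t < n) a t ^+ 2.
Proof.
move=> a0.
have SE t : \sum_(s < t.+1) a s = \sum_(s < t) a s + a t by rewrite big_ord_recr.
have := @hardy_step (fun t => \sum_(s < t) a s) a n SE (big_ord0 _ _ _ _).
set P := \sum_(t < n) _ ^+ 2; set Q := n%:R * _; set X := \sum_(t < n) _.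
have : 2 * X <= 2^-1 * P + 2 * \sum_(t < n) a t ^+ 2.
  rewrite /X /P !mulr_sumr -big_split/=; apply: ler_sum => t _.
  set M := _ / _; have := sqr_ge0 (M / 2 - a t); lra.
have : 0 <= Q by rewrite /Q mulr_ge0 ?ler0n ?sqr_ge0.
lra.
Qed.

(** Summation by parts replaces g by its partial sums and the averages of a by their
    decrements, at most average / (t + 1); the result is bounded by the sum of the
    squared averages. *)
Lemma hardy_weighted (a g : nat -> R) (K : R) (n : nat) :
  0 <= K -> (forall t, 0 <= a t) -> (forall t, 0 <= g t) ->
  (forall t, (t <= n)%N -> \sum_(s < t) g s <= K * \sum_(s < t) a s) ->
  \sum_(t < n) (\sum_(s < t.+1) a s) / t.+1%:R * g t <=
    4 * K * \sum_(t < n) a t ^+ 2.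
Proof.
move=> K0 a0 g0 gS.
pose S (t : nat) := \sum_(s < t) a s; pose G (t : nat) := \sum_(s < t) g s.
pose m (t : nat) := S t / t%:R.
have S0 t : 0 <= S t by apply: sumr_ge0.
have m0 t : 0 <= m t by rewrite divr_ge0.
have G0 t : 0 <= G t by apply: sumr_ge0.
have mE t : t%:R * m t = S t.
  rewrite /m; case: t => [|t]; first by rewrite mul0r /S big_ord0.
  by rewrite mulrC divfK ?pnatr_eq0.
have abel k : (k <= n)%N ->
    \sum_(t < k) m t.+1 * g t <= m k * G k + K * \sum_(t < k) m t ^+ 2.
  elim: k => [|k IH] kn.
    by rewrite !big_ord0 mulr0 addr0 mulr_ge0.
  rewrite !big_ord_recr/=.
  have -> : G k.+1 = G k + g k by rewrite /G big_ord_recr.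
  have kp : 0 < k%:R + 1 :> R by rewrite ltr_wpDl.
  have dm : (m k - m k.+1) * (k%:R + 1) <= m k.
    have := mE k.+1; rewrite -natr1 {1}/S big_ord_recr/= -/(S k) -mE => h.
    have := a0 k; lra.
  have : (m k - m k.+1) * G k <= K * m k ^+ 2.
    rewrite -(ler_pM2r kp).
    apply: (@le_trans _ _ (m k * G k)).
      by rewrite mulrAC ler_wpM2r.
    apply: (@le_trans _ _ (m k * (K * (k%:R * m k)))).
      by rewrite ler_wpM2l// mE; apply: gS; exact: ltnW.
    have := mulr_ge0 K0 (sqr_ge0 (m k)); lra.
  have := IH (ltnW kn); lra.
have := abel n (leqnn n).
have shift : \sum_(t < n) m t ^+ 2 <= \sum_(t < n) m t.+1 ^+ 2.
  case: (n) => [|k]; first by rewrite !big_ord0.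
  rewrite big_ord_recl big_ord_recr/= {1}/m invr0 mulr0 expr0n/= add0r.
  by rewrite lerDl sqr_ge0.
have := @hardy a n a0.
have : m n * G n <= K * (n%:R * m n ^+ 2).
  have -> : K * (n%:R * m n ^+ 2) = m n * (K * S n) by rewrite -mE; ring.
  by rewrite ler_wpM2l//; exact: gS.
rewrite -/(S n) -/(m n).
move=> h1 h2 h3; apply: (le_trans h3).
have := ler_wpM2l K0 shift; have := ler_wpM2l K0 h2.
rewrite -/(m _); lra.
Qed.

Lemma sum_inv_sqrt_le (n : nat) :
  \sum_(t < n) (Num.sqrt t.+1%:R)^-1 <= 2 * Num.sqrt n%:R :> R.
Proof.
elim: n => [|n IH]; first by rewrite big_ord0 mulr_ge0 ?sqrtr_ge0.
rewrite big_ord_recr/=.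
set p := Num.sqrt n.+1%:R; set q := Num.sqrt n%:R in IH *.
have p0 : 0 < p by rewrite sqrtr_gt0 ltr0n.
have q0 : 0 <= q by exact: sqrtr_ge0.
have pE : p ^+ 2 = q ^+ 2 + 1 by rewrite !sqr_sqrtr ?ler0n// natr1.
suff : p^-1 <= 2 * (p - q) by lra.
rewrite -(ler_pM2l p0) divff ?gt_eqF//.
have := sqr_ge0 (p - q); lra.
Qed.

Lemma count_le_real (m : R) (n : nat) : 0 <= m ->
  \sum_(t < n) (if t%:R <= m then 1 else 0 : R) <= m + 1.
Proof.
move=> m0.
suff : \sum_(t < n) (if t%:R <= m then 1 else 0 : R) <= Num.min n%:R (m + 1).
  by rewrite le_min => /andP[].
elim: n => [|n IH]; first by rewrite big_ord0 le_min lexx/=; lra.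
move: IH; rewrite big_ord_recr/= !le_min => /andP[h1 h2].
rewrite -(natr1 n); case: (leP n%:R m) => /= nm; lra.
Qed.

End Regret.

(** * Expectations over treatment paths *)

Section Mean.
Context (R : realType).
Variable p : seq bool -> R.

Definition draw (z : seq bool) (c : bool -> R) : R :=
  p z * c true + (1 - p z) * c false.

(** The expectation of X (Z_1, ..., Z_n) when p z is the conditional probability of
    Z_t = true given the past z; the last treatment is averaged out first. *)
Fixpoint mean (n : nat) (X : seq bool -> R) : R :=
  if n is m.+1 then mean m (fun z => draw z (fun k => X (rcons z k)))
  else X [::].

(** The value on the path z of the process whose increment, after the past z' and
    with treatment k, is c z' k. *)
Definition psum (c : seq bool -> bool -> R) (z : seq bool) : R :=
  \sum_(s < size z) c (take s z) (nth false z s).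

Lemma psum_nil c : psum c [::] = 0.
Proof. by rewrite /psum big_ord0. Qed.

Lemma psum_rcons c z k : psum c (rcons z k) = psum c z + c z k.
Proof.
rewrite /psum size_rcons big_ord_recr/= -cats1 take_size_cat// nth_cat ltnn.
rewrite subnn/=; congr (_ + _); apply: eq_bigr => s _.
by rewrite nth_cat takel_cat ?(ltn_ord s)// ltnW.
Qed.

Lemma eq_mean n X Y : (forall z, size z = n -> X z = Y z) -> mean n X = mean n Y.
Proof.
elim: n X Y => [|n IH] X Y XY /=; first exact: XY.
by apply: IH => z zn; rewrite /draw !XY// size_rcons zn.
Qed.

Lemma meanD n X Y : mean n (fun z => X z + Y z) = mean n X + mean n Y.
Proof.
elim: n X Y => [//|n IH] X Y /=; rewrite -IH; apply: eq_mean => z _.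
by rewrite /draw; ring.
Qed.

Lemma meanZ n a X : mean n (fun z => a * X z) = a * mean n X.
Proof.
elim: n X => [//|n IH] X /=; rewrite -IH; apply: eq_mean => z _.
by rewrite /draw; ring.
Qed.

Lemma meanB n X Y : mean n (fun z => X z - Y z) = mean n X - mean n Y.
Proof.
rewrite -mulN1r -meanZ -meanD; apply: eq_mean => z _.
by rewrite mulN1r.
Qed.

Lemma mean_cst n a : mean n (fun=> a) = a.
Proof.
elim: n => [//|n {2}<-] /=; apply: eq_mean => z _.
by rewrite /draw; ring.
Qed.

Lemma mean_psum n c :
  mean n (psum c) = \sum_(s < n) mean s (fun z => draw z (c z)).
Proof.
elim: n => [|n IH]; first by rewrite big_ord0 /= psum_nil.
rewrite big_ord_recr/= -IH -meanD; apply: eq_mean => z _.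
by rewrite /draw !psum_rcons; ring.
Qed.

(** Martingale increments are orthogonal. *)
Lemma mean_sqr_psum n c :
  (forall z, draw z (c z) = 0) ->
  mean n (fun z => psum c z ^+ 2) =
    \sum_(s < n) mean s (fun z => draw z (fun k => c z k ^+ 2)).
Proof.
move=> c0; elim: n => [|n IH]; first by rewrite big_ord0 /= psum_nil expr0n.
rewrite big_ord_recr/= -IH -meanD; apply: eq_mean => z _.
have := c0 z; rewrite /draw !psum_rcons => cz.
transitivity (psum c z ^+ 2 + (p z * c z true ^+ 2 + (1 - p z) * c z false ^+ 2) +
  2 * psum c z * (p z * c z true + (1 - p z) * c z false)); first by ring.
by rewrite cz mulr0 addr0.
Qed.

Hypothesis p01 : forall z, 0 < p z < 1.

Lemma draw_ge0 z c : (forall k, 0 <= c k) -> 0 <= draw z c.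
Proof.
by move=> c0; have /andP[p0 p1] := p01 z; rewrite addr_ge0// mulr_ge0// ?subr_ge0 ltW.
Qed.

Lemma le_mean n X Y : (forall z, size z = n -> X z <= Y z) -> mean n X <= mean n Y.
Proof.
elim: n X Y => [|n IH] X Y XY /=; first exact: XY.
apply: IH => z zn; rewrite /draw; have /andP[p0 p1] := p01 z.
by rewrite lerD// ler_wpM2l// ?XY ?size_rcons ?zn// ?subr_ge0 ltW.
Qed.

Lemma mean_ge0 n X : (forall z, size z = n -> 0 <= X z) -> 0 <= mean n X.
Proof. by move=> X0; rewrite -(mean_cst n 0); exact: le_mean. Qed.

End Mean.

Section Histories.
Context (R : realType) (d : nat).
Variables (D : design R d) (x : nat -> 'cV[R]_d) (y : bool -> nat -> R).

Definition decision_at (z : seq bool) : decision R d :=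
  D (rounds D x y z) (x (size z)).

Definition prob_at (z : seq bool) : R := prob (decision_at z).

Definition round_at (z : seq bool) (k : bool) : round R d :=
  Round (x (size z)) k (y k (size z)) (decision_at z).

Lemma size_rounds z : size (rounds D x y z) = size z.
Proof.
elim/last_ind: z => [//|z k IH].
by rewrite /rounds foldl_rcons size_rcons -/(rounds D x y z) IH size_rcons.
Qed.

Lemma rounds_rcons z k :
  rounds D x y (rcons z k) = rcons (rounds D x y z) (round_at z k).
Proof. by rewrite {1}/rounds foldl_rcons -/(rounds D x y z) size_rounds. Qed.

Lemma sum_rounds (G : round R d -> R) z :
  \sum_(r <- rounds D x y z) G r = psum (fun z k => G (round_at z k)) z.
Proof.
elim/last_ind: z => [|z k IH]; first by rewrite /= big_nil psum_nil.
by rewrite rounds_rcons big_rcons/= IH psum_rcons addrC.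
Qed.

Lemma path_prob_rcons z k :
  path_prob D x y (rcons z k) = path_prob D x y z * arm_prob (prob_at z) k.
Proof. by rewrite /path_prob rounds_rcons big_rcons/= mulrC. Qed.

Lemma expectation_mean (n : nat) (X : seq bool -> R) :
  expectation D x y (fun z : n.-tuple bool => X z) = mean prob_at n X.
Proof.
rewrite /expectation; elim: n X => [|n IH] X.
  rewrite (big_pred1 [tuple]) => [|z]; last by rewrite (tuple0 z) /= eqxx.
  by rewrite /path_prob big_nil mul1r.
pose snoc (zk : n.-tuple bool * bool) : n.+1.-tuple bool :=
  [tuple of rcons zk.1 zk.2].
have snoc_bij : bijective snoc.
  apply: inj_card_bij => [[z k] [z' k'] /(congr1 val) /= /rcons_inj[zz ->]|].
    by rewrite (val_inj zz).
  by rewrite card_prod !card_tuple card_bool expnS mulnC.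
rewrite (reindex snoc)/=; last exact: onW_bij.
rewrite -(pair_bigA _ (fun (z : n.-tuple bool) k =>
  path_prob D x y (rcons z k) * X (rcons z k)))/= -IH.
apply: eq_bigr => z _.
rewrite (bigD1 true)//= (bigD1 false)//= big_pred0 => [|[]//].
by rewrite !path_prob_rcons /draw/arm_prob; ring.
Qed.

Definition error_at (z : seq bool) (k : bool) : R :=
  y k (size z) - dotp (x (size z)) (predictor (decision_at z) k).

Hypothesis prob01 : forall z, 0 < prob_at z < 1.

(** The error of a round is (Z_t - p_t) (e_t(1) / p_t + e_t(0) / (1 - p_t)), a
    martingale increment whose conditional second moment is
    p_t (1 - p_t) (e_t(1) / p_t + e_t(0) / (1 - p_t))^2. *)
Lemma aipw_variance_mean (n : nat) : (1 <= n)%N ->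
  n%:R ^+ 2 * aipw_variance n D x y =
  \sum_(t < n) mean prob_at t (fun z =>
    error_at z true ^+ 2 / prob_at z + error_at z false ^+ 2 / (1 - prob_at z)
    - (error_at z true - error_at z false) ^+ 2).
Proof.
move=> n0; have n0R : n%:R != 0 :> R by rewrite pnatr_eq0 -lt0n.
pose effect (z : seq bool) (_ : bool) : R := y true (size z) - y false (size z).
pose c (z : seq bool) (k : bool) : R := aipw_term (round_at z k) - effect z k.
have cE z k : c z k = (k%:R - prob_at z) *
    (error_at z true / prob_at z + error_at z false / (1 - prob_at z)).
  have /andP[p0 p1] := prob01 z.
  have p1' : 1 - prob_at z != 0 by rewrite subr_eq0 gt_eqF.
  rewrite /c /effect /aipw_term /ipw /error_at /= -/(prob_at z).
  by case: k => /=; field; rewrite p1' gt_eqF.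
have draw_c z : draw prob_at z (c z) = 0 by rewrite /draw !cE /=; ring.
have psum_effect z : psum effect z = \sum_(t < size z) (y true t - y false t).
  elim/last_ind: z => [|z k IH]; first by rewrite psum_nil big_ord0.
  by rewrite psum_rcons IH size_rcons big_ord_recr.
pose total := \sum_(t < n) (y true t - y false t).
have aipwE (z : n.-tuple bool) :
    aipw D x y z = n%:R^-1 * (psum c z + total).
  rewrite /aipw sum_rounds; congr (_ * _).
  have -> : total = psum effect z by rewrite psum_effect size_tuple.
  rewrite /psum -big_split/=; apply: eq_bigr => s _.
  by rewrite /c /=; ring.
have mean_aipw : expectation D x y (@aipw R d n D x y) = n%:R^-1 * total.
  transitivity (mean prob_at n (fun z => n%:R^-1 * (psum c z + total))).
    rewrite -expectation_mean; apply: eq_bigr => z _; congr (_ * _).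
    exact: aipwE.
  rewrite meanZ meanD mean_psum mean_cst.
  rewrite big1 ?add0r// => s _.
  by rewrite (@eq_mean _ _ _ _ (fun=> 0)) ?mean_cst.
rewrite /aipw_variance mean_aipw.
transitivity (n%:R ^+ 2 * mean prob_at n
    (fun z => n%:R^-1 ^+ 2 * psum c z ^+ 2)).
  rewrite -expectation_mean; congr (_ * _); apply: eq_bigr => z _; congr (_ * _).
  by rewrite aipwE; ring.
rewrite meanZ mulrA -exprMn mulfV// expr1n mul1r.
rewrite mean_sqr_psum//; apply: eq_bigr => t _; apply: eq_mean => z _.
have /andP[p0 p1] := prob01 z.
have p1' : 1 - prob_at z != 0 by rewrite subr_eq0 gt_eqF.
by rewrite /draw !cE /=; field; rewrite p1' gt_eqF.
Qed.

End Histories.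

Lemma ler_sum_prefix (R : realType) (u : nat -> R) (m n : nat) :
  (forall s, 0 <= u s) -> (m <= n)%N -> \sum_(s < m) u s <= \sum_(s < n) u s.
Proof.
move=> u0; elim: n => [|n IH]; first by rewrite leqn0 => /eqP->.
rewrite leq_eqVlt => /predU1P[->//|]; rewrite ltnS => /IH le_n.
by rewrite (le_trans le_n)// [leRHS]big_ord_recr/= lerDl.
Qed.

(** * Fourth moments of martingales *)

Section MartingaleMoments.
Context (R : realType) (p : seq bool -> R).
Hypothesis p01 : forall z, 0 < p z < 1.

(** One more increment e changes the fourth moment of the martingale M by at most
    the mean of 8 M^2 e^2 + 3 e^4, as 4 M e^3 <= 2 M^2 e^2 + 2 e^4.  The product
    M^2 X is split by Young's inequality with weight lam = 1 / (8 W), for which the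
    total contribution of M^4 is half of the claimed bound. *)
Lemma mean_pow4_psum_le (n : nat) (c : seq bool -> bool -> R)
    (X Q : seq bool -> R) (a q : nat -> R) (W k2 Qt : R) :
  (forall z, draw p z (c z) = 0) ->
  (forall z, (size z < n)%N -> draw p z (fun k => c z k ^+ 2) <= a (size z) * X z) ->
  (forall z, (size z < n)%N -> draw p z (fun k => c z k ^+ 4) <= Q z) ->
  (forall s, 0 <= a s) -> 0 < W -> \sum_(s < n) a s <= W ->
  0 <= k2 -> (forall s, (s < n)%N -> mean p s (fun z => X z ^+ 2) <= k2) ->
  (forall s, 0 <= q s) -> (forall s, (s < n)%N -> mean p s Q <= q s) ->
  \sum_(s < n) q s <= Qt ->
  mean p n (fun z => psum c z ^+ 4) <= 64 * W ^+ 2 * k2 + 6 * Qt.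
Proof.
move=> c0 c2 c4 a0 W0 aW k20 Xk2 q0 Qq qQt.
set B := 64 * W ^+ 2 * k2 + 6 * Qt.
pose lam := (8 * W)^-1.
have lam0 : 0 < lam by rewrite invr_gt0 mulr_gt0.
have Qt0 : 0 <= Qt by apply: le_trans qQt; apply: sumr_ge0.
have B0 : 0 <= B.
  by apply: addr_ge0; apply: mulr_ge0 => //; rewrite mulr_ge0// sqr_ge0.
pose u s := 4 * a s * (lam * B + k2 / lam) + 3 * q s.
have u_ge0 s : 0 <= u s.
  apply: addr_ge0; last by rewrite mulr_ge0.
  apply: mulr_ge0; first by rewrite mulr_ge0.
  by apply: addr_ge0; [rewrite mulr_ge0// ltW|rewrite divr_ge0// ltW].
have sum_u m : (m <= n)%N -> \sum_(s < m) u s <= B.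
  move=> mn; apply: (@le_trans _ _ (\sum_(s < n) u s)).
    exact: ler_sum_prefix.
  rewrite big_split/= -mulr_suml -!mulr_sumr.
  (* The feedback term 4 W lam B is B / 2 by the choice of lam. *)
  have E1 : 4 * W * (lam * B + k2 / lam) = B / 2 + 32 * W ^+ 2 * k2.
    by rewrite /lam; field; rewrite gt_eqF.
  have : 4 * (\sum_(s < n) a s) * (lam * B + k2 / lam) <=
         4 * W * (lam * B + k2 / lam).
    apply: ler_wpM2r; last by rewrite ler_wpM2l.
    by apply: addr_ge0; [rewrite mulr_ge0// ltW|rewrite divr_ge0// ltW].
  rewrite E1 /B; lra.
suff claim m : (m <= n)%N ->
    mean p m (fun z => psum c z ^+ 4) <= \sum_(s < m) u s.
  exact: le_trans (claim n (leqnn n)) (sum_u n (leqnn n)).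
elim: m => [|m IH] mn; first by rewrite big_ord0 /= psum_nil expr0n.
have {}IH := IH (ltnW mn).
have IHB := le_trans IH (sum_u m (ltnW mn)).
rewrite big_ord_recr/=.
pose M z := psum c z.
apply: (@le_trans _ _ (mean p m (fun z => M z ^+ 4 +
    (4 * a m * (lam * M z ^+ 4 + lam^-1 * X z ^+ 2) + 3 * Q z)))).
  apply: le_mean => // z zm; rewrite /M /draw !psum_rcons.
  have zn : (size z < n)%N by rewrite zm.
  have := c2 z zn; have := c4 z zn; have := c0 z; rewrite /draw zm.
  have /andP[p0 p1] := p01 z.
  move: (psum c z) (c z true) (c z false) => S ct cf h0 h4 h2.
  have pw (e : R) : (S + e) ^+ 4 <= S ^+ 4 + 4 * S ^+ 3 * e + 8 * S ^+ 2 * e ^+ 2 + 3 * e ^+ 4.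
    rewrite -subr_ge0.
    have -> : S ^+ 4 + 4 * S ^+ 3 * e + 8 * S ^+ 2 * e ^+ 2 + 3 * e ^+ 4 - (S + e) ^+ 4 =
      2 * e ^+ 2 * (S - e) ^+ 2 by ring.
    by rewrite mulr_ge0 ?sqr_ge0// mulr_ge0// sqr_ge0.
  have pt := ler_wpM2l (ltW p0) (pw ct).
  have p1' : 0 <= 1 - p z by rewrite subr_ge0 ltW.
  have pf := ler_wpM2l p1' (pw cf).
  have hM : 8 * S ^+ 2 * X z <= 4 * (lam * S ^+ 4 + lam^-1 * X z ^+ 2).
    rewrite -(ler_pM2l lam0) -subr_ge0.
    have -> : lam * (4 * (lam * S ^+ 4 + lam^-1 * X z ^+ 2)) - lam * (8 * S ^+ 2 * X z) =
      4 * (lam * S ^+ 2 - X z) ^+ 2 by field; rewrite gt_eqF.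
    by rewrite mulr_ge0 ?sqr_ge0.
  have {}hM := ler_wpM2l (a0 m) hM.
  have S2 : 0 <= 8 * S ^+ 2 by rewrite mulr_ge0 ?sqr_ge0.
  have {}h2 := ler_wpM2l S2 h2.
  have h3 : 4 * S ^+ 3 * (p z * ct + (1 - p z) * cf) = 0 by rewrite h0 mulr0.
  lra.
rewrite !meanD !meanZ meanD !meanZ.
have h1 := ler_wpM2l (ltW lam0) IHB.
have ilam0 : 0 <= lam^-1 by rewrite invr_ge0 ltW.
have h2 := ler_wpM2l ilam0 (Xk2 m mn).
have h3 := Qq m mn.
have a4 : 0 <= 4 * a m by rewrite mulr_ge0.
have := ler_wpM2l a4 (lerD h1 h2).
have -> : u m = 4 * a m * (lam * B + lam^-1 * k2) + 3 * q m by rewrite /u [k2 / lam]mulrC.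
rewrite /M; lra.
Qed.

End MartingaleMoments.

(** * Radii, regularization and leverage *)

Section Scales.
Context (R : realType) (d : nat).
Variables (x : nat -> 'cV[R]_d) (n : nat) (c2 gamma0 K : R).

Definition horizon_sqrt : R := Num.sqrt n.+1%:R.
Local Notation r := horizon_sqrt.

Definition radius (t : nat) : R := \big[Num.max/1]_(s < t.+1) enorm (x s).

Definition reg (t : nat) : R := r * radius t.

(** An upper bound for x_t^T H_t^-1 x_t, where H_t is the regularized Gram matrix
    of the past covariates.  The first bound comes from the regularization, the
    second from the smallest eigenvalue of the Gram matrix, which is controlled
    from time gamma0 sqrt T on. *)
Definition leverage (t : nat) : R :=
  if (0 < t)%N && (r * gamma0 <= t%:R)
  then Num.min (radius t / r) (c2 * radius t ^+ 2 / t%:R) else radius t / r.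

Lemma horizon_sqrt_ge1 : 1 <= r.
Proof. by rewrite -[leLHS]sqrtr1 ler_sqrt ?ltr0n// ler1n. Qed.

Lemma horizon_sqrt_gt0 : 0 < r.
Proof. exact: lt_le_trans ltr01 horizon_sqrt_ge1. Qed.

Lemma horizon_sqrt_sqr : r ^+ 2 = n.+1%:R.
Proof. by rewrite sqr_sqrtr ?ler0n. Qed.

Lemma radius_ge1 t : 1 <= radius t.
Proof. exact: bigmax_ge_id. Qed.

Lemma radius_gt0 t : 0 < radius t.
Proof. exact: lt_le_trans ltr01 (radius_ge1 t). Qed.

Lemma radius_mono s t : (s <= t)%N -> radius s <= radius t.
Proof. by move=> st; apply: (@le_bigmax_ord _ _ _ _ _ xpredT (fun s => enorm (x s))). Qed.

Lemma enorm_le_radius t : enorm (x t) <= radius t.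
Proof. exact: (le_bigmax _ (fun s : 'I_t.+1 => enorm (x s)) ord_max). Qed.

Lemma dotp_sqr_le_radius t w : dotp (x t) w ^+ 2 <= radius t ^+ 2 * dotp w w.
Proof.
apply: le_trans (dotp_CauchySchwarz _ _) _; rewrite -enorm_sqr ler_wpM2r ?dotp_ge0//.
by rewrite lerXn2r ?nnegrE ?enorm_ge0 ?enorm_le_radius// ltW ?radius_gt0.
Qed.

Lemma reg_gt0 t : 0 < reg t.
Proof. by rewrite mulr_gt0 ?radius_gt0 ?horizon_sqrt_gt0. Qed.

Lemma reg_mono s t : (s <= t)%N -> reg s <= reg t.
Proof. by move=> st; rewrite ler_wpM2l ?radius_mono// ltW ?horizon_sqrt_gt0. Qed.

Hypothesis (c2_gt0 : 0 < c2) (gamma0_gt0 : 0 < gamma0).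

Lemma leverage_le t : leverage t <= radius t / r.
Proof. by rewrite /leverage; case: ifP => // _; rewrite ge_min lexx. Qed.

Lemma leverage_gt0 t : 0 < leverage t.
Proof.
have h : 0 < radius t / r by rewrite divr_gt0 ?radius_gt0 ?horizon_sqrt_gt0.
rewrite /leverage; case: ifP => // /andP[t0 _].
by rewrite lt_min h divr_gt0 ?mulr_gt0 ?exprn_gt0 ?radius_gt0 ?ltr0n.
Qed.

(** Three factors are bounded by radius t / r and the fourth by the late bound, so
    that the square roots of the right side add up to O((radius n)^2). *)
Lemma leverage_pow4_le t :
  leverage t ^+ 4 * r / radius t <=
  (gamma0 + 1 + 2 * c2) * (radius t ^+ 4 / (n.+1%:R * t.+1%:R)).
Proof.
have r1 := horizon_sqrt_ge1; have r0 := horizon_sqrt_gt0.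
have p1 := radius_ge1 t; have p0 := radius_gt0 t.
rewrite -horizon_sqrt_sqr.
have l0 := leverage_gt0 t.
have t1 : 0 < t.+1%:R :> R by rewrite ltr0n.
have l1 := leverage_le t.
have l3 : leverage t ^+ 3 <= (radius t / r) ^+ 3.
  by rewrite lerXn2r ?nnegrE// ltW// divr_gt0.
have bound (l : R) : leverage t <= l ->
    leverage t ^+ 4 * r / radius t <= radius t ^+ 2 / r ^+ 2 * l.
  move=> ll; have -> : radius t ^+ 2 / r ^+ 2 * l =
      (radius t / r) ^+ 3 * l * r / radius t.
    by field; rewrite !gt_eqF.
  rewrite ler_wpM2r ?invr_ge0 ?(ltW p0)// ler_wpM2r ?(ltW r0)//.
  by rewrite exprSr ler_pM ?exprn_ge0// ltW.
case: (boolP ((0 < t)%N && (r * gamma0 <= t%:R))) => [/andP[t0 late]|early].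
  have lev2 : leverage t <= c2 * radius t ^+ 2 / t%:R.
    by rewrite /leverage t0 late/= ge_min lexx orbT.
  apply: le_trans (bound _ lev2) _.
  have t0R : 0 < t%:R :> R by rewrite ltr0n.
  have -> : radius t ^+ 2 / r ^+ 2 * (c2 * radius t ^+ 2 / t%:R) =
    c2 * t.+1%:R / t%:R * (radius t ^+ 4 / (r ^+ 2 * t.+1%:R)).
    by field; rewrite !gt_eqF.
  rewrite ler_wpM2r//.
    by rewrite divr_ge0 ?mulr_ge0 ?exprn_ge0// ltW.
  rewrite ler_pdivrMr// -natr1.
  have t1R : 1 <= t%:R :> R by rewrite ler1n.
  have := mulr_ge0 (ltW gamma0_gt0) (ltW t0R).
  have := ler_wpM2l (ltW c2_gt0) t1R; lra.
apply: le_trans (bound _ l1) _.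
have -> : radius t ^+ 2 / r ^+ 2 * (radius t / r) =
    t.+1%:R / (r * radius t) * (radius t ^+ 4 / (r ^+ 2 * t.+1%:R)).
  by field; rewrite !gt_eqF.
rewrite ler_wpM2r//.
  by rewrite divr_ge0 ?mulr_ge0 ?exprn_ge0// ltW.
rewrite ler_pdivrMr ?mulr_gt0//.
have t_le : t.+1%:R <= r * gamma0 + 1.
  move: early; rewrite negb_and -ltNge lt0n negbK => /orP[/eqP->|].
    by rewrite lerDr mulr_ge0// ltW.
  by rewrite -natr1 lerD2r => /ltW.
have rp : r <= r * radius t by rewrite ler_peMr// ltW.
have h1 := ler_wpM2l (ltW gamma0_gt0) rp.
have h2 := mulr_ge0 (ltW c2_gt0) (ltW (mulr_gt0 r0 p0)).
lra.
Qed.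

Hypothesis gram_ge : forall t, (0 < t <= n)%N -> r * gamma0 <= t%:R ->
  forall v, t%:R / c2 * dotp v v <= \sum_(s < t) dotp (x s) v ^+ 2.

Lemma leverageP t w : (t <= n)%N ->
  dotp (x t) w ^+ 2 <= leverage t * ridge_form x t (reg t) w.
Proof.
move=> tn; have r0 := horizon_sqrt_gt0; have p0 := radius_gt0 t.
have ww := dotp_ge0 w.
have S0 : 0 <= \sum_(s < t) dotp (x s) w ^+ 2.
  by apply: sumr_ge0 => s _; exact: sqr_ge0.
have Q1 : reg t * dotp w w <= ridge_form x t (reg t) w by rewrite lerDr.
have b1 : dotp (x t) w ^+ 2 <= radius t / r * ridge_form x t (reg t) w.
  apply: le_trans (dotp_sqr_le_radius t w) _.
  have -> : radius t ^+ 2 * dotp w w = radius t / r * (reg t * dotp w w).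
    by rewrite /reg; field; rewrite gt_eqF.
  by rewrite ler_wpM2l// divr_ge0// ltW.
rewrite /leverage; case: ifP => // /andP[t0 late].
rewrite minElt; case: ifP => // _.
apply: le_trans (dotp_sqr_le_radius t w) _.
have t0R : 0 < t%:R :> R by rewrite ltr0n.
have -> : radius t ^+ 2 * dotp w w =
    c2 * radius t ^+ 2 / t%:R * (t%:R / c2 * dotp w w).
  by field; rewrite !gt_eqF.
rewrite ler_wpM2l//; first by rewrite divr_ge0 ?mulr_ge0 ?sqr_ge0// ltW.
have tn' : (0 < t <= n)%N by rewrite t0.
apply: le_trans (gram_ge tn' late w) _.
by rewrite lerDl mulr_ge0// ltW// reg_gt0.
Qed.

End Scales.

(** * The Sigmoid-FTRL process *)

Section FtrlProcess.
Context (R : realType) (d : nat) (phi : R -> R) (b1 b2 b3 : R).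
Hypothesis sc : sigmoid_condition phi b1 b2 b3.
Hypothesis b2_gt0 : 0 < b2.
Variables (x : nat -> 'cV[R]_d) (y : bool -> nat -> R) (n : nat).

Let D : design R d := sigmoid_ftrl n.+1 phi.
Let p : seq bool -> R := prob_at D x y.

Definition inv_weight (z : seq bool) (k b : bool) : R :=
  (b == k)%:R / arm_prob (p z) k.

Definition pseudo_outcome (k : bool) (z : seq bool) (b : bool) : R :=
  y k (size z) * inv_weight z k b.

Definition fitted (z : seq bool) (k : bool) : R :=
  dotp (x (size z)) (predictor (decision_at D x y z) k).

Definition loss_estimate (k : bool) : seq bool -> R :=
  psum (fun z b => inv_weight z k b * (y k (size z) - fitted z k) ^+ 2).

Lemma ftrl_radius_rounds z :
  ftrl_radius (rounds D x y z) (x (size z)) = radius x (size z).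
Proof.
rewrite /ftrl_radius /radius.
have -> : \big[Num.max/1]_(r <- rounds D x y z) enorm (cov r) =
    \big[Num.max/1]_(s < size z) enorm (x s).
  rewrite -(big_mkord xpredT (fun s => enorm (x s))) /index_iota subn0.
  rewrite -(big_map (@cov R d) xpredT (fun v => enorm v)).
  rewrite -(big_map x xpredT (fun v => enorm v)); congr bigop.
  elim/last_ind: z => [//|z k IH].
  by rewrite rounds_rcons map_rcons IH size_rcons -[(size z).+1]addn1 iotaD map_cat /= cats1.
apply/eqP; rewrite eq_le ge_max enorm_le_radius andbT; apply/andP; split.
  exact: (@le_bigmax_ord _ _ _ _ _ xpredT (fun s => enorm (x s))).
apply: bigmax_le => [|s _]; first by rewrite le_max bigmax_ge_id.
have := ltn_ord s; rewrite ltnS leq_eqVlt le_max => /predU1P[->|sz].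
  by rewrite lexx orbT.
by rewrite (le_bigmax _ (fun i : 'I_(size z) => enorm (x i)) (Ordinal sz)).
Qed.

Lemma ftrl_rate_rounds z :
  (ftrl_rate n.+1 (rounds D x y z) (x (size z)))^-1 = reg x n (size z).
Proof.
by rewrite /ftrl_rate ftrl_radius_rounds invfM !invrK.
Qed.

Lemma ftrl_loss_rounds z k : ftrl_loss (rounds D x y z) k = loss_estimate k z.
Proof.
rewrite /ftrl_loss sum_rounds; apply: eq_bigr => s _.
rewrite /ipw /inv_weight /fitted /=; set b := nth _ _ _.
by case: eqP => [->//|_]; rewrite !mul0r.
Qed.

Lemma ftrl_loss_ge0 past k :
  all (fun r => 0 < prob (@dec R d r) < 1) past -> 0 <= ftrl_loss past k.
Proof.
rewrite /ftrl_loss; elim: past => [|r past IH]; first by rewrite big_nil.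
rewrite big_cons /= => /andP[/andP[r0 r1] /IH]; apply: addr_ge0.
rewrite mulr_ge0 ?sqr_ge0// /ipw divr_ge0//.
by rewrite /arm_prob; case: (k); rewrite ?subr_ge0 ltW.
Qed.

Lemma all_prob01 z : all (fun r => 0 < prob (dec r) < 1) (rounds D x y z).
Proof.
elim/last_ind: z => [//|z k IH]; rewrite rounds_rcons all_rcons IH andbT /=.
have rate_gt0 : 0 < (ftrl_rate n.+1 (rounds D x y z) (x (size z)))^-1.
  by rewrite ftrl_rate_rounds reg_gt0.
have [u [pu _]] := ftrl_prob_minimizer sc
  (fun k => ftrl_loss_ge0 k IH) rate_gt0.
by rewrite -pu; exact: sigmoid_range sc u.
Qed.

Lemma ftrl_prob01 z : 0 < p z < 1.
Proof.
by have := all_prob01 (rcons z true); rewrite rounds_rcons all_rcons => /andP[].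
Qed.

Lemma loss_estimate_ge0 k z : 0 <= loss_estimate k z.
Proof. by rewrite -ftrl_loss_rounds; apply: ftrl_loss_ge0; exact: all_prob01. Qed.

Lemma ftrl_prob_sigmoid z : exists u, phi u = p z /\ forall v,
  ftrl_objective phi (loss_estimate true z) (loss_estimate false z)
    (reg x n (size z)) u <=
  ftrl_objective phi (loss_estimate true z) (loss_estimate false z)
    (reg x n (size z)) v.
Proof.
rewrite -!ftrl_loss_rounds -ftrl_rate_rounds.
apply: (ftrl_prob_minimizer sc).
  by move=> k; apply: ftrl_loss_ge0; exact: all_prob01.
by rewrite ftrl_rate_rounds reg_gt0.
Qed.

Lemma arm_prob_bounds z k : 0 < arm_prob (p z) k < 1.
Proof.
have /andP[p0 p1] := ftrl_prob01 z.
by rewrite /arm_prob; case: k; rewrite ?p0 ?p1//; lra.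
Qed.

Lemma inv_arm_prob_ge1 z k : 1 <= (arm_prob (p z) k)^-1.
Proof.
have /andP[p0 p1] := arm_prob_bounds z k.
by rewrite invf_ge1// ltW.
Qed.

Lemma inv_arm_prob_pow4 z k :
  (arm_prob (p z) k)^-1 ^+ 4 <= (128 + 4 * b1 ^+ 4 * b2) *
    (1 + (loss_estimate true z + loss_estimate false z) / reg x n (size z)).
Proof.
have [u [<- umin]] := ftrl_prob_sigmoid z.
have h v := sigmoid_inv_pow4 sc b2_gt0 (v := v) (loss_estimate_ge0 true z)
  (loss_estimate_ge0 false z) (reg_gt0 x n _) umin.
case: k => /=; first exact: h.
by rewrite -(sigmoid_opp sc); apply: h; rewrite normrN.
Qed.

Lemma ftrl_normal_equation z k :
  normal_equation x (fun s => pseudo_outcome k (take s z) (nth false z s))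
    (size z) (reg x n (size z)) (predictor (decision_at D x y z) k).
Proof.
rewrite /decision_at /= /ftrl_pred ftrl_rate_rounds.
set v := (fun s : nat => _).
rewrite (_ : (fun beta : 'cV[R]_d => _) = ridge_loss x v (size z) (reg x n (size z))).
  by apply: argmin_ridge_loss; exact: reg_gt0.
apply/funext => beta; rewrite /ridge_loss enorm_sqr; congr (_ + _).
rewrite sum_rounds; apply: eq_bigr => s _.
rewrite /v /pseudo_outcome /ipw /inv_weight /= -/p.
rewrite size_takel; last exact: ltnW.
have -> : p (take s z) = ftrl_prob n.+1 phi (rounds D x y (take s z)) (x s).
  by rewrite /p /prob_at /decision_at /= size_takel// ltnW.
set b := nth _ _ _.
by case: (b =P k) => [->//|_]; rewrite !mul0r !mulr0.
Qed.

Lemma draw_inv_weight z k (c e : R) (m : nat) :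
  draw p z (fun b => (c * inv_weight z k b + e) ^+ m) =
  arm_prob (p z) k * (c / arm_prob (p z) k + e) ^+ m +
  (1 - arm_prob (p z) k) * e ^+ m.
Proof.
rewrite /draw /inv_weight; case: k => /=; rewrite !mul0r mulr0 add0r mul1r//.
by ring.
Qed.

Variables (c1 c2 gamma0 K : R).
Hypotheses (b1_gt0 : 0 < b1) (c1_gt0 : 0 < c1) (c2_gt0 : 0 < c2).
Hypotheses (gamma0_gt0 : 0 < gamma0) (K_ge1 : 1 <= K).
Local Notation r := (horizon_sqrt R n).
Local Notation rho := (radius x).
Local Notation lam := (reg x n).
Local Notation h := (leverage x n c2 gamma0).
Local Notation E := (mean p).
Local Notation err := (error_at D x y).
Hypothesis radius_sqr_le : rho n ^+ 2 <= K * r.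
Hypothesis gram_ge : forall t, (0 < t <= n)%N -> r * gamma0 <= t%:R ->
  forall v, t%:R / c2 * dotp v v <= \sum_(s < t) dotp (x s) v ^+ 2.
Hypothesis moment4_le : forall k, \sum_(t < n.+1) y k t ^+ 4 <= c1 ^+ 4 * n.+1%:R.

Let inv_prob (z : seq bool) (k : bool) : R := (arm_prob (p z) k)^-1.
Local Notation X := inv_prob.

Lemma partial_moment2_sqr_le (k : bool) (t : nat) : (t <= n.+1)%N ->
  (\sum_(s < t) y k s ^+ 2) ^+ 2 <= t%:R * (c1 ^+ 4 * n.+1%:R).
Proof.
move=> tn; have := sum_CauchySchwarz (fun=> 1) (fun s : 'I_t => y k s ^+ 2).
under eq_bigr do rewrite mul1r.
rewrite expr1n sumr_const card_ord => /le_trans; apply.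
rewrite ler_wpM2l//; apply: le_trans (moment4_le k).
have -> : \sum_(s < t) (y k s ^+ 2) ^+ 2 = \sum_(s < t) y k s ^+ 4.
  by apply: eq_bigr => s _; rewrite -exprM.
by apply: (@ler_sum_prefix _ (fun s => y k s ^+ 4)) => // s; rewrite exprn_even_ge0.
Qed.

Lemma moment2_le (k : bool) : \sum_(t < n.+1) y k t ^+ 2 <= c1 ^+ 2 * n.+1%:R.
Proof.
have T0 : 0 <= n.+1%:R :> R by rewrite ler0n.
have S0 : 0 <= \sum_(t < n.+1) y k t ^+ 2.
  by apply: sumr_ge0 => t _; exact: sqr_ge0.
have B0 : 0 <= c1 ^+ 2 * n.+1%:R := mulr_ge0 (sqr_ge0 _) T0.
rewrite -(@ler_pXn2r _ 2)//.
have -> : (c1 ^+ 2 * n.+1%:R) ^+ 2 = n.+1%:R * (c1 ^+ 4 * n.+1%:R) by ring.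
exact: partial_moment2_sqr_le.
Qed.

Lemma radius_le_K t : (t <= n)%N -> rho t <= K * r.
Proof.
move=> tn; apply: le_trans radius_sqr_le; apply: le_trans (radius_mono x tn) _.
by rewrite expr2 ler_peMr ?radius_ge1// ltW ?radius_gt0.
Qed.

Lemma leverage_le_K t : (t <= n)%N -> h t <= K.
Proof.
move=> tn; apply: le_trans (leverage_le _ _ _ _ _) _.
by rewrite ler_pdivrMr ?horizon_sqrt_gt0 ?radius_le_K.
Qed.

Definition comb (w f : bool -> R) : R := w true * f true + w false * f false.

(** The conditional variance, given the past z, of the combination of the
    pseudo-outcomes with weights w. *)
Definition pseudo_variance (w : bool -> R) (z : seq bool) : R :=
  (w true * y true (size z)) ^+ 2 * X z true +
  (w false * y false (size z)) ^+ 2 * X z false -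
  comb w (fun k => y k (size z)) ^+ 2.

(** The pseudo-outcomes are unbiased. *)
Lemma draw_pseudo_outcome (w : bool -> R) (z : seq bool) (a c : R) :
  draw p z (fun b => (comb w (fun k => pseudo_outcome k z b) - a) ^+ 2 * c) =
  ((comb w (fun k => y k (size z)) - a) ^+ 2 + pseudo_variance w z) * c.
Proof.
have /andP[p0 p1] := ftrl_prob01 z.
have q0 : 1 - p z != 0 by rewrite subr_eq0 gt_eqF.
rewrite /draw /comb /pseudo_variance /inv_prob /pseudo_outcome /inv_weight /comb /=.
by field; rewrite q0 gt_eqF.
Qed.

Lemma combB (w f g : bool -> R) :
  comb w (fun k => f k - g k) = comb w f - comb w g.
Proof. by rewrite /comb; ring. Qed.

Lemma dotp_comb (w : bool -> R) (v : 'cV[R]_d) (b : bool -> 'cV[R]_d) :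
  dotp v (w true *: b true + w false *: b false) = comb w (fun k => dotp v (b k)).
Proof. by rewrite dotpDr !dotpZr. Qed.

(** The ridge regret for the pseudo-outcomes, in expectation: predictors depend on
    the past only, so each squared deviation from a pseudo-outcome has the
    conditional mean given by draw_pseudo_outcome. *)
Lemma ftrl_prediction_regret (w : bool -> R) (b : 'cV[R]_d) :
  \sum_(t < n.+1) E t (fun z =>
    (comb w (err z) ^+ 2 + pseudo_variance w z) * (1 + h (size z))^-1) <=
  \sum_(t < n.+1) ((comb w (fun k => y k t) - dotp (x t) b) ^+ 2 +
    E t (pseudo_variance w)) + lam n * dotp b b.
Proof.
pose cl (z : seq bool) (a : bool) : R :=
  (comb w (fun k => pseudo_outcome k z a) - comb w (fitted z)) ^+ 2 *
  (1 + h (size z))^-1.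
pose cr (z : seq bool) (a : bool) : R :=
  (comb w (fun k => pseudo_outcome k z a) - dotp (x (size z)) b) ^+ 2 * 1.
have pathwise z : size z = n.+1 -> psum cl z <= psum cr z + lam n * dotp b b.
  move=> zn.
  pose v s := comb w (fun k => pseudo_outcome k (take s z) (nth false z s)).
  pose bs s := w true *: predictor (decision_at D x y (take s z)) true +
               w false *: predictor (decision_at D x y (take s z)) false.
  have normal s : (s <= n)%N -> normal_equation x v s (lam s) (bs s).
    move=> sn u; have ss : size (take s z) = s by rewrite size_takel// zn ltnW.
    have ne k := ftrl_normal_equation (take s z) k u; rewrite ss in ne.
    have neE k : \sum_(i < s) (pseudo_outcome k (take i z) (nth false z i) -
          dotp (x i) (predictor (decision_at D x y (take s z)) k)) * dotp (x i) u =
        lam s * dotp (predictor (decision_at D x y (take s z)) k) u.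
      rewrite -ne; apply: eq_bigr => i _.
      by rewrite take_takel ?nth_take// ltnW.
    rewrite /bs dotpDl !dotpZl.
    transitivity (w true * (lam s * dotp (predictor (decision_at D x y (take s z)) true) u)
      + w false * (lam s * dotp (predictor (decision_at D x y (take s z)) false) u));
      last by ring.
    rewrite -!neE !mulr_sumr -big_split/=; apply: eq_bigr => i _.
    by rewrite dotp_comb /v /comb; ring.
  have := @ridge_regret _ _ x v lam h bs n (fun s => ltW (reg_gt0 x n s))
    (fun s _ => reg_mono x n (leqnSn s)) normal
    (fun s _ => leverage_gt0 x n gamma0 c2_gt0 s)
    (fun s u sn => leverageP c2_gt0 gram_ge u sn) b.
  rewrite /psum zn; congr (_ <= _ + _); apply: eq_bigr => s _.
    rewrite /cl /v /bs dotp_comb /fitted size_takel// zn ltnW//.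
  by rewrite /cr mulr1 size_takel// zn ltnW.
have := le_mean ftrl_prob01 pathwise.
rewrite meanD mean_cst !mean_psum => le_cl.
apply: (@le_trans _ _ (\sum_(s < n.+1) E s (fun z => draw p z (cl z)))).
  apply: le_of_eq.
  apply: eq_bigr => t _; apply: eq_mean => z _.
  by rewrite draw_pseudo_outcome -combB.
apply: (le_trans le_cl); rewrite lerD2r; apply: le_of_eq.
apply: eq_bigr => t _; rewrite -[X in X + _](mean_cst p t) -meanD.
apply: eq_mean => z zt; rewrite draw_pseudo_outcome mulr1 zt//.
Qed.

(** * Cumulated errors and inverse probabilities *)

Lemma mean_loss_estimate (k : bool) (t : nat) :
  E t (loss_estimate k) = \sum_(s < t) E s (fun z => err z k ^+ 2).
Proof.
rewrite mean_psum; apply: eq_bigr => s _; apply: eq_mean => z _.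
have /andP[p0 p1] := ftrl_prob01 z.
have q0 : 1 - p z != 0 by rewrite subr_eq0 gt_eqF.
rewrite /draw /inv_weight /error_at -/(fitted z k); case: k => /=; field; by rewrite ?q0 ?gt_eqF.
Qed.

(** The competitor is 0.  The variances on the two sides of the regret bound cancel
    up to a factor h / (1 + h). *)
Lemma error_sum_le (k : bool) :
  \sum_(t < n.+1) E t (fun z => err z k ^+ 2) <=
  (1 + K) * (\sum_(t < n.+1) y k t ^+ 2 +
    \sum_(t < n.+1) y k t ^+ 2 * E t (fun z => h t * X z k)).
Proof.
pose w (j : bool) : R := (j == k)%:R.
have wE (f : bool -> R) : comb w f = f k.
  by rewrite /comb /w; case: (k) => /=; rewrite ?mul1r ?mul0r ?addr0 ?add0r.
have K1 : 0 < 1 + K by have := K_ge1; lra.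
rewrite -ler_pdivrMl// mulr_sumr.
have := ftrl_prediction_regret w 0.
rewrite dotp0r mulr0 addr0.
have vE z : pseudo_variance w z = y k (size z) ^+ 2 * (X z k - 1).
  rewrite /pseudo_variance wE /w; case: (k) => /=;
  by rewrite !(mul1r, mul0r, expr0n, add0r, addr0) /= ?mul0r ?addr0 ?add0r; ring.
set L := \sum_(t < n.+1) E t _; set S := \sum_(t < n.+1) (_ + _) => LS.
suff : \sum_(i < n.+1) (1 + K)^-1 * E i (fun z => err z k ^+ 2) - L <=
  \sum_(t < n.+1) y k t ^+ 2 + \sum_(t < n.+1) y k t ^+ 2 * E t (fun z => h t * X z k) - S.
  by move: LS; lra.
rewrite /L /S -big_split/= -!sumrB; apply: ler_sum => t _.
rewrite dotp0r subr0 wE.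
have : E t (fun z => (1 + K)^-1 * err z k ^+ 2 -
      (comb w (err z) ^+ 2 + pseudo_variance w z) * (1 + h (size z))^-1) <=
    E t (fun z => y k t ^+ 2 * (h t * X z k) - pseudo_variance w z).
  apply: le_mean => [|z zt]; first exact: ftrl_prob01.
  rewrite wE vE zt.
  have h0 := leverage_gt0 x n gamma0 c2_gt0 t.
  have tn : (t <= n)%N by rewrite -ltnS.
  have hK := leverage_le_K tn.
  have X1 := inv_arm_prob_ge1 z k.
  have inv1 : (1 + K)^-1 <= (1 + h t)^-1 by rewrite lef_pV2 ?posrE; lra.
  have e2 := ler_wpM2r (sqr_ge0 (err z k)) inv1.
  have y2 := sqr_ge0 (y k t).
  suff : y k t ^+ 2 * (X z k - 1) - y k t ^+ 2 * (X z k - 1) / (1 + h t) <=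
         y k t ^+ 2 * (h t * X z k) by lra.
  have -> : y k t ^+ 2 * (X z k - 1) - y k t ^+ 2 * (X z k - 1) / (1 + h t) =
     y k t ^+ 2 * ((X z k - 1) * h t / (1 + h t)).
    by field; rewrite gt_eqF//; lra.
  rewrite ler_wpM2l// ler_pdivrMr; last lra.
  have := mulr_ge0 (ltW h0) (mulr_ge0 (ltW h0) (le_trans ler01 X1)).
  have := mulr_ge0 (ltW h0) (le_trans ler01 X1); rewrite -/(X z k); lra.
rewrite !meanB !meanZ; lra.
Qed.

Definition pow4_const : R := 128 + 4 * b1 ^+ 4 * b2.
Local Notation C0 := pow4_const.

(** The level s in X <= s + X^4 / s^3, chosen so large that the bound obtained for
    error_total contains error_total with a factor at most 1/2. *)
Definition split_const : R := 1 + 4 * (1 + K) * c1 ^+ 2 * C0.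

Definition error_const : R :=
  4 * (1 + K) * c1 ^+ 2 * (1 + K * split_const + K * C0).

Definition error_total : R :=
  \sum_(t < n.+1) E t (fun z => err z true ^+ 2) +
  \sum_(t < n.+1) E t (fun z => err z false ^+ 2).

Lemma pow4_const_gt0 : 0 < C0.
Proof.
have b14 : 0 <= b1 ^+ 4 by rewrite exprn_even_ge0.
by have := mulr_ge0 b14 (ltW b2_gt0); rewrite /pow4_const; lra.
Qed.

Lemma mean_error_ge0 t k : 0 <= E t (fun z => err z k ^+ 2).
Proof. by apply: mean_ge0 => [|z _]; [exact: ftrl_prob01|exact: sqr_ge0]. Qed.

Lemma mean_loss_estimates_le t : (t <= n)%N ->
  E t (fun z => loss_estimate true z + loss_estimate false z) <= error_total.
Proof.
move=> tn; rewrite meanD !mean_loss_estimate lerD//.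
  by apply: (@ler_sum_prefix _ (fun t => E t (fun z => err z true ^+ 2)) _ _ _ (leqW tn)) => s; exact: mean_error_ge0.
by apply: (@ler_sum_prefix _ (fun t => E t (fun z => err z false ^+ 2)) _ _ _ (leqW tn)) => s; exact: mean_error_ge0.
Qed.

(** Besides X <= s + X^4 / s^3, the point is that h t / lam t <= 1 / T. *)
Lemma leverage_inv_prob_le t k : (t <= n)%N ->
  E t (fun z => h t * X z k) <=
    K * split_const + K * C0 + C0 / split_const * (error_total / n.+1%:R).
Proof.
move=> tn; set s := split_const.
have C00 := pow4_const_gt0.
have s1 : 1 <= s.
  rewrite /s /split_const lerDl mulr_ge0 ?(ltW C00)// mulr_ge0 ?sqr_ge0// mulr_ge0//.
  by have := K_ge1; lra.
have s0 : 0 < s by lra.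
have T0 : 0 < n.+1%:R :> R by rewrite ltr0n.
have r0 := horizon_sqrt_gt0 R n.
have p0 := radius_gt0 x t.
apply: (@le_trans _ _ (E t (fun z => K * s + K * C0 +
    C0 / s * ((loss_estimate true z + loss_estimate false z) / n.+1%:R)))).
  apply: le_mean => [|z zt]; first exact: ftrl_prob01.
  have X1 := inv_arm_prob_ge1 z k; rewrite -/(X z k) in X1.
  have X4 := inv_arm_prob_pow4 z k; rewrite -/(X z k) zt -/C0 in X4.
  have h0 := leverage_gt0 x n gamma0 c2_gt0 t.
  have hK := leverage_le_K tn.
  have A0 : 0 <= loss_estimate true z + loss_estimate false z.
    by rewrite addr_ge0// loss_estimate_ge0.
  move: (loss_estimate true z + _) A0 X4 => A A0 X4.
  have XX : X z k <= s + X z k ^+ 4 / s.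
    have [Xs|sX] := leP (X z k) s.
      by rewrite (le_trans Xs)// lerDl divr_ge0 ?exprn_ge0// ltW//; lra.
    apply: (@le_trans _ _ (X z k ^+ 4 / s)); last lra.
    rewrite ler_pdivlMr// exprS ler_wpM2l//; first lra.
    apply: (le_trans (ltW sX)); rewrite exprS ler_peMr//; first lra.
    by rewrite exprn_ege1.
  apply: (le_trans (ler_wpM2l (ltW h0) XX)).
  have hl : h t / lam t <= n.+1%:R^-1.
    rewrite ler_pdivrMr ?reg_gt0//; apply: le_trans (leverage_le _ _ _ _ _) _.
    by rewrite -horizon_sqrt_sqr /reg; apply: le_of_eq; field;
      rewrite gt_eqF.
  have X4h := ler_wpM2l (ltW h0) X4.
  have : h t * (C0 * (1 + A / lam t)) <= K * C0 + C0 * (A / n.+1%:R).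
    have -> : h t * (C0 * (1 + A / lam t)) = h t * C0 + C0 * (A * (h t / lam t)) by ring.
    apply: lerD; first by rewrite ler_wpM2r// ltW.
    by rewrite ler_wpM2l ?(ltW C00)// ler_wpM2l.
  move=> /(le_trans X4h) /(ler_wpM2r (x := s^-1)).
  rewrite invr_ge0 (ltW s0) => /(_ isT) hX.
  have : K * C0 / s <= K * C0.
    rewrite ler_pdivrMr// ler_peMr// mulr_ge0 ?(ltW C00)//; by have := K_ge1; lra.
  have := ler_wpM2r (ltW s0) hK.
  have -> : C0 / s * (A / n.+1%:R) = C0 * (A / n.+1%:R) / s by rewrite mulrAC.
  move: hX; rewrite -mulrA mulrDl.
  move: (X z k ^+ 4 / s) (K * C0 / s) (C0 * (A / _) / s) => a b c; lra.
rewrite meanD mean_cst meanZ lerD2l ler_wpM2l//.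
  by rewrite divr_ge0// ltW.
rewrite (@eq_mean _ _ _ _ (fun z => n.+1%:R^-1 *
  (loss_estimate true z + loss_estimate false z))); last by move=> z _; rewrite mulrC.
by rewrite meanZ mulrC ler_wpM2r ?invr_ge0 ?(ltW T0)// mean_loss_estimates_le.
Qed.

(** The errors bound the inverse probabilities, and these bound the errors; the
    factor 1/2 provided by split_const closes the loop. *)
Lemma error_total_le : error_total <= error_const * n.+1%:R.
Proof.
set s := split_const; have C00 := pow4_const_gt0.
have K1 := K_ge1.
have T0 : 0 < n.+1%:R :> R by rewrite ltr0n.
set B := K * s + K * C0 + C0 / s * (error_total / n.+1%:R).
have G0 : 0 <= error_total.
  by rewrite addr_ge0//; apply: sumr_ge0 => t _; exact: mean_error_ge0.
have s0 : 0 < s.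
  rewrite ltr_wpDr// mulr_ge0 ?(ltW C00)// mulr_ge0 ?sqr_ge0// mulr_ge0//; lra.
have B0 : 0 <= B.
  rewrite addr_ge0//; last by rewrite mulr_ge0// divr_ge0// ltW.
  by rewrite -mulrDr mulr_ge0//; lra.
have arm k : \sum_(t < n.+1) E t (fun z => err z k ^+ 2) <=
    (1 + K) * (c1 ^+ 2 * n.+1%:R * (1 + B)).
  apply: le_trans (error_sum_le k) _; rewrite ler_wpM2l//; first lra.
  rewrite mulrDr mulr1; apply: lerD; first exact: moment2_le.
  apply: (@le_trans _ _ ((\sum_(t < n.+1) y k t ^+ 2) * B)).
    rewrite mulr_suml; apply: ler_sum => t _; rewrite ler_wpM2l ?sqr_ge0//.
    by apply: leverage_inv_prob_le; rewrite -ltnS.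
  by rewrite ler_wpM2r// moment2_le.
have := lerD (arm true) (arm false); rewrite -/error_total.
have C0s : 4 * (1 + K) * c1 ^+ 2 * C0 <= s by rewrite /s /split_const; lra.
have absorb : 2 * ((1 + K) * (c1 ^+ 2 * n.+1%:R * (C0 / s * (error_total / n.+1%:R))))
    <= error_total / 2.
  have -> : 2 * ((1 + K) * (c1 ^+ 2 * n.+1%:R * (C0 / s * (error_total / n.+1%:R)))) =
    4 * (1 + K) * c1 ^+ 2 * C0 / s * (error_total / 2).
    by field; rewrite !gt_eqF.
  by rewrite ler_piMl ?divr_ge0// ler_pdivrMr// mul1r.
move: absorb; rewrite /error_const /B -/s.
by move: (C0 / s * (error_total / n.+1%:R)) (n.+1%:R : R) => W T; lra.
Qed.

Definition inv_prob_const : R := C0 * (K + error_const).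

Lemma error_const_ge0 : 0 <= error_const.
Proof.
have C00 := pow4_const_gt0; have K1 := K_ge1.
have s0 : 0 < split_const.
  rewrite ltr_wpDr// mulr_ge0 ?(ltW C00)// mulr_ge0 ?sqr_ge0// mulr_ge0//; lra.
rewrite /error_const mulr_ge0//; first by rewrite mulr_ge0 ?sqr_ge0// mulr_ge0//; lra.
have K0 : 0 <= K by lra.
by have := mulr_ge0 K0 (ltW s0); have := mulr_ge0 K0 (ltW C00); lra.
Qed.

Lemma mean_inv_prob_pow4_le t k : (t <= n)%N ->
  E t (fun z => X z k ^+ 4) <= inv_prob_const * (r / rho t).
Proof.
move=> tn; have C00 := pow4_const_gt0.
have l0 := reg_gt0 x n t; have p0 := radius_gt0 x t; have r0 := horizon_sqrt_gt0 R n.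
apply: (@le_trans _ _ (E t (fun z => C0 + C0 / lam t *
    (loss_estimate true z + loss_estimate false z)))).
  apply: le_mean => [|z zt]; first exact: ftrl_prob01.
  have := inv_arm_prob_pow4 z k; rewrite zt -/C0 => /le_trans; apply.
  apply: le_of_eq; ring.
rewrite meanD mean_cst meanZ.
have h1 : C0 / lam t * E t (fun z => loss_estimate true z + loss_estimate false z) <=
    C0 / lam t * (error_const * n.+1%:R).
  rewrite ler_wpM2l ?divr_ge0 ?(ltW C00) ?(ltW l0)//.
  exact: le_trans (mean_loss_estimates_le tn) error_total_le.
have h2 : C0 / lam t * (error_const * n.+1%:R) = C0 * (error_const * (r / rho t)).
  by rewrite -horizon_sqrt_sqr /reg; field; rewrite !gt_eqF.
have h3 : 1 <= K * (r / rho t).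
  by rewrite mulrA ler_pdivlMr// mul1r radius_le_K.
have := ler_wpM2l (ltW C00) h3; rewrite /inv_prob_const; lra.
Qed.

(** * Fourth moments of the errors *)

(** The ridge predictor that would be computed from the true outcomes. *)
Definition baseline (k : bool) (t : nat) : 'cV[R]_d :=
  argmin setT (ridge_loss x (y k) t (lam t)).

Definition noise (z : seq bool) (k : bool) : R :=
  fitted z k - dotp (x (size z)) (baseline k (size z)).

(** With g = H_t^-1 x_t, for the regularized Gram matrix H_t, the difference of the
    two predictions is the sum of <x_s, g> times the difference of the outcomes
    of round s.  The form of H_t takes at g the value <x_t, g>, which is at most
    the leverage. *)
Lemma noise_weights (t : nat) : (t <= n)%N ->
  exists w : nat -> R,
  [/\ \sum_(s < t) w s ^+ 2 <= rho t / r,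
      forall s, (s < t)%N -> w s ^+ 2 <= (rho t / r) ^+ 2
    & forall z k, size z = t -> noise z k =
        psum (fun z' b => w (size z') * (pseudo_outcome k z' b - y k (size z'))) z].
Proof.
move=> tn; have l0 := reg_gt0 x n t.
have r0 := horizon_sqrt_gt0 R n; have p0 := radius_gt0 x t.
have coercive u : lam t * dotp u u <= ridge_form x t (lam t) u.
  by rewrite lerDr; apply: sumr_ge0 => s _; exact: sqr_ge0.
have [g gE] := ridge_form_represents l0 coercive (x t).
have Qg : ridge_form x t (lam t) g = dotp (x t) g.
  by rewrite -gE /ridge_form; congr (_ + _); apply: eq_bigr => s _; rewrite expr2.
have Qg0 : 0 <= dotp (x t) g.
  by rewrite -Qg; apply: le_trans (coercive g); rewrite mulr_ge0 ?dotp_ge0// ltW.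
have Qg_le : dotp (x t) g <= rho t / r.
  have := leverageP c2_gt0 gram_ge g tn; rewrite Qg expr2 => lev.
  have [->|gn0] := eqVneq (dotp (x t) g) 0; first by rewrite divr_ge0// ltW.
  apply: le_trans (leverage_le x n c2 gamma0 t).
  by rewrite ler_pM2r// in lev; rewrite lt_def gn0.
have gg : dotp g g <= (rho t / r) / lam t.
  by rewrite ler_pdivlMr// mulrC (le_trans (coercive g))// Qg.
exists (fun s => dotp (x s) g); split.
- by apply: le_trans Qg_le; rewrite -Qg lerDl mulr_ge0 ?dotp_ge0// ltW.
- move=> s st; apply: le_trans (dotp_sqr_le_radius x s g) _.
  have -> : (rho t / r) ^+ 2 = rho t ^+ 2 * ((rho t / r) / lam t).
    by rewrite /reg; field; rewrite !gt_eqF.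
  rewrite ler_pM ?sqr_ge0 ?dotp_ge0// lerXn2r ?nnegrE ?(ltW (radius_gt0 _ _))//.
  by rewrite radius_mono// ltnW.
move=> z k zt; rewrite /noise /fitted zt -dotpBr.
have base_eq := @argmin_ridge_loss R d x (y k) t (lam t) l0 g.
have ftrl_eq := ftrl_normal_equation z k g; rewrite zt in ftrl_eq.
set b := predictor _ k in ftrl_eq *; set b0 := baseline k t.
have gB : lam t * dotp g (b - b0) =
    \sum_(s < t) (pseudo_outcome k (take s z) (nth false z s) - dotp (x s) b) * dotp (x s) g
    - \sum_(s < t) (y k s - dotp (x s) b0) * dotp (x s) g.
  by rewrite ftrl_eq base_eq -mulrBr (dotpC g) dotpBl.
rewrite -gE gB /psum zt -sumrB -big_split/=; apply: eq_bigr => s _.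
rewrite size_takel ?zt; last exact: ltnW.
by rewrite dotpBr; ring.
Qed.

Definition noise_const : R :=
  (32 * (inv_prob_const + 1) + 6 * inv_prob_const) * c1 ^+ 4 * K.

Lemma inv_prob_const_ge0 : 0 <= inv_prob_const.
Proof.
rewrite mulr_ge0 ?(ltW pow4_const_gt0)//.
by have := error_const_ge0; have := K_ge1; lra.
Qed.

Lemma mean_noise_pow4_le t k : (t <= n)%N ->
  E t (fun z => noise z k ^+ 4) <= noise_const * rho t ^+ 2.
Proof.
move=> tn; have [w [w2 w_le noiseE]] := noise_weights tn.
have r0 := horizon_sqrt_gt0 R n; have p0 := radius_gt0 x t.
have T0 : 0 < n.+1%:R :> R by rewrite ltr0n.
have CX0 := inv_prob_const_ge0.
rewrite (@eq_mean _ _ _ _ (fun z => psum (fun z' b =>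
  w (size z') * (pseudo_outcome k z' b - y k (size z'))) z ^+ 4)); last first.
  by move=> z zt; rewrite noiseE.
set eta := rho t / r in w2 w_le.
have eta0 : 0 < eta by rewrite divr_gt0.
(* W^2 bounds (sum w^4) (sum y^4), hence (sum w^2 y^2)^2. *)
pose W : R := Num.sqrt (eta ^+ 3 * (c1 ^+ 4 * n.+1%:R)).
have W0 : 0 < eta ^+ 3 * (c1 ^+ 4 * n.+1%:R).
  by apply: mulr_gt0; [exact: exprn_gt0|apply: mulr_gt0 => //; exact: exprn_gt0].
have Wsqr : W ^+ 2 = eta ^+ 3 * (c1 ^+ 4 * n.+1%:R) by rewrite sqr_sqrtr// ltW.
(* q = T^(1/4), the weight for which X^2 <= (X^4 / q + q) / 2 has mean O(q). *)
pose q : R := Num.sqrt r.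
have q0 : 0 < q by rewrite sqrtr_gt0.
have q2 : q ^+ 2 = r by rewrite sqr_sqrtr// ltW.
have w4 s : (s < t)%N -> w s ^+ 4 <= eta ^+ 2 * w s ^+ 2.
  by move=> st; rewrite -[4%N]/(2 + 2)%N exprD ler_wpM2r ?sqr_ge0 ?w_le.
have EX4 s : (s < t)%N -> E s (fun z => X z k ^+ 4) <= inv_prob_const * r.
  move=> st; have sn : (s <= n)%N := leq_trans (ltnW st) tn.
  apply: le_trans (mean_inv_prob_pow4_le k sn) _.
  rewrite ler_wpM2l// ler_pdivrMr ?radius_gt0// ler_peMr ?radius_ge1// ltW//.
have bound := @mean_pow4_psum_le R p ftrl_prob01 t
  (fun z' b => w (size z') * (pseudo_outcome k z' b - y k (size z')))
  (fun z => X z k) (fun z => (w (size z) * y k (size z)) ^+ 4 * X z k ^+ 4)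
  (fun s => (w s * y k s) ^+ 2)
  (fun s => (w s * y k s) ^+ 4 * (inv_prob_const * r))
  W ((inv_prob_const + 1) / 2 * q)
  (eta ^+ 4 * (c1 ^+ 4 * n.+1%:R) * (inv_prob_const * r)).
apply: (le_trans (bound _ _ _ _ _ _ _ _ _ _ _)) => {bound}.
- move=> z; have /andP[pz0 pz1] := ftrl_prob01 z.
  have pz1' : 1 - p z != 0 by rewrite subr_eq0 gt_eqF.
  rewrite /draw /pseudo_outcome /inv_weight; case: k {noiseE EX4} => /=; field;
  by rewrite ?pz1' ?gt_eqF.
- move=> z zt; have /andP[a0 a1] := arm_prob_bounds z k.
  rewrite (_ : (fun b => _) = fun b => (w (size z) * y k (size z) * inv_weight z k b
     + - (w (size z) * y k (size z))) ^+ 2); last first.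
    by apply/funext => b; rewrite /pseudo_outcome; ring.
  rewrite draw_inv_weight /inv_prob.
  set a := arm_prob _ _ in a0 a1 *; set e := w _ * y k _.
  have -> : a * (e / a - e) ^+ 2 + (1 - a) * (- e) ^+ 2 = e ^+ 2 / a - e ^+ 2.
    by field; rewrite gt_eqF.
  by rewrite gerBl sqr_ge0.
- move=> z zt; have /andP[a0 a1] := arm_prob_bounds z k.
  rewrite (_ : (fun b => _) = fun b => (w (size z) * y k (size z) * inv_weight z k b
     + - (w (size z) * y k (size z))) ^+ 4); last first.
    by apply/funext => b; rewrite /pseudo_outcome; ring.
  rewrite draw_inv_weight /inv_prob.
  set a := arm_prob _ _ in a0 a1 *; set e := w _ * y k _.
  have -> : a * (e / a - e) ^+ 4 + (1 - a) * (- e) ^+ 4 =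
      e ^+ 4 * ((1 - a) * ((1 - a) ^+ 3 + a ^+ 3) * a * a^-1 ^+ 4).
    by field; rewrite gt_eqF.
  rewrite ler_wpM2l ?exprn_even_ge0// ler_piMl ?exprn_ge0 ?invr_ge0 ?(ltW a0)//.
  have a1' : 0 <= 1 - a by rewrite subr_ge0 ltW.
  have a3 : (1 - a) ^+ 3 + a ^+ 3 <= 1.
    by have := mulr_ge0 (ltW a0) a1'; lra.
  have a30 : 0 <= (1 - a) ^+ 3 + a ^+ 3 by rewrite addr_ge0 ?exprn_ge0// ltW.
  by rewrite mulr_ile1 ?(ltW a0) ?(ltW a1)// ?mulr_ile1// ?mulr_ge0//; lra.
- by move=> s; exact: sqr_ge0.
- by rewrite sqrtr_gt0.
- have Sq : 0 <= \sum_(s < t) (w s * y k s) ^+ 2.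
    by apply: sumr_ge0 => s _; exact: sqr_ge0.
  rewrite -(@ler_pXn2r _ 2) ?nnegrE ?sqrtr_ge0// Wsqr.
  have CS := sum_CauchySchwarz (fun s : 'I_t => w s ^+ 2) (fun s => y k s ^+ 2).
  apply: (@le_trans _ _ ((\sum_(s < t) w s ^+ 4) * \sum_(s < t) y k s ^+ 4)).
    have -> : \sum_(s < t) (w s * y k s) ^+ 2 = \sum_(s < t) w s ^+ 2 * y k s ^+ 2.
      by apply: eq_bigr => s _; rewrite exprMn.
    by apply: (le_trans CS); apply: le_of_eq;
      congr (_ * _); apply: eq_bigr => s _; rewrite -exprM.
  apply: ler_pM; try by apply: sumr_ge0 => s _; rewrite exprn_even_ge0.
    rewrite exprSr; apply: (@le_trans _ _ (\sum_(s < t) eta ^+ 2 * w s ^+ 2)).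
      by apply: ler_sum => s _; exact: w4.
    by rewrite -mulr_sumr ler_wpM2l ?sqr_ge0.
  apply: le_trans (moment4_le k); apply: (@ler_sum_prefix _ (fun s => y k s ^+ 4)).
    by move=> s; rewrite exprn_even_ge0.
  exact: leqW.
- by rewrite mulr_ge0 ?(ltW q0)// divr_ge0//; lra.
- move=> s st; apply: (@le_trans _ _ (E s (fun z => (2 * q)^-1 * X z k ^+ 4 + q / 2))).
    apply: le_mean => [|z _]; first exact: ftrl_prob01.
    rewrite -subr_ge0.
    have -> : (2 * q)^-1 * X z k ^+ 4 + q / 2 - X z k ^+ 2 =
      (2 * q)^-1 * (X z k ^+ 2 - q) ^+ 2 by field; rewrite gt_eqF.
    by rewrite mulr_ge0 ?sqr_ge0// invr_ge0 mulr_ge0// ltW.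
  have q2i : 0 <= (2 * q)^-1 by rewrite invr_ge0 mulr_ge0// ltW.
  rewrite meanD mean_cst meanZ; have := ler_wpM2l q2i (EX4 s st).
  have -> : (2 * q)^-1 * (inv_prob_const * r) = inv_prob_const / 2 * q.
    by rewrite -q2; field; rewrite gt_eqF.
  lra.
- by move=> s; rewrite mulr_ge0 ?exprn_even_ge0// mulr_ge0// ltW.
- move=> s st; rewrite (@eq_mean _ _ _ _ (fun z => (w s * y k s) ^+ 4 * X z k ^+ 4)).
    by rewrite meanZ ler_wpM2l ?exprn_even_ge0// EX4.
  by move=> z ->.
- rewrite -mulr_suml ler_wpM2r ?(mulr_ge0 CX0 (ltW r0))//.
  apply: (@le_trans _ _ (\sum_(s < t) eta ^+ 4 * y k s ^+ 4)).
    apply: ler_sum => s _; rewrite exprMn ler_wpM2r ?exprn_even_ge0//.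
    rewrite -[4%N]/(2 * 2)%N !exprM lerXn2r ?nnegrE ?sqr_ge0//.
    exact: w_le.
  rewrite -mulr_sumr ler_wpM2l ?exprn_even_ge0//.
  apply: le_trans (moment4_le k); apply: (@ler_sum_prefix _ (fun s => y k s ^+ 4)).
    by move=> s; rewrite exprn_even_ge0.
  exact: leqW.
have rho2 : rho t ^+ 2 <= K * r.
  apply: le_trans radius_sqr_le.
  by rewrite lerXn2r ?nnegrE ?(ltW (radius_gt0 _ _))// radius_mono.
have K1 := K_ge1; have K0 : 0 < K by lra.
have rhoq : rho t <= K * q.
  rewrite -(@ler_pXn2r _ 2) ?nnegrE ?mulr_ge0 ?(ltW q0) ?(ltW K0) ?(ltW p0)//.
  apply: (le_trans rho2); rewrite exprMn q2 ler_wpM2r ?(ltW r0)//.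
  by rewrite expr2 ler_peMr// ltW.
rewrite Wsqr -(horizon_sqrt_sqr R n) /eta.
have h1 : rho t ^+ 3 / q <= K * rho t ^+ 2.
  by rewrite ler_pdivrMr// exprSr; have := ler_wpM2l (sqr_ge0 (rho t)) rhoq; lra.
have h2 : rho t ^+ 4 / r <= K * rho t ^+ 2.
  rewrite ler_pdivrMr//; have := ler_wpM2l (sqr_ge0 (rho t)) rho2; lra.
have c14 : 0 <= c1 ^+ 4 by rewrite exprn_even_ge0.
have e1 : 64 * ((rho t / r) ^+ 3 * (c1 ^+ 4 * r ^+ 2)) * ((inv_prob_const + 1) / 2 * q) =
    32 * (inv_prob_const + 1) * c1 ^+ 4 * (rho t ^+ 3 / q).
  by rewrite -q2; field; rewrite gt_eqF.
have e2 : 6 * ((rho t / r) ^+ 4 * (c1 ^+ 4 * r ^+ 2) * (inv_prob_const * r)) =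
    6 * inv_prob_const * c1 ^+ 4 * (rho t ^+ 4 / r).
  by field; rewrite gt_eqF.
rewrite e1 e2.
have f1 : 0 <= 32 * (inv_prob_const + 1) * c1 ^+ 4 by rewrite mulr_ge0//; lra.
have f2 : 0 <= 6 * inv_prob_const * c1 ^+ 4 by rewrite mulr_ge0//; lra.
have := ler_wpM2l f1 h1; have := ler_wpM2l f2 h2; rewrite /noise_const; lra.
Qed.

Lemma baseline_form_le (k : bool) (t : nat) :
  ridge_form x t (lam t) (baseline k t) <= \sum_(s < t) y k s ^+ 2.
Proof.
have l0 := reg_gt0 x n t.
exact: (ridge_form_minimizer_le (ltW l0) (argmin_ridge_loss x (y k) t l0)).
Qed.

Local Notation fit k t := (dotp (x t) (baseline k t)).

(** The ridge regret against 0 on a prefix. *)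
Lemma baseline_sqr_sum_le (k : bool) (t : nat) : (t <= n.+1)%N ->
  \sum_(s < t) fit k s ^+ 2 <= (2 * (1 + K) + 2) * \sum_(s < t) y k s ^+ 2.
Proof.
case: t => [|t] tn; first by rewrite !big_ord0 mulr0.
have K1 := K_ge1.
have := @ridge_regret _ _ x (y k) lam h (baseline k) t
  (fun s => ltW (reg_gt0 x n s)) (fun s _ => reg_mono x n (leqnSn s))
  (fun s _ => argmin_ridge_loss x (y k) s (reg_gt0 x n s))
  (fun s _ => leverage_gt0 x n gamma0 c2_gt0 s)
  (fun s u st => leverageP c2_gt0 gram_ge u (leq_trans st tn)) 0.
rewrite dotp0r mulr0 addr0.
have -> : \sum_(s < t.+1) (y k s - dotp (x s) 0) ^+ 2 = \sum_(s < t.+1) y k s ^+ 2.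
  by apply: eq_bigr => s _; rewrite dotp0r subr0.
move=> regret.
have : \sum_(s < t.+1) fit k s ^+ 2 <=
    \sum_(s < t.+1) (2 * (1 + K) * ((y k s - fit k s) ^+ 2 / (1 + h s)) + 2 * y k s ^+ 2).
  apply: ler_sum => s _.
  have sn : (s <= n)%N by rewrite -ltnS (leq_trans (ltn_ord s)).
  have h0 := leverage_gt0 x n gamma0 c2_gt0 s; have hK := leverage_le_K sn.
  have : (y k s - fit k s) ^+ 2 <= (1 + K) * ((y k s - fit k s) ^+ 2 / (1 + h s)).
    rewrite mulrCA ler_peMr ?sqr_ge0// ler_pdivlMr ?mul1r; lra.
  have := sqr_ge0 (fit k s - 2 * y k s).
  move: (_ / _) => v; lra.
rewrite big_split/= -!mulr_sumr.
have K2 : 0 <= 2 * (1 + K) by lra.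
have := ler_wpM2l K2 regret; lra.
Qed.

Definition baseline_const : R :=
  c1 ^+ 4 * (gamma0 * (gamma0 + 1) + 8 * c2 * (2 * (1 + K) + 2)).

(** Before time gamma0 sqrt T, the leverage bound radius t / r is enough, there
    being O(sqrt T) such rounds.  Later the squared norm of the predictor is at
    most c2 times the mean of the past squared outcomes, and hardy_weighted
    applies to these means with the squared predictions as weights. *)
Lemma baseline_pow4_sum_le (k : bool) :
  \sum_(t < n.+1) fit k t ^+ 4 / rho t <= baseline_const * (rho n * n.+1%:R).
Proof.
have r0 := horizon_sqrt_gt0 R n; have r1 := horizon_sqrt_ge1 R n.
have pn0 := radius_gt0 x n; have K1 := K_ge1.
have c20 := c2_gt0; have g0 := gamma0_gt0.
have c14 : 0 <= c1 ^+ 4 by rewrite exprn_even_ge0.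
pose m (t : nat) : R := (\sum_(s < t) y k s ^+ 2) / t%:R.
have S0 t : 0 <= \sum_(s < t) y k s ^+ 2.
  by apply: sumr_ge0 => s _; exact: sqr_ge0.
have step (t : 'I_n.+1) : fit k t ^+ 4 / rho t <=
    rho n * (c1 ^+ 4 * gamma0 * r * (if t%:R <= r * gamma0 then 1 else 0) +
             2 * c2 * (m t.+1 * fit k t ^+ 2)).
  have tn : (t <= n)%N by rewrite -ltnS.
  have p0 := radius_gt0 x t; have pn := radius_mono x tn.
  have m0 : 0 <= m t.+1 by rewrite /m divr_ge0.
  have f2 := sqr_ge0 (fit k t).
  have late_ge0 : 0 <= 2 * c2 * (m t.+1 * fit k t ^+ 2).
    by apply: mulr_ge0; [apply: mulr_ge0 => //; exact: ltW|exact: mulr_ge0].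
  case: (boolP ((0 < t)%N && (r * gamma0 <= t%:R))) => [/andP[t0 late]|early].
    have t0R : 0 < t%:R :> R by rewrite ltr0n.
    have tn' : (0 < t <= n)%N by rewrite t0.
    apply: (@le_trans _ _ (rho n * (2 * c2 * (m t.+1 * fit k t ^+ 2)))); last first.
      rewrite ler_wpM2l ?(ltW pn0)// lerDr mulr_ge0//; last by case: ifP.
      by rewrite !mulr_ge0// ltW.
    have bS : t%:R / c2 * dotp (baseline k t) (baseline k t) <= \sum_(s < t) y k s ^+ 2.
      apply: le_trans (baseline_form_le k t); apply: le_trans (gram_ge tn' late _) _.
      by rewrite lerDl mulr_ge0 ?dotp_ge0// ltW// reg_gt0.
    have bb : dotp (baseline k t) (baseline k t) <= 2 * c2 * m t.+1.
      rewrite -(@ler_pM2l _ (t%:R / c2)) ?divr_gt0//; apply: (le_trans bS).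
      have -> : t%:R / c2 * (2 * c2 * m t.+1) =
          (2 * t%:R / t.+1%:R) * \sum_(s < t.+1) y k s ^+ 2.
        have t1R : 0 < t.+1%:R :> R by rewrite ltr0n.
        by rewrite /m; field; rewrite !gt_eqF.
      apply: (@le_trans _ _ (\sum_(s < t.+1) y k s ^+ 2)).
        by rewrite big_ord_recr/= lerDl sqr_ge0.
      rewrite ler_peMl// ler_pdivlMr ?ltr0n// mul1r -natr1.
      have : 1 <= t%:R :> R by rewrite ler1n.
      lra.
    rewrite ler_pdivrMr//.
    have := dotp_sqr_le_radius x t (baseline k t).
    move=> /(ler_wpM2r f2); rewrite -exprD => /le_trans; apply.
    have := ler_wpM2l (sqr_ge0 (rho t)) bb => /(ler_wpM2r f2) /le_trans; apply.
    have Z0 : 0 <= 2 * c2 * m t.+1 * fit k t ^+ 2 * rho t.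
      apply: mulr_ge0 (ltW p0); apply: mulr_ge0 => //; apply: mulr_ge0 => //.
      by rewrite mulr_ge0// ltW.
    have := ler_wpM2r Z0 pn; lra.
  have t_le : t%:R <= r * gamma0.
    move: early; rewrite negb_and -ltNge lt0n negbK => /orP[/eqP->|/ltW//].
    by rewrite mulr_ge0// ltW.
  rewrite t_le mulr1.
  apply: (@le_trans _ _ (rho n * (c1 ^+ 4 * gamma0 * r))); last first.
    by rewrite ler_wpM2l ?(ltW pn0)// lerDl.
  have f2_le : fit k t ^+ 2 <= rho t / r * \sum_(s < t) y k s ^+ 2.
    apply: le_trans (leverageP c2_gt0 gram_ge _ tn) _.
    apply: ler_pM; first exact: ltW (leverage_gt0 x n gamma0 c2_gt0 t).
    - apply: addr_ge0; first by apply: sumr_ge0 => s _; exact: sqr_ge0.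
      by rewrite mulr_ge0 ?dotp_ge0// ltW// reg_gt0.
    - exact: leverage_le.
    - exact: baseline_form_le.
  have S2 := partial_moment2_sqr_le k (leqW tn).
  have f4 : fit k t ^+ 4 <= (rho t / r) ^+ 2 * (t%:R * (c1 ^+ 4 * n.+1%:R)).
    apply: (@le_trans _ _ ((rho t / r * \sum_(s < t) y k s ^+ 2) ^+ 2)).
      rewrite -[4%N]/(2 * 2)%N exprM lerXn2r ?nnegrE//.
      by rewrite mulr_ge0// divr_ge0// ltW.
    by rewrite exprMn ler_wpM2l ?sqr_ge0.
  rewrite ler_pdivrMr//; apply: (le_trans f4).
  rewrite -(horizon_sqrt_sqr R n).
  have -> : (rho t / r) ^+ 2 * (t%:R * (c1 ^+ 4 * r ^+ 2)) =
      rho t * (c1 ^+ 4 * t%:R * rho t) by field; rewrite gt_eqF.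
  have -> : rho n * (c1 ^+ 4 * gamma0 * r) * rho t =
      rho n * (c1 ^+ 4 * (r * gamma0) * rho t) by ring.
  have B1 : 0 <= c1 ^+ 4 * t%:R * rho t.
    exact: mulr_ge0 (mulr_ge0 c14 (ler0n _ _)) (ltW p0).
  apply: ler_pM (ltW p0) B1 pn _.
  by rewrite ler_wpM2r ?(ltW p0)// ler_wpM2l.
apply: le_trans (ler_sum _ (fun t _ => step t)) _.
rewrite -mulr_sumr [leRHS]mulrCA ler_wpM2l ?(ltW pn0)//.
rewrite big_split/= -!mulr_sumr.
have K'0 : 0 <= 2 * (1 + K) + 2 by lra.
have := @hardy_weighted _ (fun t => y k t ^+ 2) (fun t => fit k t ^+ 2) _ n.+1
  K'0 (fun t => sqr_ge0 _) (fun t => sqr_ge0 _) (fun t tn => baseline_sqr_sum_le k tn).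
have -> : \sum_(t < n.+1) (y k t ^+ 2) ^+ 2 = \sum_(t < n.+1) y k t ^+ 4.
  by apply: eq_bigr => t _; rewrite -exprM.
move=> hw.
have c2' : 0 <= 2 * c2 by lra.
have K'4 : 0 <= 4 * (2 * (1 + K) + 2) by lra.
have {}hw := le_trans hw (ler_wpM2l K'4 (moment4_le k)).
have {}hw := ler_wpM2l c2' hw.
have rg0 : 0 <= r * gamma0 by rewrite mulr_ge0// ltW.
have cnt := @count_le_real R (r * gamma0) n.+1 rg0.
have cg0 : 0 <= c1 ^+ 4 * gamma0 * r by rewrite !mulr_ge0// ltW.
have {}cnt := ler_wpM2l cg0 cnt.
apply: le_trans (lerD cnt hw) _; rewrite /baseline_const -(horizon_sqrt_sqr R n).
have rr : r <= r ^+ 2 by rewrite expr2 ler_peMr// ltW.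
have cg : 0 <= c1 ^+ 4 * gamma0 by rewrite mulr_ge0// ltW.
have := ler_wpM2l cg rr; lra.
Qed.

Definition error4_const : R := 8 * c1 ^+ 4 + 64 * baseline_const + 64 * noise_const.

Lemma error_pow4_sum_le (k : bool) :
  \sum_(t < n.+1) E t (fun z => err z k ^+ 4) / lam t <= error4_const * (r * rho n).
Proof.
have r0 := horizon_sqrt_gt0 R n; have pn0 := radius_gt0 x n.
have pn1 := radius_ge1 x n.
have step (t : 'I_n.+1) : E t (fun z => err z k ^+ 4) / lam t <=
    8 / r * y k t ^+ 4 + 64 / r * (fit k t ^+ 4 / rho t) + 64 * noise_const * (rho n / r).
  have tn : (t <= n)%N by rewrite -ltnS.
  have p0 := radius_gt0 x t; have p1 := radius_ge1 x t.
  have y40 : 0 <= y k t ^+ 4 by rewrite exprn_even_ge0.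
  have : E t (fun z => err z k ^+ 4) <=
      8 * y k t ^+ 4 + 64 * fit k t ^+ 4 + 64 * (noise_const * rho t ^+ 2).
    apply: (@le_trans _ _ (E t (fun z => (8 * y k t ^+ 4 + 64 * fit k t ^+ 4) +
        64 * noise z k ^+ 4))).
      apply: le_mean => [|z zt]; first exact: ftrl_prob01.
      have -> : err z k = y k t + - (fit k t + noise z k).
        by rewrite /error_at -/(fitted z k) /noise zt; ring.
      have := pow4D_le (y k t) (- (fit k t + noise z k)).
      have := pow4D_le (fit k t) (noise z k).
      have -> : (- (fit k t + noise z k)) ^+ 4 = (fit k t + noise z k) ^+ 4 by ring.
      lra.
    rewrite meanD mean_cst meanZ lerD2l ler_wpM2l//.
    exact: mean_noise_pow4_le.
  move=> /(ler_wpM2r (x := (lam t)^-1)).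
  rewrite invr_ge0 (ltW (reg_gt0 x n t)) => /(_ isT) /le_trans; apply.
  rewrite mulrDl [X in X + _ <= _]mulrDl; apply: lerD; first apply: lerD.
  - rewrite mulrAC ler_wpM2r// ler_wpM2l// lef_pV2 ?posrE ?reg_gt0//.
    by rewrite /reg ler_peMr// ltW.
  - by apply: le_of_eq; rewrite /reg; field; rewrite !gt_eqF.
  have -> : 64 * (noise_const * rho t ^+ 2) / lam t = 64 * noise_const * (rho t / r).
    by rewrite /reg; field; rewrite !gt_eqF.
  have CN0 : 0 <= 64 * noise_const.
    have c14 : 0 <= c1 ^+ 4 by rewrite exprn_even_ge0.
    have CX0 := inv_prob_const_ge0; have K1 := K_ge1.
    apply: mulr_ge0 => //; rewrite /noise_const.
    by apply: mulr_ge0; last lra; apply: mulr_ge0 => //; lra.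
  by rewrite ler_wpM2l// ler_wpM2r ?invr_ge0 ?(ltW r0)// radius_mono.
apply: le_trans (ler_sum _ (fun t _ => step t)) _.
rewrite !big_split/= sumr_const card_ord -!mulr_sumr -[_ *+ n.+1]mulr_natr.
have r8 : 0 <= 8 / r by rewrite divr_ge0// ltW.
have r64 : 0 <= 64 / r by rewrite divr_ge0// ltW.
have h1 := ler_wpM2l r8 (moment4_le k).
have h2 := ler_wpM2l r64 (baseline_pow4_sum_le k).
rewrite -(horizon_sqrt_sqr R n) in h1 h2 *.
have e1 : 8 / r * (c1 ^+ 4 * r ^+ 2) = 8 * c1 ^+ 4 * r by field; rewrite gt_eqF.
have e2 : 64 / r * (baseline_const * (rho n * r ^+ 2)) = 64 * baseline_const * (r * rho n).
  by field; rewrite gt_eqF.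
have e3 : 64 * noise_const * (rho n / r) * r ^+ 2 = 64 * noise_const * (r * rho n).
  by field; rewrite gt_eqF.
rewrite e1 in h1; rewrite e2 in h2; rewrite e3.
have c14 : 0 <= 8 * c1 ^+ 4 by rewrite mulr_ge0// exprn_even_ge0.
have rr : r <= r * rho n by rewrite ler_peMr// ltW.
have := ler_wpM2l c14 rr; rewrite /error4_const.
move: h1 h2; move: (8 / r * _) (64 / r * _) (r * rho n) => a b c; lra.
Qed.

(** * Regrets of the probabilities and of the predictors *)

Let logit (z : seq bool) : R := projT1 (cid (ftrl_prob_sigmoid z)).

Lemma logitP z : phi (logit z) = p z /\ forall v,
  ftrl_objective phi (loss_estimate true z) (loss_estimate false z)
    (lam (size z)) (logit z) <=
  ftrl_objective phi (loss_estimate true z) (loss_estimate false z) (lam (size z)) v.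
Proof. exact: projT2 (cid (ftrl_prob_sigmoid z)). Qed.

Let f (u : R) : R := (phi u)^-1.
Let df : R -> R := derive1 f.

(** By ftrl_objective_growth, a round with gradient g is stable up to
    g^2 / (lam (2 + 4 |u|)).  Given the past, g^2 has mean at most
    b1^2 (2 + b1 |u|) (e(1)^4 + e(0)^4), so the factors of order |u| cancel. *)
Lemma ftrl_probability_regret (u : R) :
  \sum_(t < n.+1) E t (fun z => err z true ^+ 2 * X z true + err z false ^+ 2 * X z false) <=
  \sum_(t < n.+1) E t (fun z => err z true ^+ 2 * f u + err z false ^+ 2 * f (- u)) +
  lam n * psi u +
  \sum_(t < n.+1) E t (fun z => b1 ^+ 2 * (1 + b1) / lam (size z) *
    (err z true ^+ 4 + err z false ^+ 4)).
Proof.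
pose est (k : bool) (z : seq bool) (b : bool) : R := inv_weight z k b * err z k ^+ 2.
pose loss (v : R) (z : seq bool) (b : bool) : R := est true z b * f v + est false z b * f (- v).
pose grad (z : seq bool) (b : bool) : R :=
  est true z b * df (logit z) - est false z b * df (- logit z).
pose stab (z : seq bool) (b : bool) : R :=
  grad z b ^+ 2 / (lam (size z) * (2 + 4 * `|logit z|)).
pose gain (z : seq bool) (b : bool) : R := loss (logit z) z b - stab z b.
have den0 z : 0 < lam (size z) * (2 + 4 * `|logit z|).
  by rewrite mulr_gt0 ?reg_gt0// ltr_wpDr// mulr_ge0.
have est_ge0 k z b : 0 <= est k z b.
  rewrite mulr_ge0 ?sqr_ge0// /inv_weight divr_ge0//.
  by have /andP[/ltW] := arm_prob_bounds z k.
have pathwise z : size z = n.+1 -> psum gain z <= psum (loss u) z + lam n * psi u.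
  move=> zn.
  have := @ftrl_regret _ R (fun s v => loss v (take s z) (nth false z s)) lam (@psi R)
    (fun s => logit (take s z)) (fun s => gain (take s z) (nth false z s)) n
    (@psi_ge0 R) (ltW (reg_gt0 x n 0)) (fun s _ => reg_mono x n (leqnSn s)) _ u.
  rewrite /psum zn; apply => s a sn.
  have ss : size (take s z) = s by rewrite size_takel// zn ltnW.
  have [_ lmin] := logitP (take s z); rewrite ss in lmin.
  set v := logit (take s z) in lmin *.
  have := ftrl_objective_growth sc (loss_estimate_ge0 true _) (loss_estimate_ge0 false _)
    (reg_gt0 x n s) lmin a.
  have objE c : ftrl_objective phi (loss_estimate true (take s z))
      (loss_estimate false (take s z)) (lam s) c =
    \sum_(i < s) loss c (take i z) (nth false z i) + lam s * psi c.
    rewrite /ftrl_objective /loss_estimate /psum ss !mulr_suml -big_split/=.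
    congr (_ + _); apply: eq_bigr => i _.
    by rewrite /loss /est /error_at /fitted take_takel ?nth_take// ltnW.
  rewrite !objE => growth.
  set b := nth false z s.
  have tan1 := ler_wpM2l (est_ge0 true (take s z) b) (sigmoid_inv_tangent sc v a).
  have tan0 := ler_wpM2l (est_ge0 false (take s z) b)
    (sigmoid_inv_tangent sc (- v) (- a)).
  have : loss v (take s z) b + grad (take s z) b * (a - v) <= loss a (take s z) b.
    rewrite /loss /grad /df /f; lra.
  have := den0 (take s z); rewrite ss /gain /stab ss -/v => dpos.
  set g := grad _ _ => tangent.
  have : - (g ^+ 2 / (lam s * (2 + 4 * `|v|))) <=
      lam s * (2^-1 + `|v|) * (a - v) ^+ 2 + g * (a - v).
    rewrite lerNl ler_pdivlMr// mulrC -subr_ge0.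
    have -> : g ^+ 2 - (lam s * (2 + 4 * `|v|)) *
        - (lam s * (2^-1 + `|v|) * (a - v) ^+ 2 + g * (a - v)) =
      (g + (lam s * (2 + 4 * `|v|)) / 2 * (a - v)) ^+ 2 by field.
    exact: sqr_ge0.
  move: growth tangent; lra.
have := le_mean ftrl_prob01 pathwise.
rewrite meanD mean_cst !mean_psum.
have loss_draw v z : draw p z (loss v z) =
    err z true ^+ 2 * f v + err z false ^+ 2 * f (- v).
  have /andP[p0 p1] := ftrl_prob01 z.
  have q0 : 1 - p z != 0 by rewrite subr_eq0 gt_eqF.
  rewrite /draw /loss /est /inv_weight /=.
  by field; rewrite q0 gt_eqF.
have -> : \sum_(s < n.+1) E s (fun z => draw p z (loss u z)) =
    \sum_(t < n.+1) E t (fun z => err z true ^+ 2 * f u + err z false ^+ 2 * f (- u)).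
  by apply: eq_bigr => s _; apply: eq_mean => z _; exact: loss_draw.
move=> le_gain; rewrite -lerBlDr; apply: le_trans le_gain.
rewrite -sumrB; apply: ler_sum => t _; rewrite -meanB; apply: le_mean => [|z _].
  exact: ftrl_prob01.
have [pl _] := logitP z.
have X1 : X z true = f (logit z) by rewrite /f pl.
have X0 : X z false = f (- logit z) by rewrite /f (sigmoid_opp sc) pl.
have stab_draw : draw p z (stab z) =
    (err z true ^+ 4 * X z true * df (logit z) ^+ 2 +
     err z false ^+ 4 * X z false * df (- logit z) ^+ 2) /
    (lam (size z) * (2 + 4 * `|logit z|)).
  have /andP[p0 p1] := ftrl_prob01 z.
  have q0 : 1 - p z != 0 by rewrite subr_eq0 gt_eqF.
  rewrite /draw /stab /grad /est /inv_weight /inv_prob /=.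
  field; rewrite q0 gt_eqF//= ?(gt_eqF (reg_gt0 _ _ _))//=.
  by rewrite gt_eqF// ltr_wpDr// mulr_ge0.
have -> : draw p z (gain z) = draw p z (loss (logit z) z) - draw p z (stab z).
  by rewrite /draw /gain; ring.
rewrite loss_draw -X1 -X0 lerD2l lerN2 stab_draw.
rewrite ler_pdivrMr//.
have -> : b1 ^+ 2 * (1 + b1) / lam (size z) * (err z true ^+ 4 + err z false ^+ 4) *
    (lam (size z) * (2 + 4 * `|logit z|)) =
  err z true ^+ 4 * ((1 + b1) * (2 + 4 * `|logit z|) * b1 ^+ 2) +
  err z false ^+ 4 * ((1 + b1) * (2 + 4 * `|logit z|) * b1 ^+ 2).
  by field; rewrite gt_eqF// reg_gt0.
have armle v : `|v| = `|logit z| ->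
    f v * df v ^+ 2 <= (1 + b1) * (2 + 4 * `|logit z|) * b1 ^+ 2.
  move=> vl; have f1 := sigmoid_inv_le_linear sc v; rewrite vl in f1.
  have f0 := sigmoid_inv_gt1 sc v.
  have d1 := sigmoid_inv_derive_ge sc v; have d0 := sigmoid_inv_derive_lt0 sc v.
  apply: ler_pM; rewrite ?sqr_ge0//; first exact: le_trans ler01 (ltW f0).
    apply: (le_trans f1); have := normr_ge0 (logit z); have := ltW b1_gt0.
    move: `|logit z| => l b l0; have := mulr_ge0 b l0; lra.
  rewrite -sqrrN lerXn2r ?nnegrE ?(ltW b1_gt0)//; rewrite /df /f; lra.
rewrite X1 X0; apply: lerD; rewrite -mulrA ler_wpM2l ?exprn_even_ge0//; apply: armle => //.
by rewrite normrN.
Qed.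

Definition variance_const : R :=
  (c1 ^+ 4 + inv_prob_const + (gamma0 + 1 + 2 * c2)) / 2.

Lemma variance_const_ge0 : 0 <= variance_const.
Proof.
have CX0 := inv_prob_const_ge0; have g0 := gamma0_gt0; have c20 := c2_gt0.
have c14 : 0 <= c1 ^+ 4 by rewrite exprn_even_ge0.
by rewrite /variance_const; lra.
Qed.

(** Young's inequality is applied twice, with weights mu and cc that balance the
    three bounds available: on the sum of y^4, on E X^4, and on h^4. *)
Lemma leverage_variance_le (k : bool) :
  \sum_(t < n.+1) h t * y k t ^+ 2 * E t (X^~ k) <= variance_const * (r * rho n).
Proof.
have r0 := horizon_sqrt_gt0 R n; have pn0 := radius_gt0 x n.
have CX0 := inv_prob_const_ge0; have g0 := gamma0_gt0; have c20 := c2_gt0.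
pose mu : R := rho n / r.
have mu0 : 0 < mu by rewrite divr_gt0.
(* The square of al t is the factor of Ch in leverage_pow4_le. *)
pose al (t : nat) : R := rho t ^+ 2 / r * (Num.sqrt t.+1%:R)^-1.
pose Ch : R := gamma0 + 1 + 2 * c2.
have Ch0 : 0 <= Ch by rewrite /Ch; lra.
have step (t : 'I_n.+1) : h t * y k t ^+ 2 * E t (X^~ k) <=
    mu / 2 * y k t ^+ 4 + (inv_prob_const + Ch) / (4 * mu) *
      (rho n ^+ 2 / r * (Num.sqrt t.+1%:R)^-1).
  have tn : (t <= n)%N by rewrite -ltnS.
  have p0 := radius_gt0 x t.
  have s0 : 0 < Num.sqrt t.+1%:R :> R by rewrite sqrtr_gt0 ltr0n.
  have a0 : 0 < al t by rewrite mulr_gt0 ?invr_gt0// divr_gt0// exprn_gt0.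
  have al2 : al t ^+ 2 = rho t ^+ 4 / (n.+1%:R * t.+1%:R).
    have -> : t.+1%:R = Num.sqrt t.+1%:R ^+ 2 :> R by rewrite sqr_sqrtr.
    by rewrite /al -(horizon_sqrt_sqr R n); field; rewrite !gt_eqF.
  have := leverage_pow4_le x n c2_gt0 gamma0_gt0 t; rewrite -al2 -/Ch => h4.
  have hpos := leverage_gt0 x n gamma0 c2_gt0 t.
  pose cc := rho t * al t / r.
  have cc0 : 0 < cc by rewrite divr_gt0// mulr_gt0.
  have young z : h t * y k t ^+ 2 * X z k <=
      mu / 2 * y k t ^+ 4 + (4 * mu)^-1 * (cc * X z k ^+ 4 + h t ^+ 4 / cc).
    have e1 : 0 <= (mu * y k t ^+ 2 - h t * X z k) ^+ 2 := sqr_ge0 _.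
    have e2 : 0 <= (cc * X z k ^+ 2 - h t ^+ 2) ^+ 2 := sqr_ge0 _.
    rewrite -subr_ge0.
    have -> : mu / 2 * y k t ^+ 4 + (4 * mu)^-1 * (cc * X z k ^+ 4 + h t ^+ 4 / cc)
       - h t * y k t ^+ 2 * X z k =
      (2 * mu)^-1 * (mu * y k t ^+ 2 - h t * X z k) ^+ 2 +
      (4 * mu * cc)^-1 * (cc * X z k ^+ 2 - h t ^+ 2) ^+ 2.
      by field; rewrite !gt_eqF.
    have m2 : 0 <= (2 * mu)^-1 by rewrite invr_ge0 ltW// mulr_gt0.
    have m4 : 0 <= (4 * mu * cc)^-1.
      by rewrite invr_ge0; apply/ltW/mulr_gt0 => //; exact: mulr_gt0.
    exact: addr_ge0 (mulr_ge0 m2 e1) (mulr_ge0 m4 e2).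
  rewrite -meanZ; apply: (le_trans (le_mean ftrl_prob01 (fun z _ => young z))).
  rewrite meanD mean_cst meanZ meanD mean_cst meanZ lerD2l.
  have -> : (inv_prob_const + Ch) / (4 * mu) * (rho n ^+ 2 / r / Num.sqrt t.+1%:R) =
    (4 * mu)^-1 * ((inv_prob_const + Ch) * (rho n ^+ 2 / r / Num.sqrt t.+1%:R)).
    by rewrite [RHS]mulrA [(4 * mu)^-1 * (_ + _)]mulrC.
  have mu4 : 0 <= (4 * mu)^-1 by rewrite invr_ge0 mulr_ge0// ltW.
  rewrite ler_wpM2l//.
  have b1' : cc * E t (fun z => X z k ^+ 4) <= inv_prob_const * al t.
    apply: le_trans (ler_wpM2l (ltW cc0) (mean_inv_prob_pow4_le k tn)) _.
    by apply: le_of_eq; rewrite /cc; field; rewrite !gt_eqF.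
  have b2' : h t ^+ 4 / cc <= Ch * al t.
    have -> : h t ^+ 4 / cc = h t ^+ 4 * r / rho t / al t.
      by rewrite /cc; field; rewrite !gt_eqF.
    by rewrite ler_pdivrMr// -[leRHS]mulrA -expr2.
  apply: (@le_trans _ _ ((inv_prob_const + Ch) * al t)); first by rewrite mulrDl lerD.
  apply: ler_wpM2l; first exact: addr_ge0.
  rewrite /al; apply: ler_wpM2r; first by rewrite invr_ge0 ltW.
  apply: ler_wpM2r; first by rewrite invr_ge0 ltW.
  by rewrite lerXn2r ?nnegrE ?(ltW p0) ?(ltW pn0)// radius_mono.
apply: le_trans (ler_sum _ (fun t _ => step t)) _.
rewrite big_split/= -!mulr_sumr.
have mu2 : 0 <= mu / 2 by rewrite divr_ge0// ltW.
have h1 := ler_wpM2l mu2 (moment4_le k).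
have q0 : 0 <= (inv_prob_const + Ch) / (4 * mu) * (rho n ^+ 2 / r).
  have mu4 : 0 <= 4 * mu by rewrite mulr_ge0// ltW.
  apply: mulr_ge0; apply: divr_ge0 => //; first exact: addr_ge0.
    exact: sqr_ge0.
  exact: ltW.
have h2 := ler_wpM2l q0 (sum_inv_sqrt_le R n.+1).
rewrite -/(horizon_sqrt R n) in h2.
rewrite -(horizon_sqrt_sqr R n) in h1.
have e1 : mu / 2 * (c1 ^+ 4 * r ^+ 2) = c1 ^+ 4 / 2 * (r * rho n).
  by rewrite /mu; field; rewrite gt_eqF.
have e2 : (inv_prob_const + Ch) / (4 * mu) * (rho n ^+ 2 / r) * (2 * r) =
    (inv_prob_const + Ch) / 2 * (r * rho n).
  by rewrite /mu; field; rewrite !gt_eqF.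
rewrite e1 in h1; rewrite e2 -[X in X <= _]mulrA in h2.
rewrite /variance_const -/Ch; lra.
Qed.

Lemma ftrl_combined_prediction_regret (w : bool -> R) (b : 'cV[R]_d) :
  \sum_(t < n.+1) E t (fun z => comb w (err z) ^+ 2) <=
  \sum_(t < n.+1) (comb w (fun k => y k t) - dotp (x t) b) ^+ 2 +
  lam n * dotp b b +
  (w true ^+ 2 + w false ^+ 2) * (error_const + variance_const) * (r * rho n).
Proof.
have r0 := horizon_sqrt_gt0 R n; have pn0 := radius_gt0 x n.
set w2 := w true ^+ 2 + w false ^+ 2.
have w20 : 0 <= w2 by rewrite addr_ge0 ?sqr_ge0.
have step (t : 'I_n.+1) : E t (fun z => comb w (err z) ^+ 2) <=
   E t (fun z => (comb w (err z) ^+ 2 + pseudo_variance w z) * (1 + h (size z))^-1) -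
   E t (pseudo_variance w) +
   (rho n / r * w2 * (E t (fun z => err z true ^+ 2) + E t (fun z => err z false ^+ 2)) +
    (w true ^+ 2 * (h t * y true t ^+ 2 * E t (X^~ true)) +
     w false ^+ 2 * (h t * y false t ^+ 2 * E t (X^~ false)))).
  have tn : (t <= n)%N by rewrite -ltnS.
  have hpos := leverage_gt0 x n gamma0 c2_gt0 t.
  rewrite -meanD -!meanZ -!meanD -meanB -meanD; apply: le_mean => [|z zt].
    exact: ftrl_prob01.
  rewrite zt.
  have V0 : 0 <= pseudo_variance w z.
    have := draw_pseudo_outcome w z (comb w (fun k => y k (size z))) 1.
    rewrite subrr expr0n add0r !mulr1 => <-.
    by apply: draw_ge0 => [|k]; [exact: ftrl_prob01|rewrite mulr1 sqr_ge0].
  have Vle : pseudo_variance w z <=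
      w true ^+ 2 * (y true t ^+ 2 * X z true) + w false ^+ 2 * (y false t ^+ 2 * X z false).
    rewrite /pseudo_variance zt; have := sqr_ge0 (comb w (fun k => y k t)).
    move: (comb _ _) => c; lra.
  have cerr : comb w (err z) ^+ 2 <= w2 * (err z true ^+ 2 + err z false ^+ 2).
    rewrite /comb /w2 -subr_ge0.
    have := sqr_ge0 (w true * err z false - w false * err z true); lra.
  have hrho : h t <= rho n / r.
    apply: le_trans (leverage_le _ _ _ _ _) _.
    by rewrite ler_wpM2r ?invr_ge0 ?(ltW r0)// radius_mono.
  set e := comb w (err z) ^+ 2 in cerr *.
  have e0 : 0 <= e by exact: sqr_ge0.
  set V := pseudo_variance w z in V0 Vle *.
  have inv_ge : (e + V) * (1 - h t) <= (e + V) * (1 + h t)^-1.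
    apply: ler_wpM2l; first exact: addr_ge0.
    have h1 : 0 < 1 + h t by lra.
    by rewrite -(ler_pM2r h1) mulVf ?gt_eqF//; have := sqr_ge0 (h t); lra.
  have he : h t * e <= rho n / r * (w2 * (err z true ^+ 2 + err z false ^+ 2)).
    by apply: ler_pM => //; exact: ltW.
  have hV := ler_wpM2l (ltW hpos) Vle.
  move: inv_ge; move: (_^-1) (rho n / r) he => i m he inv_ge; lra.
apply: le_trans (ler_sum _ (fun t _ => step t)) _.
have := ftrl_prediction_regret w b.
rewrite !big_split/= -!mulr_sumr sumrN !big_split/= -/error_total.
have m0 : 0 <= rho n / r * w2 by rewrite mulr_ge0// divr_ge0// ltW.
have h1 := ler_wpM2l m0 error_total_le.
have h2 := ler_wpM2l (sqr_ge0 (w true)) (leverage_variance_le true).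
have h3 := ler_wpM2l (sqr_ge0 (w false)) (leverage_variance_le false).
rewrite -(horizon_sqrt_sqr R n) in h1.
have e1 : rho n / r * w2 * (error_const * r ^+ 2) = w2 * error_const * (r * rho n).
  by field; rewrite gt_eqF.
rewrite e1 in h1.
have : w true ^+ 2 * (variance_const * (r * rho n)) +
    w false ^+ 2 * (variance_const * (r * rho n)) = w2 * variance_const * (r * rho n).
  by rewrite /w2; ring.
move: h1 h2 h3; move: (rho n / r * w2 * _) => a; lra.
Qed.

(** If w(1) w(0) = 1 and 1 / p = 1 + w(1)^2, then 1 / (1 - p) = 1 + w(0)^2 and
    e(1)^2 / p + e(0)^2 / (1 - p) - (e(1) - e(0))^2 = (w(1) e(1) + w(0) e(0))^2,
    so the two regrets add up. *)
Lemma ftrl_variance_le (u : R) (w : bool -> R) (b : 'cV[R]_d) :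
  w true * w false = 1 -> f u = 1 + w true ^+ 2 -> f (- u) = 1 + w false ^+ 2 ->
  n.+1%:R ^+ 2 * aipw_variance n.+1 D x y <=
  \sum_(t < n.+1) (comb w (fun k => y k t) - dotp (x t) b) ^+ 2 +
  (psi u + dotp b b + 2 * b1 ^+ 2 * (1 + b1) * error4_const +
   (w true ^+ 2 + w false ^+ 2) * (error_const + variance_const)) * (r * rho n).
Proof.
move=> w1 fu fnu; rewrite (@aipw_variance_mean R d D x y ftrl_prob01)//.
have -> : \sum_(t < n.+1) E t (fun z => err z true ^+ 2 / p z + err z false ^+ 2 / (1 - p z)
      - (err z true - err z false) ^+ 2) =
    \sum_(t < n.+1) E t (fun z => err z true ^+ 2 * X z true + err z false ^+ 2 * X z false) -
    \sum_(t < n.+1) E t (fun z => (err z true - err z false) ^+ 2).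
  by rewrite -sumrB; apply: eq_bigr => t _; rewrite meanB.
have := ftrl_probability_regret u.
have := ftrl_combined_prediction_regret w b.
have -> : \sum_(t < n.+1) E t (fun z => comb w (err z) ^+ 2) =
    \sum_(t < n.+1) E t (fun z => err z true ^+ 2 * f u + err z false ^+ 2 * f (- u)) -
    \sum_(t < n.+1) E t (fun z => (err z true - err z false) ^+ 2).
  rewrite -sumrB; apply: eq_bigr => t _; rewrite -meanB; apply: eq_mean => z _.
  rewrite fu fnu /comb; move: (err z true) (err z false) => e1 e0.
  transitivity (w true ^+ 2 * e1 ^+ 2 + w false ^+ 2 * e0 ^+ 2 +
    2 * (w true * w false) * e1 * e0); first by ring.
  by rewrite w1; ring.
have -> : \sum_(t < n.+1) E t (fun z => b1 ^+ 2 * (1 + b1) / lam (size z) *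
     (err z true ^+ 4 + err z false ^+ 4)) =
    b1 ^+ 2 * (1 + b1) * (\sum_(t < n.+1) E t (fun z => err z true ^+ 4) / lam t +
                          \sum_(t < n.+1) E t (fun z => err z false ^+ 4) / lam t).
  rewrite -big_split mulr_sumr /=; apply: eq_bigr => t _.
  rewrite -mulrDl -meanD [_ / lam t]mulrC mulrA -meanZ; apply: eq_mean => z ->//.
have bb : 0 <= b1 ^+ 2 * (1 + b1).
  by rewrite mulr_ge0 ?sqr_ge0//; have := ltW b1_gt0; lra.
have := ler_wpM2l bb (lerD (error_pow4_sum_le true) (error_pow4_sum_le false)).
rewrite -/(reg x n n) /reg; lra.
Qed.

End FtrlProcess.

(** * The oracle *)

Section Oracle.
Context (R : realType) (d : nat).
Variables (x : nat -> 'cV[R]_d) (y : bool -> nat -> R) (n : nat).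
Variable b : bool -> 'cV[R]_d.
Hypothesis least_squares : forall k, normal_equation x (y k) n.+1 0 (b k).

Definition residual (k : bool) (t : nat) : R := y k t - dotp (x t) (b k).

Definition residual_norm (k : bool) : R :=
  Num.sqrt (\sum_(t < n.+1) residual k t ^+ 2).

Lemma residual_norm_sqr k : residual_norm k ^+ 2 = \sum_(t < n.+1) residual k t ^+ 2.
Proof. by rewrite sqr_sqrtr// sumr_ge0// => t _; exact: sqr_ge0. Qed.

Lemma residual_orthogonal k v : \sum_(t < n.+1) residual k t * dotp (x t) v = 0.
Proof. by rewrite least_squares mul0r. Qed.

Lemma nonadaptive_variance (q : R) (c : bool -> 'cV[R]_d) : 0 < q < 1 ->
  n.+1%:R ^+ 2 * aipw_variance n.+1 (nonadaptive q c) x y =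
  \sum_(t < n.+1) ((y true t - dotp (x t) (c true)) ^+ 2 / q +
    (y false t - dotp (x t) (c false)) ^+ 2 / (1 - q) -
    (y true t - dotp (x t) (c true) - (y false t - dotp (x t) (c false))) ^+ 2).
Proof.
move=> q01; rewrite (@aipw_variance_mean R d (nonadaptive q c) x y)//.
apply: eq_bigr => t _.
by rewrite -[RHS](mean_cst (prob_at (nonadaptive q c) x y) t); apply: eq_mean => z <-.
Qed.

(** Residuals are orthogonal to all predictions, so changing the predictors adds a
    square; for the least-squares predictors the arithmetic-geometric inequality
    gives the best odds (1 - q) / q. *)
Lemma oracle_variance_ge :
  2 * residual_norm true * residual_norm false +
    2 * \sum_(t < n.+1) residual true t * residual false t <=
  n.+1%:R ^+ 2 * oracle_variance n.+1 x y.
Proof.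
set V0 := (X in X <= _).
have T0 : 0 < n.+1%:R ^+ 2 :> R by rewrite exprn_gt0// ltr0n.
rewrite mulrC -ler_pdivrMr//; apply: lb_le_inf.
  have h01 : 0 < (2^-1 : R) < 1 by lra.
  by exists (aipw_variance n.+1 (nonadaptive 2^-1 (fun=> 0)) x y), 2^-1, (fun=> 0).
move=> _ [q [c [q01 ->]]]; rewrite ler_pdivrMr// mulrC nonadaptive_variance//.
have /andP[q0 q1] := q01.
pose k := (1 - q) / q; have k0 : 0 < k by rewrite divr_gt0// subr_gt0.
pose v j := c j - b j.
have errE j (t : nat) : y j t - dotp (x t) (c j) = residual j t - dotp (x t) (v j).
  by rewrite /residual /v dotpBr; ring.
have -> : \sum_(t < n.+1) ((y true t - dotp (x t) (c true)) ^+ 2 / q +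
    (y false t - dotp (x t) (c false)) ^+ 2 / (1 - q) -
    (y true t - dotp (x t) (c true) - (y false t - dotp (x t) (c false))) ^+ 2) =
  k * residual_norm true ^+ 2 + k^-1 * residual_norm false ^+ 2 +
  2 * (\sum_(t < n.+1) residual true t * residual false t) +
  \sum_(t < n.+1) k^-1 * (k * dotp (x t) (v true) + dotp (x t) (v false)) ^+ 2.
  rewrite !residual_norm_sqr.
  have z1 := residual_orthogonal true (v true); have z2 := residual_orthogonal true (v false).
  have z3 := residual_orthogonal false (v true); have z4 := residual_orthogonal false (v false).
  transitivity (k * \sum_(t < n.+1) residual true t ^+ 2 +
    k^-1 * \sum_(t < n.+1) residual false t ^+ 2 +
    2 * (\sum_(t < n.+1) residual true t * residual false t) +
    \sum_(t < n.+1) k^-1 * (k * dotp (x t) (v true) + dotp (x t) (v false)) ^+ 2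
    - 2 * k * \sum_(t < n.+1) residual true t * dotp (x t) (v true)
    - 2 * \sum_(t < n.+1) residual true t * dotp (x t) (v false)
    - 2 * \sum_(t < n.+1) residual false t * dotp (x t) (v true)
    - 2 * k^-1 * \sum_(t < n.+1) residual false t * dotp (x t) (v false)); last first.
    by rewrite z1 z2 z3 z4; ring.
  rewrite !mulr_sumr -!big_split/= -!sumrB; apply: eq_bigr => t _.
  rewrite !errE /k; field.
  by rewrite subr_eq0 !gt_eqF.
have : 0 <= \sum_(t < n.+1) k^-1 * (k * dotp (x t) (v true) + dotp (x t) (v false)) ^+ 2.
  by apply: sumr_ge0 => t _; rewrite mulr_ge0 ?sqr_ge0// invr_ge0 ltW.
have : 2 * residual_norm true * residual_norm false <=
    k * residual_norm true ^+ 2 + k^-1 * residual_norm false ^+ 2.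
  rewrite -subr_ge0.
  have -> : k * residual_norm true ^+ 2 + k^-1 * residual_norm false ^+ 2 -
      2 * residual_norm true * residual_norm false =
    k^-1 * (k * residual_norm true - residual_norm false) ^+ 2.
    by field; rewrite gt_eqF.
  by rewrite mulr_ge0 ?sqr_ge0// invr_ge0 ltW.
rewrite /V0; lra.
Qed.

(** At the optimal odds the arithmetic-geometric inequality is an equality. *)
Lemma weighted_residual_sum (w : bool -> R) : w true * w false = 1 ->
  residual_norm false = w true ^+ 2 * residual_norm true ->
  residual_norm true = w false ^+ 2 * residual_norm false ->
  \sum_(t < n.+1) (comb w (fun k => y k t) -
      dotp (x t) (w true *: b true + w false *: b false)) ^+ 2 =
  2 * residual_norm true * residual_norm false +
    2 * \sum_(t < n.+1) residual true t * residual false t.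
Proof.
move=> w1 r0E r1E.
transitivity (w true ^+ 2 * residual_norm true ^+ 2 + w false ^+ 2 * residual_norm false ^+ 2
  + 2 * (w true * w false) * \sum_(t < n.+1) residual true t * residual false t).
  rewrite !residual_norm_sqr !mulr_sumr -!big_split/=; apply: eq_bigr => t _.
  by rewrite dotp_comb -combB /comb /residual; ring.
have h1 : w true ^+ 2 * residual_norm true ^+ 2 =
    residual_norm true * residual_norm false by rewrite r0E; ring.
have h2 : w false ^+ 2 * residual_norm false ^+ 2 =
    residual_norm true * residual_norm false by rewrite r1E; ring.
by rewrite w1 h1 h2; ring.
Qed.

End Oracle.

(** * The regret bound *)

Section RegretBound.
Context (R : realType) (d : nat) (phi : R -> R) (b1 b2 b3 : R).
Variables (c0 c1 c2 gamma0 K : R).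
Hypotheses (b1_gt0 : 0 < b1) (b2_gt0 : 0 < b2) (c0_gt0 : 0 < c0) (c1_gt0 : 0 < c1).
Hypotheses (c2_gt0 : 0 < c2) (gamma0_gt0 : 0 < gamma0) (K_ge1 : 1 <= K).
Hypothesis sc : sigmoid_condition phi b1 b2 b3.
Variables (x : nat -> 'cV[R]_d) (y : bool -> nat -> R) (n : nat).
Local Notation r := (horizon_sqrt R n).

Hypothesis radius_sqr_le : radius x n ^+ 2 <= K * r.
Hypothesis gram_ge : forall t, (0 < t <= n)%N -> r * gamma0 <= t%:R ->
  forall v, t%:R / c2 * dotp v v <= \sum_(s < t) dotp (x s) v ^+ 2.
Hypothesis gram_final_ge :
  forall v, n.+1%:R / c2 * dotp v v <= \sum_(s < n.+1) dotp (x s) v ^+ 2.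
Hypothesis moment4_le : forall k, \sum_(t < n.+1) y k t ^+ 4 <= c1 ^+ 4 * n.+1%:R.
Hypothesis fit_error_ge : forall k b,
  c0 ^+ 2 * n.+1%:R <= \sum_(t < n.+1) (y k t - dotp (x t) b) ^+ 2.

Definition logit_bound : R := b2 / 2 / (c0 / (c0 + c1)).

Definition regret_const : R :=
  2^-1 * logit_bound ^+ 2 + logit_bound ^+ 3 + 4 * (c1 / c0) * c2 * c1 ^+ 2 +
  2 * b1 ^+ 2 * (1 + b1) * error4_const b1 b2 c1 c2 gamma0 K +
  2 * (c1 / c0) * (error_const b1 b2 c1 K + variance_const b1 b2 c1 c2 gamma0 K).

(** The competitors are the least-squares predictors and the probability
    a(1) / (a(1) + a(0)), where a(k) is the norm of the residuals of arm k.  Both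
    norms are between c0 sqrt T and c1 sqrt T, so this probability stays away from
    0 and 1 and the corresponding u and predictors are bounded. *)
Lemma scaled_regret_le :
  n.+1%:R ^+ 2 * aipw_variance n.+1 (sigmoid_ftrl n.+1 phi) x y -
  n.+1%:R ^+ 2 * oracle_variance n.+1 x y <= regret_const * (r * radius x n).
Proof.
have r0 := horizon_sqrt_gt0 R n; have rho0 := radius_gt0 x n.
have T0 : 0 < n.+1%:R :> R by rewrite ltr0n.
have coercive v : n.+1%:R / c2 * dotp v v <= ridge_form x n.+1 0 v.
  by rewrite /ridge_form mul0r addr0.
have ols k := ridge_minimizer_exists (y k) (divr_gt0 T0 c2_gt0) coercive.
pose b k := projT1 (cid (ols k)).
have bP k : normal_equation x (y k) n.+1 0 (b k) := projT2 (cid (ols k)).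
pose a k := residual_norm x y n b k.
have a2 k : a k ^+ 2 = \sum_(t < n.+1) (y k t - dotp (x t) (b k)) ^+ 2.
  exact: residual_norm_sqr.
have a_ge0 k : 0 <= a k by exact: sqrtr_ge0.
have m2 k := moment2_le moment4_le k.
have a_ge k : c0 * r <= a k.
  rewrite -(@ler_pXn2r _ 2) ?nnegrE ?mulr_ge0 ?(ltW c0_gt0) ?(ltW r0)//.
  by rewrite exprMn horizon_sqrt_sqr a2.
have a_le k : a k <= c1 * r.
  rewrite -(@ler_pXn2r _ 2) ?nnegrE ?mulr_ge0 ?(ltW c1_gt0) ?(ltW r0)//.
  rewrite exprMn horizon_sqrt_sqr a2; apply: le_trans (m2 k).
  have := ridge_loss_eq 0 (bP k); rewrite /ridge_loss /ridge_form !mul0r !addr0.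
  have -> : \sum_(s < n.+1) (y k s - dotp (x s) 0) ^+ 2 = \sum_(s < n.+1) y k s ^+ 2.
    by apply: eq_bigr => s _; rewrite dotp0r subr0.
  by move=> ->; rewrite lerDl; apply: sumr_ge0 => s _; exact: sqr_ge0.
have a0 k : 0 < a k by apply: lt_le_trans (a_ge k); rewrite mulr_gt0.
have bb k : dotp (b k) (b k) <= c2 * c1 ^+ 2.
  rewrite -(@ler_pM2l _ (n.+1%:R / c2)) ?divr_gt0//.
  apply: le_trans (coercive _) _.
  apply: le_trans (ridge_form_minimizer_le (lexx 0) (bP k)) _.
  apply: (le_trans (m2 k)); apply: le_of_eq.
  by field; rewrite gt_eqF.
(* The square of w true is the odds ratio (1 - p) / p of p = a(1) / (a(1) + a(0)). *)
pose w k := Num.sqrt (a (~~ k) / a k).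
have w2 k : w k ^+ 2 = a (~~ k) / a k by rewrite sqr_sqrtr// divr_ge0.
have w2_le k : w k ^+ 2 <= c1 / c0.
  rewrite w2 ler_pdivrMr// mulrAC ler_pdivlMr//.
  apply: (le_trans (ler_wpM2r (ltW c0_gt0) (a_le _))).
  have := ler_wpM2l (ltW c1_gt0) (a_ge k); lra.
have w1 : w true * w false = 1.
  rewrite /w -sqrtrM ?divr_ge0//=.
  have -> : a false / a true * (a true / a false) = 1 by field; rewrite !gt_eqF.
  by rewrite sqrtr1.
have aD : 0 < a true + a false by rewrite addr_gt0.
have p01 : 0 < a true / (a true + a false) < 1.
  by rewrite divr_gt0//= ltr_pdivrMr// mul1r ltrDl.
have [u pu] := sigmoid_surjective sc p01.
have fu : (phi u)^-1 = 1 + w true ^+ 2.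
  by rewrite pu w2 /=; field; rewrite !gt_eqF.
have fnu : (phi (- u))^-1 = 1 + w false ^+ 2.
  rewrite (sigmoid_opp sc) pu w2 /=; field.
  by rewrite !gt_eqF.
have c01 : 0 < c0 + c1 by rewrite addr_gt0.
have ratio (i j : R) : c0 * r <= i -> j <= c1 * r -> 0 < i -> 0 < j ->
    c0 / (c0 + c1) <= i / (i + j).
  move=> ih jh i0 j0; rewrite ler_pdivrMr// mulrAC ler_pdivlMr ?addr_gt0//.
  have := ler_wpM2l (ltW c1_gt0) ih; have := ler_wpM2l (ltW c0_gt0) jh; lra.
have u_le : `|u| <= logit_bound.
  apply: (sigmoid_preimage_bounded sc b2_gt0); first by rewrite divr_gt0.
  rewrite pu ratio//= lerBrDr -lerBrDl.
  have -> : 1 - a true / (a true + a false) = a false / (a false + a true).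
    by field; rewrite addrC !gt_eqF.
  exact: ratio.
have psiu : psi u <= 2^-1 * logit_bound ^+ 2 + logit_bound ^+ 3.
  have L0 := le_trans (normr_ge0 u) u_le.
  rewrite /psi -(real_normK (num_real u)); apply: lerD.
    by rewrite ler_wpM2l// lerXn2r ?nnegrE.
  by rewrite lerXn2r ?nnegrE.
have var_le := ftrl_variance_le sc b2_gt0 b1_gt0 c1_gt0 c2_gt0 gamma0_gt0 K_ge1
  radius_sqr_le gram_ge moment4_le (w true *: b true + w false *: b false) w1 fu fnu.
have r0E : a false = w true ^+ 2 * a true by rewrite w2 /= divfK// gt_eqF.
have r1E : a true = w false ^+ 2 * a false by rewrite w2 /= divfK// gt_eqF.
rewrite (weighted_residual_sum w1 r0E r1E) in var_le.
have oracle_ge := oracle_variance_ge bP.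
have rr : 0 <= r * radius x n by rewrite mulr_ge0// ltW.
have bstar : dotp (w true *: b true + w false *: b false)
    (w true *: b true + w false *: b false) <= 4 * (c1 / c0) * c2 * c1 ^+ 2.
  have CS : dotp (w true *: b true + w false *: b false)
      (w true *: b true + w false *: b false) <=
      (w true ^+ 2 + w false ^+ 2) * (dotp (b true) (b true) + dotp (b false) (b false)).
    have := dotp_ge0 (w true *: b false - w false *: b true).
    rewrite !dotpDl !dotpDr !dotpNl !dotpNr !dotpZl !dotpZr (dotpC (b false) (b true)).
    lra.
  apply: (le_trans CS).
  have -> : 4 * (c1 / c0) * c2 * c1 ^+ 2 = (c1 / c0 + c1 / c0) * (c2 * c1 ^+ 2 + c2 * c1 ^+ 2).
    by ring.
  by apply: ler_pM; rewrite ?addr_ge0 ?sqr_ge0 ?dotp_ge0// lerD.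
have consts_ge0 : 0 <= error_const b1 b2 c1 K + variance_const b1 b2 c1 c2 gamma0 K.
  by rewrite addr_ge0 ?error_const_ge0 ?variance_const_ge0.
have wsum : (w true ^+ 2 + w false ^+ 2) *
    (error_const b1 b2 c1 K + variance_const b1 b2 c1 c2 gamma0 K) <=
    2 * (c1 / c0) * (error_const b1 b2 c1 K + variance_const b1 b2 c1 c2 gamma0 K).
  rewrite ler_wpM2r//; have := w2_le true; have := w2_le false; lra.
have : (psi u + dotp (w true *: b true + w false *: b false) (w true *: b true + w false *: b false) +
    2 * b1 ^+ 2 * (1 + b1) * error4_const b1 b2 c1 c2 gamma0 K +
    (w true ^+ 2 + w false ^+ 2) *
    (error_const b1 b2 c1 K + variance_const b1 b2 c1 c2 gamma0 K)) * (r * radius x n) <=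
    regret_const * (r * radius x n).
  rewrite ler_wpM2r// /regret_const; move: psiu bstar wsum.
  move: (psi u) (dotp _ _) (_ * error4_const _ _ _ _ _ _) => ? ? ?; lra.
move: var_le oracle_ge; rewrite -/(a true) -/(a false); lra.
Qed.

End RegretBound.

Lemma le_pow4_of_root (R : realType) (m c : R) :
  0 <= m -> 0 <= c -> m `^ (4%:R^-1) <= c -> m <= c ^+ 4.
Proof.
move=> m0 c0 mc.
have -> : m = (m `^ (4%:R^-1)) ^+ 4.
  by rewrite -powR_mulrn ?powR_ge0// -powRrM mulVf// powRr1.
by rewrite lerXn2r ?nnegrE ?powR_ge0.
Qed.

(** For a unit vector v the sum of the <x_s, v>^2 is at most T R^2.  So R is bounded
    below, and the constant 1 in the radii of the design is absorbed by R. *)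
Lemma max_enorm_ge (R : realType) (d n : nat) (x : nat -> 'cV[R]_d) (c2 : R) :
  (1 <= d)%N -> 0 < c2 ->
  (forall v, n.+1%:R / c2 * dotp v v <= \sum_(s < n.+1) dotp (x s) v ^+ 2) ->
  1 <= Num.sqrt c2 * max_enorm n.+1 x.
Proof.
case: d x => // d x _ c20 gram.
have M0 : 0 <= max_enorm n.+1 x by exact: bigmax_ge_id.
have T0 : 0 < n.+1%:R :> R by rewrite ltr0n.
pose v : 'cV[R]_d.+1 := delta_mx 0 0.
have vv : dotp v v = 1.
  rewrite /dotp (bigD1 ord0)//= big1 ?addr0 => [|i /negbTE i0]; rewrite !mxE.
    by rewrite eqxx mulr1.
  by rewrite i0 mul0r.
rewrite -(@ler_pXn2r _ 2) ?nnegrE ?mulr_ge0 ?sqrtr_ge0// expr1n exprMn sqr_sqrtr ?(ltW c20)//.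
rewrite -(@ler_pM2l _ (n.+1%:R / c2)) ?divr_gt0//.
have := gram v; rewrite vv => /le_trans; apply.
apply: (@le_trans _ _ (\sum_(s < n.+1) max_enorm n.+1 x ^+ 2)).
  apply: ler_sum => s _; apply: le_trans (dotp_CauchySchwarz _ _) _.
  rewrite vv mulr1 -enorm_sqr lerXn2r ?nnegrE ?enorm_ge0//.
  exact: (le_bigmax _ (fun s : 'I_n.+1 => enorm (x s)) s).
rewrite sumr_const card_ord -mulr_natr; apply: le_of_eq.
by field; rewrite gt_eqF.
Qed.

Theorem theorem4p1 (R : realType) (c0 c1 c2 c3 gamma0 b1 b2 b3 : R)
    (hc0 : 0 < c0) (hc01 : c0 <= c1) (hc2 : 0 < c2) (hc3 : 0 < c3)
    (hgamma0 : 0 < gamma0) (hb1 : 0 < b1) (hb2 : 0 < b2) (hb3 : 0 < b3) :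
  exists2 C : R, 0 < C &
    forall phi : R -> R, sigmoid_condition phi b1 b2 b3 ->
    forall (T d : nat), (1 <= T)%N -> (1 <= d)%N ->
    forall (x : nat -> 'cV[R]_d) (y : bool -> nat -> R),
      outcome_assumption T x y c0 c1 ->
      gram_assumption T x c2 gamma0 ->
      (* redundant when gamma0 ^+ 2 <= T, where gram_assumption gives it *)
      c2^-1 <= sigma_min (gram x T) ->
      radius_assumption T x c3 ->
      neyman_regret T (sigmoid_ftrl T phi) x y
        <= C * (Num.sqrt T%:R)^-1 * max_enorm T x.
Proof.
have hc1 : 0 < c1 by exact: lt_le_trans hc0 hc01.
pose K := Num.max 1 (c3 ^+ 2).
have K1 : 1 <= K by rewrite le_max lexx.
pose C1 := Num.max 1 (regret_const b1 b2 c0 c1 c2 gamma0 K).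
have C10 : 0 < C1 by rewrite lt_max ltr01.
have s0 : 0 <= Num.sqrt c2 by exact: sqrtr_ge0.
exists (C1 * (1 + Num.sqrt c2)); first by rewrite mulr_gt0// ltr_pwDl.
move=> phi sc [//|n] d _ d1 x y outcome gramA gramT radiusA.
set r := Num.sqrt n.+1%:R; set M := max_enorm n.+1 x.
have r0 : 0 < r := horizon_sqrt_gt0 R n.
have T0 : 0 < n.+1%:R :> R by rewrite ltr0n.
have gram_ge t : (0 < t <= n)%N -> r * gamma0 <= t%:R ->
    forall v, t%:R / c2 * dotp v v <= \sum_(s < t) dotp (x s) v ^+ 2.
  move=> /andP[t0 tn] late v; rewrite [t%:R / c2]mulrC.
  by apply: gram_form_ge => //; apply: gramA => //; rewrite t0 leqW.
have gram_final v : n.+1%:R / c2 * dotp v v <= \sum_(s < n.+1) dotp (x s) v ^+ 2.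
  by rewrite [_ / c2]mulrC; exact: gram_form_ge.
have M1 : 1 <= Num.sqrt c2 * M := max_enorm_ge d1 hc2 gram_final.
have M0 : 0 <= M by exact: bigmax_ge_id.
have radius_le_max : radius x n <= Num.max 1 M.
  apply: bigmax_le => [|s _]; first by rewrite le_max lexx.
  by rewrite le_max (le_bigmax _ (fun s : 'I_n.+1 => enorm (x s)) s) orbT.
have radius_le : radius x n <= (1 + Num.sqrt c2) * M.
  by apply: (le_trans radius_le_max); rewrite ge_max; have := mulr_ge0 s0 M0; lra.
have M2 : M ^+ 2 <= c3 ^+ 2 * r.
  have -> : c3 ^+ 2 * r = (c3 * n.+1%:R `^ (4%:R^-1)) ^+ 2.
    rewrite exprMn -[X in _ = _ * X]powR_mulrn ?powR_ge0// -powRrM.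
    by rewrite /r -powR12_sqrt ?ler0n//; congr (_ * _ `^ _); field.
  by rewrite lerXn2r ?nnegrE// ?mulr_ge0 ?powR_ge0// ltW.
have radius2 : radius x n ^+ 2 <= K * r.
  have rho0 := radius_gt0 x n.
  apply: (@le_trans _ _ (Num.max 1 M ^+ 2)).
    by rewrite lerXn2r ?nnegrE ?(ltW rho0)// le_max ler01.
  rewrite /Num.max; case: ifP => _.
    by apply: (le_trans M2); rewrite ler_wpM2r ?(ltW r0)// le_max lexx orbT.
  rewrite expr1n -[leLHS]mulr1; apply: ler_pM => //; exact: (horizon_sqrt_ge1 R n).
have moment4 k : \sum_(t < n.+1) y k t ^+ 4 <= c1 ^+ 4 * n.+1%:R.
  have [_ _] := outcome k => /le_pow4_of_root h.
  rewrite -ler_pdivrMr// mulrC; apply: h; last exact: ltW.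
  rewrite mulr_ge0 ?invr_ge0 ?(ltW T0)//.
  by apply: sumr_ge0 => t _; rewrite exprn_even_ge0.
have fit_error k b : c0 ^+ 2 * n.+1%:R <= \sum_(t < n.+1) (y k t - dotp (x t) b) ^+ 2.
  have S0 : 0 <= \sum_(t < n.+1) (y k t - dotp (x t) b) ^+ 2.
    by apply: sumr_ge0 => t _; exact: sqr_ge0.
  have [best _ _] := outcome k.
  have : c0 <= Num.sqrt (n.+1%:R^-1 * \sum_(t < n.+1) (y k t - dotp (x t) b) ^+ 2).
    apply: (le_trans best); apply: ge_inf; last by exists b.
    by exists 0 => _ [b' _ <-]; exact: sqrtr_ge0.
  rewrite -(@ler_pXn2r _ 2) ?nnegrE ?sqrtr_ge0 ?(ltW hc0)//.
  by rewrite sqr_sqrtr ?mulr_ge0 ?invr_ge0 ?(ltW T0)// ler_pdivlMl// mulrC.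
have := scaled_regret_le hb1 hb2 hc0 hc1 hc2 hgamma0 K1 sc radius2 gram_ge gram_final
  moment4 fit_error.
rewrite -/r => scaled.
rewrite /neyman_regret -(ler_pM2l T0) mulrBr !mulrA -expr2.
apply: (le_trans scaled).
apply: (@le_trans _ _ (C1 * (r * radius x n))).
  by rewrite ler_wpM2r ?mulr_ge0 ?(ltW r0) ?(ltW (radius_gt0 _ _))// le_max lexx orbT.
have -> : n.+1%:R * C1 * (1 + Num.sqrt c2) / r * M =
    C1 * (r * ((1 + Num.sqrt c2) * M)).
  have <- : r ^+ 2 = n.+1%:R := horizon_sqrt_sqr R n.
  by field; rewrite gt_eqF.
by rewrite !ler_wpM2l// ltW.
Qed.
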